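(* Let $d>1$, let $\{f_n\}_{n\in\mathbb{N}}$ be a $d$-decaying Gauss like iterated function system, let $0<c<1$, and let $\varphi$ be the potential function with $\varphi(j)=e^{j^c}$ for all $j\ge 1$. (I) When $\Phi(n)=e^{n^\alpha}$ with $\alpha>0$: (I-1) $\dim_H E_\varphi(\Phi)=1$ if $\alpha<1$ and $\{f_n\}$ satisfies the bounded distortion property; (I-2) $\dim_H E_\varphi(\Phi)=\frac{1-c}{d}$ if $\alpha>1$. (II) When $\Phi(n)=e^{\beta^n}$ with $\beta>1$, $\dim_H E_\varphi(\Phi)=\frac{1-c}{d}$. (III) When $\Phi(n)=e^{e^{\gamma^n}}$ with $\gamma>1$, $\dim_H E_\varphi(\Phi)=\frac{1-c}{d\gamma-(1-c)(\gamma-1)}$.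
   Context: $\mathbb{N}=\{1,2,\dots\}$; $\dim_H$ denotes Hausdorff dimension. Let $d>1$ be real. A family $\{f_n\}_{n\in\mathbb{N}}$ of $C^1$ maps from $[0,1]$ to itself is a $d$-decaying Gauss like iterated function system if: (1) for any $i\ne j$ in $\mathbb{N}$, $f_i((0,1))\cap f_j((0,1))=\emptyset$; (2) $\bigcup_{i=1}^\infty f_i([0,1])=[0,1)$; (3) if $f_i(x)<f_j(x)$ for all $x\in(0,1)$ then $i<j$; (4) there exist $m\in\mathbb{N}$ and $0<A<1$ such that for all $(a_1,\dots,a_m)\in\mathbb{N}^m$ and all $x\in[0,1]$, $0<|(f_{a_1}\circ\cdots\circ f_{a_m})'(x)|\le A<1$; (5) for any $\delta>0$ there are constants $K_1=K_1(\delta)>0$, $K_2=K_2(\delta)>0$ such that for each $i\in\mathbb{N}$ there exist constants $\xi_i,\lambda_i$ with $\frac{K_1}{i^{d+\delta}}\le \xi_i\le |f_i'(x)|\le\lambda_i\le \frac{K_2}{i^{d-\delta}}$ for all $x\in[0,1]$. The basic interval of order $n$ of a word $a_1\cdots a_n\in\mathbb{N}^n$ is $I_n(a_1,\dots,a_n)=f_{a_1}\circ\cdots\circ f_{a_n}([0,1])$, and $|I|$ is the diameter of an interval $I$. All but countably many $x\in[0,1]$ have a unique symbolic expansion $(a_1(x),a_2(x),\dots)\in\mathbb{N}^{\mathbb{N}}$ with $x=\lim_{n\to\infty}f_{a_1(x)}\circ\cdots\circ f_{a_n(x)}(1)$. Bounded distortion property: there exist constants $K_3,K_4>0$ such that for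 any two finite words $a_1\cdots a_n$ and $b_1\cdots b_m$ over $\mathbb{N}$, $K_3\le \frac{|I_{n+m}(a_1,\dots,a_n,b_1,\dots,b_m)|}{|I_n(a_1,\dots,a_n)|\cdot|I_m(b_1,\dots,b_m)|}\le K_4$. A potential function is a function $\varphi:[0,1]\to\mathbb{R}_+$ that is constant on the interior of each $I_1(j)$, $j\in\mathbb{N}$; $\varphi(j)$ denotes this constant value. Its Birkhoff sums are $S_n\varphi(x)=\sum_{k=1}^n\varphi(a_k)$ if $x\in I_n(a_1,\dots,a_n)$; these are well defined outside a countable set (which does not affect Hausdorff dimension). For $\Phi:\mathbb{N}\to\mathbb{R}_+$, $E_\varphi(\Phi)=\{x\in(0,1):\lim_{n\to\infty}S_n\varphi(x)/\Phi(n)=1\}$. *)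

(* Defs.v *)
From mathcomp Require Import all_boot all_order all_algebra.
From mathcomp Require Import all_classical all_reals all_analysis.

Set Implicit Arguments.
Unset Strict Implicit.
Unset Printing Implicit Defensive.

Import Order.TTheory GRing.Theory Num.Theory.
Import numFieldNormedType.Exports.

Local Open Scope classical_set_scope.
Local Open Scope ring_scope.

(** * Hausdorff dimension of subsets of the line *)

(* Extended-real valued, because [sup] is 0 on unbounded sets of reals; the
   extra point 0 makes the diameter of the empty set equal to 0. *)
Definition diam (R : realType) (A : set R) : \bar R :=
  ereal_sup (0%E |` [set `|p.1 - p.2|%:E | p in A `*` A]).

(* |U|^s, with the usual convention that the empty set weighs 0 also for s = 0
   (the library has 0 `^ 0 = 1). *)
Definition hausdorff_gauge (R : realType) (s : R) (U : set R) : \bar R :=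
  if U == set0 then 0%E else (diam U `^ s)%E.

Definition hausdorff_premeasure (R : realType) (s e : R) (A : set R) : \bar R :=
  ereal_inf [set (\sum_(0 <= i <oo) hausdorff_gauge s (U i))%E
    | U in [set U : nat -> set R |
        A `<=` \bigcup_i U i /\ (forall i, (diam (U i) <= e%:E)%E)]].

(* The premeasure is nonincreasing in e, so its limit as e tends to 0 is the
   supremum over e > 0. *)
Definition hausdorff_measure (R : realType) (s : R) (A : set R) : \bar R :=
  ereal_sup [set hausdorff_premeasure s e A | e in [set e : R | 0 < e]].

Definition hausdorff_dim (R : realType) (A : set R) : \bar R :=
  ereal_inf [set s%:E | s in [set s : R | 0 <= s /\ hausdorff_measure s A = 0%E]].

(** * C^1 maps of the closed unit interval *)

(* A map of [0, 1] is represented by a function R -> R of which only the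
   restriction to [0, 1] matters, so difference quotients are restricted to
   [0, 1]; the derivative is thus one-sided at 0 and 1. *)
Definition diff_quot (R : realType) (g : R -> R) (x y : R) : R :=
  (g y - g x) / (y - x).

Definition deriv01 (R : realType) (g : R -> R) (x : R) : R :=
  lim (diff_quot g x @ within `[0, 1] x^').

Definition C1_01 (R : realType) (g : R -> R) : Prop :=
  (forall x : R, x \in `[0, 1] -> cvg (diff_quot g x @ within `[0, 1] x^')) /\
  {within `[0, 1], continuous (deriv01 g)}.

(** * Gauss like iterated function systems *)

(* Digits range over the positive integers: the value at 0 of a family
   [f : nat -> R -> R] is never used. *)
Definition word (w : seq nat) : bool :=
  (0 < size w)%N && all (fun i => 0 < i)%N w.

Definition ifs_comp (R : realType) (f : nat -> R -> R) (w : seq nat) : R -> R :=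
  foldr (fun i g => f i \o g) idfun w.

Record decaying_gauss_like_ifs (R : realType) (d : R) (f : nat -> R -> R) : Prop :=
  DecayingGaussLikeIFS {
    ifs_self_map : forall i, (0 < i)%N -> f i @` `[0, 1] `<=` `[0, 1];
    ifs_C1 : forall i, (0 < i)%N -> C1_01 (f i);
    ifs_disjoint : forall i j, (0 < i)%N -> (0 < j)%N -> i <> j ->
      f i @` `]0, 1[ `&` f j @` `]0, 1[ = set0;
    ifs_cover :
      \bigcup_(i in [set i | (0 < i)%N]) (f i @` `[0, 1]) = `[0, 1[%classic;
    ifs_order : forall i j, (0 < i)%N -> (0 < j)%N ->
      (forall x : R, x \in `]0, 1[ -> f i x < f j x) -> (i < j)%N;
    ifs_contraction : exists m (A : R), [/\ (0 < m)%N, 0 < A, A < 1 &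
      forall w, word w -> size w = m -> forall x : R, x \in `[0, 1] ->
        0 < `|deriv01 (ifs_comp f w) x| <= A];
    ifs_decay : forall delta : R, 0 < delta ->
      exists K1 K2 : R, [/\ 0 < K1, 0 < K2 &
        forall i, (0 < i)%N -> exists xi lambda : R,
          forall x : R, x \in `[0, 1] ->
            [/\ K1 / i%:R `^ (d + delta) <= xi,
                xi <= `|deriv01 (f i) x|,
                `|deriv01 (f i) x| <= lambda &
                lambda <= K2 / i%:R `^ (d - delta)]]
  }.

Definition basic_interval (R : realType) (f : nat -> R -> R) (w : seq nat) : set R :=
  ifs_comp f w @` `[0, 1].

Definition basic_length (R : realType) (f : nat -> R -> R) (w : seq nat) : R :=
  fine (diam (basic_interval f w)).

Definition bounded_distortion (R : realType) (f : nat -> R -> R) : Prop :=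
  exists K3 K4 : R, [/\ 0 < K3, 0 < K4 &
    forall v w, word v -> word w ->
      K3 <= basic_length f (v ++ w) / (basic_length f v * basic_length f w) <= K4].

(* The digit a_k of an expansion is [a k.-1]. *)
Definition symbolic_expansion (R : realType) (f : nat -> R -> R)
    (a : nat -> nat) (x : R) : Prop :=
  (forall k, (0 < a k)%N) /\ (forall n, (0 < n)%N -> basic_interval f (mkseq a n) x).

(** * Potentials and Birkhoff sums *)

Definition potential (R : realType) (f : nat -> R -> R) (phi : R -> R) : Prop :=
  (forall x : R, x \in `[0, 1] -> 0 <= phi x) /\
  (forall j, (0 < j)%N -> forall x y,
    interior (basic_interval f [:: j]) x -> interior (basic_interval f [:: j]) y ->
    phi x = phi y).

(* phi(j): the value of phi on the interior of I_1(j). *)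
Definition potential_value (R : realType) (f : nat -> R -> R) (phi : R -> R)
    (j : nat) : R :=
  xget 0 (phi @` interior (basic_interval f [:: j])).

Definition birkhoff_sum (R : realType) (f : nat -> R -> R) (phi : R -> R)
    (a : nat -> nat) (n : nat) : R :=
  \sum_(k < n) potential_value f phi (a k).

(* The countably many points with two expansions belong to the level set as
   soon as one of the expansions qualifies. *)
Definition birkhoff_level_set (R : realType) (f : nat -> R -> R) (phi : R -> R)
    (Phi : nat -> R) : set R :=
  [set x : R | (x \in `]0, 1[) /\ exists a, symbolic_expansion f a x /\
    (fun n => birkhoff_sum f phi a n / Phi n) @ \oo --> (1 : R)].

(* Main.v *)
(** By the mean value theorem f_i contracts distances by a factor between
    K1 / i^(d+delta) and K2 / i^(d-delta), so cylinders have size about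
    (a_1 ... a_n)^(-d), and the first-order cylinders tile [0, 1) from left to
    right, so consecutive digits give adjacent cylinders.

    When Phi(n) / Phi(n+1) -> 0, the condition S_n / Phi(n) -> 1 amounts to
    phi(a_n) / Phi(n) -> 1, i.e. a_n^c - log Phi(n) -> 0: the n-th digit ranges
    over an interval of about a_n^(1-c) integers near (log Phi(n))^(1/c).  The
    natural covers by unions of adjacent cylinders and a homogeneous Moran
    construction give the same exponent, which depends only on the limit ratio G
    of the partial sums of log log Phi(n): G = 1 in (I-2) and (II), G = gamma in
    (III).

    When alpha < 1 in (I), bounded distortion and the identity "the cylinders of
    order n have total length 1" yield, for each s < 1, a finite family of words
    of equal length with s-dimensional mass larger than 1.  Concatenating them
    freely, with one digit inserted between consecutive words, gives dimension at
    least s; the inserted digit is 2 except at about k^beta of the first k places,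
    alpha < beta < 1, where it is chosen greedily so that S_n follows
    exp(n^alpha).  These large digits cost only exp(o(k)) in length.

    Lower bounds need no measure: if the averaged masses of a countable cover sum
    to less than 1 over a finitely branching tree, one can walk down the tree
    keeping that sum below 1, and the branch obtained avoids the cover. *)

Require Import Defs.
From mathcomp Require Import all_boot all_order all_algebra.
From mathcomp Require Import all_classical all_reals all_analysis.
From mathcomp Require Import ring lra zify.

Set Implicit Arguments.
Unset Strict Implicit.
Unset Printing Implicit Defensive.

Import Order.TTheory GRing.Theory Num.Theory.
Import numFieldNormedType.Exports.

Local Open Scope classical_set_scope.
Local Open Scope ring_scope.

(** * Real inequalities *)

Section RealBounds.
Context {R : realType}.
Implicit Types (t q c L x y : R).

(** Write q = 1/c, t_k = log log Phi(k+1) and T_k = t_0 + ... + t_(k-1). The digit a_k is near e^(q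
    t_k) and has about e^((q-1) t_k) possible values. Fixing the digits before a_n and joining all
    admissible values of a_n gives about e^((q-1) T_n) sets of diameter about e^(-d q T_n)
    e^((q-1-dq) t_n). Since t_n / T_n tends to G - 1, the critical exponent solves q - 1 = s (d q G
    - (q-1)(G-1)); multiplying by c gives the stated values. Lipschitz constants contribute factors
    e^(O(n)), which are absorbed because T_n grows faster than n. In the slow regime lengths are
    only exponential in the number of blocks, so a constant lost in each block matters. The family
    of words is therefore chosen after the distortion constant is known, with enough surplus mass to
    pay for that constant and for one digit 2 inserted in each block. *)

Lemma powR_expR x y : expR x `^ y = expR (x * y).
Proof. by rewrite /powR gt_eqF ?expR_gt0// expRK mulrC. Qed.

(** A Bernoulli inequality for every positive base: it combines [ln u >= 1 - u^-1] with
    [expR z >= 1 + z]. *)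
Lemma powR_ge1D_inv u q : 0 < u -> 0 <= q -> 1 + q * (1 - u^-1) <= u `^ q.
Proof.
move=> u0 q0; rewrite /powR gt_eqF//; apply: le_trans (expR_ge1Dx _).
rewrite lerD2l ler_wpM2l// -[leRHS]opprK -lnV//.
have h : ln (1 + (u^-1 - 1)) <= u^-1 - 1.
  by apply: le_ln1Dx; rewrite ltrBrDr addNr invr_gt0.
by rewrite addrCA subrr addr0 in h; lra.
Qed.

(** Used with [c * q = 1] to count the integers j such that [j ^ c] is within 1 of L; the summand 2
    absorbs the rounding of both ends. *)
Lemma powR_gap q : 1 <= q -> exists2 C, 0 < C & forall L, 3 <= L ->
  (L + 1) `^ q - (L - 1) `^ q + 2 <= C * L `^ (q - 1).
Proof.
move=> q1; exists (3 * q * 2 `^ q + 2).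
  by rewrite addr_gt0// mulr_gt0 ?powR_gt0//; lra.
move=> L L3; have L0 : 0 < L by lra.
have h := @powR_ge1D_inv ((L - 1) / (L + 1)) q _ _.
have {}h : 1 - q * (2 / (L - 1)) <= ((L - 1) / (L + 1)) `^ q.
  have -> : 1 - q * (2 / (L - 1)) = 1 + q * (1 - ((L - 1) / (L + 1))^-1).
    by field; apply/andP; split; rewrite gt_eqF//; lra.
  by apply: h; [rewrite divr_gt0//; lra|lra].
have e : (L - 1) `^ q = (L + 1) `^ q * ((L - 1) / (L + 1)) `^ q.
  rewrite -powRM; [|lra|by rewrite divr_ge0//; lra].
  by congr (_ `^ _); field; rewrite gt_eqF//; lra.
have h1 : (L + 1) `^ q <= 2 `^ q * L `^ q.
  rewrite -powRM//; last lra.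
  by rewrite ge0_ler_powR ?nnegrE//; lra.
have Lq : L `^ q = L * L `^ (q - 1) by rewrite mulr_powRB1//; lra.
have X0 : 0 <= L `^ (q - 1) by exact: powR_ge0.
have X1 : 1 <= L `^ (q - 1) by rewrite -[leLHS](powRr0 L) ler_powR//; lra.
have h2 : (L + 1) `^ q * (q * (2 / (L - 1))) <= 3 * q * 2 `^ q * L `^ (q - 1).
  rewrite (@le_trans _ _ (2 `^ q * L `^ q * (q * (2 / (L - 1)))))//.
    by rewrite ler_wpM2r// mulr_ge0 ?divr_ge0//; lra.
  rewrite Lq (_ : 2 `^ q * (L * L `^ (q - 1)) * (q * (2 / (L - 1))) =
    (q * 2 `^ q * L `^ (q - 1)) * (L * 2 / (L - 1))); last by ring.
  rewrite (_ : 3 * q * 2 `^ q * L `^ (q - 1) = (q * 2 `^ q * L `^ (q - 1)) * 3); last by ring.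
  rewrite ler_wpM2l ?mulr_ge0 ?powR_ge0//; first lra.
  by rewrite ler_pdivrMr; lra.
have : (L + 1) `^ q * (1 - q * (2 / (L - 1))) <= (L - 1) `^ q.
  by rewrite e ler_wpM2l ?powR_ge0.
rewrite mulrBr mulr1 mulrDl; lra.
Qed.

Lemma powR_concave_gap c x y : 0 < c -> c <= 1 -> 0 < x -> 0 <= y ->
  (x + y) `^ c - x `^ c <= y * x `^ (c - 1).
Proof.
move=> c0 c1 x0 y0.
have -> : x + y = x * (1 + y / x) by field; rewrite gt_eqF.
have yx : 0 <= y / x by rewrite divr_ge0// ltW.
rewrite powRM; [|exact: ltW|by rewrite addr_ge0].
have h : (1 + y / x) `^ c <= 1 + y / x.
  by rewrite -[leRHS]powRr1 ?ler_powR ?lerDl// addr_ge0.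
have xc : x `^ c = x * x `^ (c - 1) by rewrite mulr_powRB1// ltW.
have h2 : x `^ c * (1 + y / x) `^ c <= x `^ c * (1 + y / x).
  by rewrite ler_wpM2l ?powR_ge0.
have -> : y * x `^ (c - 1) = x `^ c * (y / x) by rewrite xc; field; rewrite gt_eqF.
lra.
Qed.

Lemma ler_powR2r (r x y : R) : 0 <= r -> 0 <= x -> x <= y -> x `^ r <= y `^ r.
Proof.
by move=> r0 x0 xy; rewrite ge0_ler_powR ?nnegrE// (le_trans x0).
Qed.

Lemma dist_in_itv (a b x y : R) : x \in `[a, b] -> y \in `[a, b] -> `|x - y| <= b - a.
Proof.
rewrite !in_itv/= => /andP[? ?] /andP[? ?].
by rewrite ler_norml; apply/andP; split; lra.
Qed.

Lemma truncn_ge_half x : 1 <= x -> x / 2 <= (Num.truncn x)%:R.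
Proof.
move=> x1; have /andP[h1 h2] := truncn_itv (le_trans ler01 x1).
have : (1 <= Num.truncn x)%N by rewrite -(@ler_nat R) leNgt; apply/negP => h;
  move: h2; rewrite -natr1; move: h; rewrite ltr_nat ltnS leqn0 => /eqP ->; lra.
by rewrite -(@ler_nat R); move: h2; rewrite -natr1; lra.
Qed.

Lemma bounded_below_of_near (E : nat -> R) : (\forall k \near \oo, 0 <= E k) ->
  exists B, forall k, B <= E k.
Proof.
case=> N _ hN; suff [B hB] : exists B, forall k, (k < N)%N -> B <= E k.
  exists (Num.min B 0) => k; have [kN|Nk] := ltnP k N.
    by rewrite ge_min hB.
  by rewrite ge_min (hN k) ?orbT.
elim: N {hN} => [|N [B hB]]; first by exists 0.
exists (Num.min B (E N)) => k; rewrite ltnS leq_eqVlt => /predU1P[->|/hB h].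
  by rewrite ge_min lexx orbT.
by rewrite ge_min h.
Qed.

Lemma mulr_le_norm (a x y : R) : 0 <= x -> x <= y -> x * a <= `|a| * y.
Proof.
move=> x0 xy; rewrite mulrC (le_trans (ler_wpM2r x0 (ler_norm a)))//.
by rewrite ler_wpM2l.
Qed.

Lemma expr_small (r e : R) : 0 < r -> r < 1 -> 0 < e -> exists k, r ^+ k <= e.
Proof.
move=> r0 r1 e0; have rn1 : `|r| < 1 by rewrite ger0_norm ?ltW.
have /cvgrPdist_le/(_ e e0)[k _ /(_ k)] := cvg_expr rn1.
rewrite /= leqnn sub0r normrN => /(_ isT) h.
by exists k; apply: le_trans h; rewrite ler_norm.
Qed.

Lemma powR_unbounded (b : R) : 0 < b -> forall M, \forall k \near \oo, M <= k%:R `^ b.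
Proof.
move=> b0 M; have := @nbhs_infty_ger R (Num.max M 1 `^ b^-1); apply: filterS => k h.
rewrite (@le_trans _ _ (Num.max M 1))// ?le_max ?lexx//.
have -> : Num.max M 1 = (Num.max M 1 `^ b^-1) `^ b.
  by rewrite -powRrM mulVf ?lt0r_neq0// powRr1// le_max ler01 orbT.
by rewrite ge0_ler_powR ?nnegrE ?powR_ge0// ltW.
Qed.

Lemma ln_le_powR (b y : R) : 0 < b -> 0 < y -> ln y <= y `^ b / b.
Proof.
move=> b0 y0; rewrite ler_pdivlMr// mulrC -ln_powR.
have p0 := powR_gt0 b y0.
have h : ln (1 + (y `^ b - 1)) <= y `^ b - 1.
  by apply: le_ln1Dx; rewrite ltrBrDr addNr.
by move: h; rewrite addrCA subrr addr0 => /le_trans; apply; rewrite gerDl oppr_le0.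
Qed.

Lemma geometric_le (r : R) m : 0 < r -> r < 1 -> \sum_(i < m) r ^+ i <= (1 - r)^-1.
Proof.
move=> r0 r1; have r1' : 0 < 1 - r by lra.
rewrite -[leRHS]mulr1 ler_pdivlMl//.
have := subrX1 r m; have := exprn_ge0 m (ltW r0); lra.
Qed.

Lemma expr_unbounded (b : R) : 1 < b -> forall M, \forall k \near \oo, M <= b ^+ k.
Proof.
move=> b1 M; have b0 : 0 < ln b by rewrite ln_gt0.
have := @nbhs_infty_ger R (M / ln b); apply: filterS => k.
rewrite ler_pdivrMr// => h; rewrite -[b]lnK ?posrE; last lra.
rewrite -expRM_natl; apply: le_trans (expR_ge1Dx _); lra.
Qed.

End RealBounds.

(** * Sums dominated by their last term *)

Section BirkhoffRatio.
Context {R : realType} (u P : nat -> R).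
Hypotheses (P_gt0 : forall n, 0 < P n) (u_ge0 : forall n, 0 <= u n)
  (P_ratio : (fun n => P n / P n.+1) @ \oo --> (0 : R)).
Let S n := \sum_(k < n) u k.

Lemma last_term_ratio : (fun n => S n / P n) @ \oo --> (1 : R) ->
  (fun n => u n / P n.+1) @ \oo --> (1 : R).
Proof.
move=> SP; have -> : (fun n => u n / P n.+1) =
    (fun n => S n.+1 / P n.+1 - (S n / P n) * (P n / P n.+1)).
  apply/funext => n; rewrite /S big_ord_recr/=; field.
  by rewrite !gt_eqF.
suff : (fun n => S n.+1 / P n.+1 - (S n / P n) * (P n / P n.+1)) @ \oo --> (1 - 1 * 0 : R).
  by rewrite mulr0 subr0.
apply: cvgB; last exact: cvgM.
by rewrite (cvg_shiftS (fun n => S n / P n)).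
Qed.

Lemma sum_ratio : (fun n => u n / P n.+1) @ \oo --> (1 : R) ->
  (fun n => S n / P n) @ \oo --> (1 : R).
Proof.
move=> uP; have rec n : S n.+1 / P n.+1 = (S n / P n) * (P n / P n.+1) + u n / P n.+1.
  by rewrite /S big_ord_recr/=; field; rewrite !gt_eqF.
have S0 n : 0 <= S n / P n by rewrite divr_ge0 ?sumr_ge0// ltW.
have q0 n : 0 <= P n / P n.+1 by rewrite divr_ge0// ltW.
have [N _ hN] : \forall n \near \oo, P n / P n.+1 <= 2^-1 /\ u n / P n.+1 <= 2.
  near=> n; split; near: n.
    by apply: (cvgr_le (0 : R)) => //; rewrite invr_gt0.
  by apply: (cvgr_le (1 : R)) => //; lra.
(* Once consecutive values of P have ratio at most 1/2 and the last term is at most 2, any bound B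
   >= 4 propagates, as B / 2 + 2 <= B. *)
pose B := Num.max (S N / P N) 4.
have bound n : (N <= n)%N -> S n / P n <= B.
  elim: n => [|n IH]; first by rewrite leqn0 => /eqP <-; rewrite le_max lexx.
  rewrite leq_eqVlt => /predU1P[<-|]; first by rewrite le_max lexx.
  rewrite ltnS => Nn; have [h1 h2] := hN n Nn; rewrite rec.
  have B4 : 4 <= B by rewrite le_max lexx orbT.
  have : (S n / P n) * (P n / P n.+1) <= B * 2^-1 by rewrite ler_pM// IH.
  lra.
rewrite -(cvg_shiftS (fun n => S n / P n)).
have -> : (fun n => S n.+1 / P n.+1) =
  (fun n => (S n / P n) * (P n / P n.+1) + u n / P n.+1) by apply/funext => n.
suff : (fun n => (S n / P n) * (P n / P n.+1) + u n / P n.+1) @ \oo --> (0 + 1 : R).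
  by rewrite add0r.
apply: cvgD => //.
apply: (@squeeze_cvgr _ _ _ _ (fun=> 0) (fun n => B * (P n / P n.+1))).
- near=> n; rewrite mulr_ge0//= ler_wpM2r// bound//.
  by near: n; exists N.
- exact: cvg_cst.
- suff : (fun n => B * (P n / P n.+1)) @ \oo --> (B * 0 : R) by rewrite mulr0.
  by apply: cvgM => //; exact: cvg_cst.
Unshelve. all: by end_near. Qed.

End BirkhoffRatio.

(** * Hausdorff measure *)

Section Diameter.
Context {R : realType}.
Implicit Types (A : set R) (s r : R).

Lemma diam_ge0 A : (0 <= diam A)%E.
Proof. by apply: ereal_sup_ubound; left. Qed.

Lemma diam_le A r : 0 <= r -> (forall x y, A x -> A y -> `|x - y| <= r) ->
  (diam A <= r%:E)%E.
Proof.
move=> r0 Ar; apply: ge_ereal_sup => _ [->|[[x y] [/= Ax Ay] <-]];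
  by rewrite lee_fin// Ar.
Qed.

Lemma diam_ge A x y : A x -> A y -> (`|x - y|%:E <= diam A)%E.
Proof. by move=> Ax Ay; apply: ereal_sup_ubound; right; exists (x, y). Qed.

Lemma diam0 : diam (set0 : set R) = 0%E.
Proof. by apply/eqP; rewrite eq_le diam_ge0 diam_le. Qed.

Lemma hausdorff_gauge_ge0 s A : (0 <= hausdorff_gauge s A)%E.
Proof. by rewrite /hausdorff_gauge; case: ifP => // _; exact: poweR_ge0. Qed.

Lemma hausdorff_gaugeE s A : 0 < s -> hausdorff_gauge s A = (diam A `^ s)%E.
Proof.
move=> s0; rewrite /hausdorff_gauge; case: eqP => // ->.
by rewrite diam0 poweR0r// gt_eqF.
Qed.

Lemma diam_le_gauge s e A : 0 < s -> 0 <= e ->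
  (hausdorff_gauge s A <= (e `^ s)%:E)%E -> (diam A <= e%:E)%E.
Proof.
move=> s0 e0; rewrite hausdorff_gaugeE// => h; rewrite leNgt; apply/negP => eA.
have := diam_ge0 A; move: h eA; case: (diam A) => [x| |] //=.
  rewrite !lee_fin lte_fin => h ex x0; move: h; rewrite leNgt.
  by rewrite gt0_ltr_powR// nnegrE// ltW.
by rewrite gt_eqF.
Qed.

Lemma hausdorff_gauge_le s r A : 0 < s -> (diam A <= r%:E)%E ->
  (hausdorff_gauge s A <= (r `^ s)%:E)%E.
Proof.
move=> s0 Ar; rewrite hausdorff_gaugeE// -poweR_EFin.
by apply: gt0_ler_poweR => //; rewrite ?ltW// ?in_itv/= leey andbT
  ?(le_trans _ Ar) ?diam_ge0.
Qed.

End Diameter.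

(** * Sets of Hausdorff measure zero *)

Section HausdorffNull.
Context {R : realType}.
Implicit Types (A : set R) (s : R).

Lemma hausdorff_null_cover s A : hausdorff_measure s A = 0%E ->
  forall eta, 0 < eta -> exists U : nat -> set R,
    [/\ A `<=` \bigcup_i U i, (forall i, (diam (U i) <= 1)%E) &
     (\sum_(0 <= i <oo) hausdorff_gauge s (U i) <= eta%:E)%E].
Proof.
move=> A0 eta eta0.
have : (hausdorff_premeasure s 1 A < eta%:E)%E.
  rewrite (@le_lt_trans _ _ 0%E) ?lte_fin// -A0.
  by apply: ereal_sup_ubound; exists 1 => //=.
move=> /ereal_inf_lt[_ [U [AU U1] <-] /ltW Ueta].
by exists U.
Qed.

(** Diameters need no separate control: each gauge is at most the total, so a total of at most
    [e ^ s] forces every diameter below e. *)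
Lemma hausdorff_null_of_covers s A : 0 < s ->
  (forall eta, 0 < eta -> exists2 U : nat -> set R, A `<=` \bigcup_i U i &
     (\sum_(0 <= i <oo) hausdorff_gauge s (U i) <= eta%:E)%E) ->
  hausdorff_measure s A = 0%E.
Proof.
move=> s0 h; apply/eqP; rewrite eq_le; apply/andP; split; last first.
  apply: le_ereal_sup_tmp; exists (hausdorff_premeasure s 1 A); first by exists 1 => /=.
  apply: le_ereal_inf_tmp => _ [U _ <-].
  by apply: nneseries_ge0 => n _ _; exact: hausdorff_gauge_ge0.
apply: ge_ereal_sup => _ [e /= e0 <-].
apply/lee_addgt0Pr => eta eta0; rewrite add0e.
have m0 : 0 < Num.min eta (e `^ s) by rewrite lt_min eta0 powR_gt0.
have [U AU Um] := h _ m0.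
apply: ge_ereal_inf; exists (\sum_(0 <= i <oo) hausdorff_gauge s (U i))%E; last first.
  by rewrite (le_trans Um)// lee_fin ge_min lexx.
exists U => //; split => // i; apply: (diam_le_gauge s0 (ltW e0)).
rewrite (@le_trans _ _ (Num.min eta (e `^ s))%:E)//; last first.
  by rewrite lee_fin ge_min lexx orbT.
apply: le_trans Um.
rewrite (le_trans _ (nneseries_lim_ge i.+1 _))//; last first.
  by move=> n _ _; exact: hausdorff_gauge_ge0.
rewrite big_nat_recr//= leeDr//.
by apply: sume_ge0 => n _; exact: hausdorff_gauge_ge0.
Qed.

(** Covers by sets of diameter at most 1 serve for both exponents, since [x ^ s] is nonincreasing in
    s there. Diameter 0 is treated apart: with s = 0 its gauge may be 1. *)
Lemma hausdorff_null_le s s' A : 0 <= s -> s < s' ->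
  hausdorff_measure s A = 0%E -> hausdorff_measure s' A = 0%E.
Proof.
move=> s0 ss' A0; have s'0 := le_lt_trans s0 ss'.
apply: hausdorff_null_of_covers => // eta eta0.
have [U [AU U1 Ueta]] := hausdorff_null_cover A0 eta0.
exists U => //; apply: le_trans Ueta; apply: lee_nneseries => [n _ _|n _].
  exact: hausdorff_gauge_ge0.
rewrite /hausdorff_gauge; case: ifP => // _.
have := U1 n; have := diam_ge0 (U n); case: (diam (U n)) => [x| |]//.
rewrite /= !lee_fin le_eqVlt => /predU1P[<- _|x0 x1].
  by rewrite powR0 ?gt_eqF// powR_ge0.
by rewrite ger_powR ?x0//= ltW.
Qed.

Lemma hausdorff_null_bigcup s (F : nat -> set R) : 0 < s ->
  (forall k, hausdorff_measure s (F k) = 0%E) ->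
  hausdorff_measure s (\bigcup_k F k) = 0%E.
Proof.
move=> s0 F0; apply: hausdorff_null_of_covers => // eta eta0.
have /choice[U hU] : forall k, exists U : nat -> set R, F k `<=` \bigcup_i U i /\
    (\sum_(0 <= i <oo) hausdorff_gauge s (U i) <= (eta / (2 ^ k.+1)%:R)%:E)%E.
  move=> k; have [|U [? _ ?]] := @hausdorff_null_cover s _ (F0 k) (eta / (2 ^ k.+1)%:R).
    by rewrite divr_gt0// ltr0n expn_gt0.
  by exists U.
have /ppcard_eqP[e] := card_esym card_nat2.
exists (fun n => U (e n).1 (e n).2).
  move=> x [k _ Fkx]; have [+ _] := hU k => /(_ _ Fkx)[i _ Ux].
  have [n _ en] : (e @` [set: nat]) (k, i).
    by rewrite image_eq.
  by exists n => //=; rewrite en.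
rewrite nneseries_esumT; last by move=> n; exact: hausdorff_gauge_ge0.
rewrite -(@reindex_esum R nat (nat * nat)%type setT setT e
  (fun p => hausdorff_gauge s (U p.1 p.2))); last exact: bij.
have -> : [set: nat * nat] = setT `*`` (fun=> setT) by apply/seteqP; split.
rewrite -(@esum_esum R nat nat setT (fun=> setT) (fun i j => hausdorff_gauge s (U i j))); last by move=> *; exact: hausdorff_gauge_ge0.
rewrite -nneseries_esumT; last first.
  by move=> n; apply: esum_ge0 => *; exact: hausdorff_gauge_ge0.
apply: le_trans (epsilon_trick0 xpredT (ltW eta0)).
apply: lee_nneseries => [n _ _|n _].
  by apply: esum_ge0 => *; exact: hausdorff_gauge_ge0.
rewrite -nneseries_esumT; last by move=> *; exact: hausdorff_gauge_ge0.
exact: (hU n).2.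
Qed.

Lemma hausdorff_null_finite_covers s A : 0 < s ->
  (forall eta, 0 < eta -> exists (T : eqType) (l : seq T) (U : T -> set R) (r : T -> R),
     [/\ forall x, A x -> exists2 t, t \in l & U t x,
         {in l, forall t, (diam (U t) <= (r t)%:E)%E} &
         \sum_(t <- l) r t `^ s <= eta]) ->
  hausdorff_measure s A = 0%E.
Proof.
move=> s0 h; apply: hausdorff_null_of_covers => // eta eta0.
have [T [l [U [r [AU Ur leta]]]]] := h _ eta0.
(* Positions past the end of the list hold the empty set, of gauge 0. *)
exists (fun i => nth set0 (map U l) i).
  move=> x /AU[t tl Ux]; exists (index t l) => //=.
  by rewrite (nth_map t) ?index_mem// nth_index.
rewrite (nneseries_split 0 (size l)); last by move=> *; exact: hausdorff_gauge_ge0.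
rewrite [X in (_ + X)%E]eseries0 ?adde0; last first.
  move=> i; rewrite add0n => li _.
  by rewrite nth_default ?size_map// /hausdorff_gauge eqxx.
apply: (@le_trans _ _ (\sum_(t <- l) r t `^ s)%:E); last by rewrite lee_fin.
rewrite add0n -sumEFin.
have -> : (\sum_(0 <= k < size l) hausdorff_gauge s (nth set0 [seq U i | i <- l] k) =
   \sum_(t <- l) hausdorff_gauge s (U t))%E.
  by rewrite -(size_map U l) -(big_nth set0 xpredT) big_map.
rewrite big_seq [leRHS]big_seq.
by apply: lee_sum => t tl; apply: hausdorff_gauge_le => //; exact: Ur.
Qed.

Lemma hausdorff_null_sub s A B : A `<=` B -> 0 < s ->
  hausdorff_measure s B = 0%E -> hausdorff_measure s A = 0%E.
Proof.
move=> AB s0 B0; apply: hausdorff_null_of_covers => // eta eta0.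
have [U [BU _ ?]] := hausdorff_null_cover B0 eta0.
by exists U => //; exact: subset_trans BU.
Qed.

Lemma hausdorff_dim_le A t : 0 <= t ->
  (forall s, t < s -> hausdorff_measure s A = 0%E) -> (hausdorff_dim A <= t%:E)%E.
Proof.
move=> t0 h; apply/lee_addgt0Pr => e e0; apply: ereal_inf_lbound.
by exists (t + e) => //; split; [lra|apply: h; lra].
Qed.

Lemma hausdorff_dim_ge A t :
  (forall s, 0 < s -> s < t -> hausdorff_measure s A <> 0%E) ->
  (t%:E <= hausdorff_dim A)%E.
Proof.
move=> h; apply: le_ereal_inf_tmp => _ [s [s0 As] <-]; rewrite lee_fin leNgt.
apply/negP => st.
(* The midpoint is positive even for s = 0, and nullness at s passes up to it. *)
by apply: (h ((s + t) / 2)); [lra|lra|apply: hausdorff_null_le As => //; lra].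
Qed.

Lemma hausdorff_dim_eq A t : 0 <= t ->
  (forall s, t < s -> hausdorff_measure s A = 0%E) ->
  (forall s, 0 < s -> s < t -> hausdorff_measure s A <> 0%E) ->
  hausdorff_dim A = t%:E.
Proof.
by move=> t0 h1 h2; apply/eqP; rewrite eq_le hausdorff_dim_le// hausdorff_dim_ge.
Qed.

End HausdorffNull.

(** * Maps of the unit interval *)

Section Calculus01.
Context {R : realType}.
Implicit Types (g : R -> R) (x l : R).

Lemma diff_quot_cvgP g x l : diff_quot g x @ within `[0, 1] x^' --> l <->
  forall e, 0 < e -> exists2 delta, 0 < delta &
    forall y, y \in `[0, 1] -> y != x -> `|x - y| < delta ->
      `|l - diff_quot g x y| <= e.
Proof.
split=> [/cvgrPdist_le h e e0|h].
  have := h e e0; rewrite near_withinE => /nbhs_ballP[delta /= d0 hd].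
  by exists delta => // y y01 yx xy; apply: hd.
apply/cvgrPdist_le => e e0; have [delta d0 hd] := h e e0.
rewrite near_withinE; apply/nbhs_ballP; exists delta => //= y xy yx y01.
exact: hd.
Qed.

Lemma is_derive1P g x l : is_derive x 1 g l <->
  forall e, 0 < e -> exists2 delta, 0 < delta &
    forall y, y != x -> `|x - y| < delta -> `|l - diff_quot g x y| <= e.
Proof.
have dqE y : y != x -> (y - x)^-1 *: (g ((y - x) *: 1 + x) - g x) = diff_quot g x y.
  by move=> yx; rewrite /diff_quot !scaler1 subrK mulrC.
split=> [[dg <-] e e0|h].
  move/cvgrPdist_le : dg => /(_ e e0)/nbhs_ballP[delta /= d0 hd].
  exists delta => // y yx xy; rewrite -dqE//; apply: (hd (y - x)) => /=.
    by rewrite /ball/= sub0r opprB.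
  by rewrite subr_eq0.
have cg : h^-1 *: ((g \o shift x) (h *: (1 : R)) - g x) @[h --> 0^'] --> l.
  apply/cvgrPdist_le => e e0; have [delta d0 hd] := h e e0.
  apply/nbhs_ballP; exists delta => //= y; rewrite /ball/= sub0r normrN => yd y0.
  have yx : y + x - x = y by exact: addrK.
  have := hd (y + x); rewrite -dqE ?yx; last by rewrite -subr_eq0 yx.
  by apply; [rewrite -subr_eq0 yx|rewrite opprD addrCA subrr addr0 normrN].
by split; [apply/cvg_ex; exists l|exact: cvg_lim].
Qed.

(** Near an interior point the restriction to [0, 1] is invisible; this identifies [deriv01] with
    the two-sided derivative that the mean value theorem and the chain rule require. *)
Lemma within01_dnbhs x : x \in `]0, 1[ -> within `[0, 1] x^' = x^'.
Proof.
move=> x01; apply/seteqP; split=> A hA; last exact: cvg_within hA.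
have : \forall y \near x^', y \in `[0, 1].
  by apply: nbhs_dnbhs; apply: filterS (near_in_itvoo x01) => y; exact: subset_itv_oo_cc.
by move=> h; apply: (@filterS2 _ x^' _ _ _ A _ hA h) => y hy yI; exact: hy.
Qed.

Lemma is_derive_deriv01 g x l : x \in `]0, 1[ -> is_derive x 1 g l ->
  deriv01 g x = l.
Proof.
move=> x01 /is_derive1P h; rewrite /deriv01 within01_dnbhs//.
apply: cvg_lim => //; rewrite -(within01_dnbhs x01).
apply/diff_quot_cvgP => e e0; have [delta d0 hd] := h e e0.
by exists delta => // y _; exact: hd.
Qed.

Lemma C1_01_is_derive g x : C1_01 g -> x \in `]0, 1[ ->
  is_derive x 1 g (deriv01 g x).
Proof.
move=> [+ _] x01; have xI : x \in `[0, 1] by apply: subset_itv_oo_cc.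
move=> /(_ x xI); rewrite /deriv01 (within01_dnbhs x01) => cg.
apply/is_derive1P => e e0; move/cvgrPdist_le : cg => /(_ e e0)/nbhs_ballP[delta /= d0 hd].
by exists delta => // y yx xy; apply: hd.
Qed.

Lemma C1_01_continuous g : C1_01 g -> {within `[0, 1], continuous g}.
Proof.
move=> [+ _]; move=> h; apply/subspace_continuousP => x xI.
have /diff_quot_cvgP := h x xI; set l := lim _ => /(_ 1 ltr01)[delta d0 hd].
apply/cvgrPdist_le => e e0; rewrite near_withinE; apply/nbhs_ballP.
have l0 : 0 < `|l| + 1 by rewrite ltr_wpDl.
exists (Num.min delta (e / (`|l| + 1))) => /=; first by rewrite lt_min d0 divr_gt0.
move=> y; rewrite /ball/= lt_min => /andP[xyd xye] yI.
have [->|yx] := eqVneq y x; first by rewrite subrr normr0 ltW.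
have q1 := hd y yI yx xyd.
have -> : g x - g y = diff_quot g x y * (x - y).
  by rewrite /diff_quot -(opprB y x) mulrN mulfVK ?subr_eq0// opprB.
rewrite normrM; have ql : `|diff_quot g x y| <= `|l| + 1.
  rewrite -(subKr l (diff_quot g x y)) (le_trans (ler_normB _ _))// lerD2l//.
rewrite (@le_trans _ _ ((`|l| + 1) * (e / (`|l| + 1))))//.
  by rewrite ler_pM// ltW.
by rewrite mulrCA divff ?mulr1// gt_eqF.
Qed.

End Calculus01.

(** * Cylinders of the iterated function system *)

Section IFSGeometry.
Context {R : realType} {d : R} {f : nat -> R -> R}.
Hypothesis hf : decaying_gauss_like_ifs d f.

(** Unlike [word], this admits the empty word, from which inductions start. *)
Definition posw (w : seq nat) := all (fun i => 0 < i)%N w.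

Lemma lip_of_deriv (g : R -> R) (a c : R) : {within `[0, 1], continuous g} ->
  (forall x : R, x \in `]0, 1[ -> is_derive x 1 g (deriv01 g x)) ->
  (forall x : R, x \in `]0, 1[ -> a <= `|deriv01 g x| <= c) ->
  forall x y : R, x \in `[0, 1] -> y \in `[0, 1] ->
    a * `|x - y| <= `|g x - g y| <= c * `|x - y|.
Proof.
move=> cg dg bg.
have main (x y : R) : x \in `[0, 1] -> y \in `[0, 1] -> x < y ->
    a * `|x - y| <= `|g x - g y| <= c * `|x - y|.
  move=> x01 y01 xy.
  have sub (z : R) : z \in `]x, y[ -> z \in `]0, 1[.
    move: x01 y01; rewrite !in_itv/= => /andP[? ?] /andP[? ?] /andP[? ?].
    by apply/andP; split; lra.
  have dg' (z : R) : z \in `]x, y[ -> is_derive z 1 g (deriv01 g z).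
    by move=> /sub; exact: dg.
  have cg' : {within `[x, y], continuous g}.
    apply: continuous_subspaceW cg => z /=; move: x01 y01.
    rewrite !in_itv/= => /andP[? ?] /andP[? ?] /andP[? ?].
    by apply/andP; split; lra.
  have [z zxy e] := MVT xy dg' cg'.
  rewrite (distrC (g x)) e (distrC x) normrM.
  by have /andP[? ?] := bg z (sub z zxy); rewrite !ler_wpM2r.
move=> x y x01 y01; have [xy|yx|->] := ltgtP x y; first exact: main.
  by rewrite distrC (distrC (g x)); exact: main.
by rewrite !subrr normr0 !mulr0 lexx.
Qed.

Lemma ifs_bilipschitz (delta : R) : 0 < delta -> exists K1 K2 : R,
  [/\ 0 < K1, 0 < K2 & forall i, (0 < i)%N ->
    forall x y : R, x \in `[0, 1] -> y \in `[0, 1] ->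
    K1 / i%:R `^ (d + delta) * `|x - y| <= `|f i x - f i y| <=
    K2 / i%:R `^ (d - delta) * `|x - y|].
Proof.
move=> d0; have [K1 [K2 [K10 K20 h]]] := ifs_decay hf d0.
exists K1, K2; split => // i i0.
apply: lip_of_deriv; first exact/C1_01_continuous/(ifs_C1 hf).
  by move=> x; exact/C1_01_is_derive/(ifs_C1 hf).
move=> x x01; have [xi [la hi]] := h i i0.
have [|h1 h2 h3 h4] := hi x; first exact: subset_itv_oo_cc.
by rewrite (le_trans h1)//= (le_trans h3).
Qed.

Lemma ifs_comp_cat u v x : ifs_comp f (u ++ v) x = ifs_comp f u (ifs_comp f v x).
Proof. by elim: u => //= i u ->. Qed.

Lemma ifs_in01 i x : (0 < i)%N -> x \in `[0, 1] -> f i x \in `[0, 1].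
Proof. by move=> i0 x01; apply: (ifs_self_map hf i0); exists x. Qed.

Lemma ifs_inj i : (0 < i)%N -> {in `[0, 1] &, injective (f i)}.
Proof.
move=> i0 x y x01 y01 e; have [K1 [K2 [K10 _ h]]] := ifs_bilipschitz ltr01.
have /andP[+ _] := h i i0 x y x01 y01.
rewrite e subrr normr0 pmulr_rle0 ?divr_gt0 ?powR_gt0 ?ltr0n//.
by rewrite normr_le0 subr_eq0 => /eqP.
Qed.

Lemma ifs_comp_in01 w x : posw w -> x \in `[0, 1] -> ifs_comp f w x \in `[0, 1].
Proof.
by elim: w => //= i w IH /andP[i0 w0] x01; exact/ifs_in01/IH.
Qed.

Lemma ifs_comp_inj w : posw w -> {in `[0, 1] &, injective (ifs_comp f w)}.
Proof.
elim: w => [_ x y //|i w IH /= /andP[i0 w0] x y x01 y01 /ifs_inj e].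
by apply: IH => //; apply: e => //; exact: ifs_comp_in01.
Qed.

Lemma ifs_comp_lipschitz w : posw w -> exists2 L, 0 < L &
  forall x y : R, x \in `[0, 1] -> y \in `[0, 1] ->
    `|ifs_comp f w x - ifs_comp f w y| <= L * `|x - y|.
Proof.
elim: w => [_|i w IH /= /andP[i0 w0]]; first by exists 1 => // x y _ _; rewrite mul1r.
have [L L0 hL] := IH w0; have [K1 [K2 [_ K20 h]]] := ifs_bilipschitz ltr01.
exists (K2 / i%:R `^ (d - 1) * L); first by rewrite mulr_gt0// divr_gt0// powR_gt0// ltr0n.
move=> x y x01 y01.
have /andP[_ h2] := h i i0 _ _ (ifs_comp_in01 w0 x01) (ifs_comp_in01 w0 y01).
rewrite (le_trans h2)// -(mulrA _ L) ler_wpM2l//; last exact: hL.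
by rewrite divr_ge0 ?powR_ge0 ?ltW.
Qed.

Lemma ifs_comp_continuous w : posw w -> {within `[0, 1], continuous (ifs_comp f w)}.
Proof.
move=> /ifs_comp_lipschitz[L L0 h]; apply/subspace_continuousP => x x01.
apply/cvgrPdist_le => e e0; rewrite near_withinE; apply/nbhs_ballP.
exists (e / L) => /=; first by rewrite divr_gt0.
move=> y /ltW xy y01; rewrite (le_trans (h _ _ x01 y01))//.
by rewrite mulrC -ler_pdivlMr.
Qed.

(** The maps may reverse orientation, so the endpoints of a cylinder have to be sorted. *)
Definition lo w := Num.min (ifs_comp f w 0) (ifs_comp f w 1).
Definition hi w := Num.max (ifs_comp f w 0) (ifs_comp f w 1).

Lemma in01_0 : (0 : R) \in `[0, 1]. Proof. by rewrite in_itv/= lexx ler01. Qed.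
Lemma in01_1 : (1 : R) \in `[0, 1]. Proof. by rewrite in_itv/= lexx ler01. Qed.

Lemma ifs_comp_mono w : posw w ->
  {in `[0, 1] &, {homo ifs_comp f w : x y / x < y}} \/
  {in `[0, 1] &, {homo ifs_comp f w : x y /~ x < y}}.
Proof.
move=> w0; exact: itv_continuous_inj_mono (ifs_comp_continuous w0) (ifs_comp_inj w0).
Qed.

Lemma ifs_compE w : posw w ->
  (lo w = ifs_comp f w 0 /\ hi w = ifs_comp f w 1 /\
     {in `[0, 1] &, {homo ifs_comp f w : x y / x < y}}) \/
  (lo w = ifs_comp f w 1 /\ hi w = ifs_comp f w 0 /\
     {in `[0, 1] &, {homo ifs_comp f w : x y /~ x < y}}).
Proof.
rewrite /lo/hi => w0; have [h|h] := ifs_comp_mono w0; [left|right].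
  have h01 := h _ _ in01_0 in01_1 ltr01.
  by rewrite min_l ?max_r ?ltW.
have h01 := h _ _ in01_1 in01_0 ltr01.
by rewrite min_r ?max_l ?ltW.
Qed.

Lemma lo_lt_hi w : posw w -> lo w < hi w.
Proof.
by case/ifs_compE => [[-> [-> h]]|[-> [-> h]]]; apply: h;
  rewrite ?in01_0 ?in01_1 ?ltr01.
Qed.

Lemma hi_sub_lo w : posw w -> hi w - lo w = `|ifs_comp f w 0 - ifs_comp f w 1|.
Proof.
move=> w0; have := lo_lt_hi w0.
case: (ifs_compE w0) => [[-> [-> h]]|[-> [-> h]]] => h1; last first.
  by rewrite ger0_norm// subr_ge0 ltW.
by rewrite distrC ger0_norm// subr_ge0 ltW.
Qed.

Lemma ifs_comp_open w x : posw w -> x \in `]0, 1[ -> lo w < ifs_comp f w x < hi w.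
Proof.
move=> w0 x01; have xI : x \in `[0, 1] by exact: subset_itv_oo_cc.
move: x01; rewrite in_itv/= => /andP[x0 x1].
by case: (ifs_compE w0) => [[-> [-> h]]|[-> [-> h]]];
  rewrite !h ?in01_0 ?in01_1.
Qed.

Lemma ifs_comp_closed w x : posw w -> x \in `[0, 1] -> lo w <= ifs_comp f w x <= hi w.
Proof.
move=> w0 xI; have : (x \in `]0, 1[) \/ (x = 0 \/ x = 1).
  move: xI; rewrite !in_itv/= !le_eqVlt eq_sym => /andP[/predU1P[->|x0]]; first by right; left.
  by move=> /predU1P[->|->]; [right; right|left; rewrite x0].
case=> [/(ifs_comp_open w0)/andP[/ltW -> /ltW ->] // |[->|->]];
  by rewrite /lo/hi ge_min le_max lexx ?orbT.
Qed.

Lemma ifs_comp_onto w y : posw w -> lo w <= y <= hi w ->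
  exists2 x, x \in `[0, 1] & ifs_comp f w x = y.
Proof. by move=> w0; apply: IVT => //; exact: ifs_comp_continuous. Qed.

Lemma ifs_comp_onto_open w y : posw w -> lo w < y < hi w ->
  exists2 x, x \in `]0, 1[ & ifs_comp f w x = y.
Proof.
move=> w0 yI; have [|x x01 xy] := @ifs_comp_onto w y w0.
  by case/andP: yI => /ltW -> /ltW ->.
exists x => //; move: x01; rewrite !in_itv/= !le_eqVlt eq_sym => /andP[/predU1P[x0|->/=]].
  move: xy yI; rewrite x0 => <-.
  by rewrite /lo/hi gt_min lt_max !ltxx/= ?orbF => /andP[/lt_trans h/h]; rewrite ltxx.
move=> /predU1P[x1|//]; move: xy yI; rewrite x1 => <-.
by rewrite /lo/hi gt_min lt_max !ltxx/= ?orbF => /andP[/lt_trans h/h]; rewrite ltxx.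
Qed.

Lemma basic_intervalE w : posw w -> basic_interval f w = [set` `[lo w, hi w]].
Proof.
move=> w0; apply/seteqP; split=> [_ [x x01 <-]|y] /=; rewrite in_itv/=.
  exact: ifs_comp_closed.
by move=> /(ifs_comp_onto w0)[x ? <-]; exists x.
Qed.

Lemma diam_basic w : posw w -> diam (basic_interval f w) = (hi w - lo w)%:E.
Proof.
move=> w0; have h := lo_lt_hi w0; apply/eqP; rewrite eq_le basic_intervalE//.
apply/andP; split.
  apply: diam_le => [|x y]; first by rewrite subr_ge0 ltW.
  rewrite /= !in_itv/= => /andP[? ?] /andP[? ?].
  by rewrite ler_norml; apply/andP; split; lra.
apply: (@le_trans _ _ `|hi w - lo w|%:E); first by rewrite lee_fin ler_norm.
by apply: diam_ge; rewrite /= in_itv/= lexx ltW.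
Qed.

Lemma basic_lengthE w : posw w -> basic_length f w = hi w - lo w.
Proof. by move=> w0; rewrite /basic_length diam_basic. Qed.

Lemma posw_cat u v : posw (u ++ v) = posw u && posw v.
Proof. exact: all_cat. Qed.

Lemma sub_lo u v : posw u -> posw v -> lo u <= lo (u ++ v).
Proof.
move=> u0 v0; rewrite {2}/lo !ifs_comp_cat le_min.
by apply/andP; split; apply: (andP (ifs_comp_closed u0 (ifs_comp_in01 v0 _))).1;
  rewrite ?in01_0 ?in01_1.
Qed.

Lemma sub_hi u v : posw u -> posw v -> hi (u ++ v) <= hi u.
Proof.
move=> u0 v0; rewrite {1}/hi !ifs_comp_cat ge_max.
by apply/andP; split; apply: (andP (ifs_comp_closed u0 (ifs_comp_in01 v0 _))).2;
  rewrite ?in01_0 ?in01_1.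
Qed.

Lemma ifs_comp_in01_open w x : posw w -> x \in `]0, 1[ -> ifs_comp f w x \in `]0, 1[.
Proof.
move=> w0 x01; have /andP[h1 h2] := ifs_comp_open w0 x01.
have := ifs_comp_in01 w0 in01_0; have := ifs_comp_in01 w0 in01_1.
move: h1 h2; rewrite !in_itv/= /lo /hi gt_min lt_max.
by move=> /orP[] ? /orP[] ? /andP[? ?] /andP[? ?]; apply/andP; split; lra.
Qed.

(** Injectivity strips the common prefix; at the first differing digit the remaining points still
    lie in ]0, 1[, so [ifs_disjoint] applies. *)
Lemma disjoint_open u v x y : size u = size v -> u != v -> posw u -> posw v ->
  x \in `]0, 1[ -> y \in `]0, 1[ -> ifs_comp f u x != ifs_comp f v y.
Proof.
elim: u v => [|i u IH] [|j v]//= [suv] uv /andP[i0 u0] /andP[j0 v0] x01 y01.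
have [ij|ij] := eqVneq i j.
  rewrite -ij; rewrite -ij eqseq_cons eqxx/= in uv.
  apply: contra_neq (IH v suv uv u0 v0 x01 y01) => /(ifs_inj i0); apply;
    exact: ifs_comp_in01 (subset_itv_oo_cc _).
apply/eqP => e; have := ifs_disjoint hf i0 j0 (elimN eqP ij).
move=> /seteqP[+ _] => /(_ (f i (ifs_comp f u x))); apply; split.
  by exists (ifs_comp f u x) => //; exact: ifs_comp_in01_open.
by rewrite e; exists (ifs_comp f v y) => //; exact: ifs_comp_in01_open.
Qed.

Lemma basic_disjoint u v : size u = size v -> u != v -> posw u -> posw v ->
  hi u <= lo v \/ hi v <= lo u.
Proof.
move=> suv uv u0 v0; have := lo_lt_hi u0; have := lo_lt_hi v0 => lv lu.
apply/orP; rewrite leNgt (leNgt (hi v)) -negb_and; apply/negP => /andP[h1 h2].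
(* The midpoint of an overlap ]a, b[ would have preimages in ]0, 1[ under both compositions. *)
pose a := Num.max (lo u) (lo v); pose b := Num.min (hi u) (hi v).
have ab : a < b by rewrite gt_max !lt_min lu lv h1 h2.
have [|x x01 xe] := @ifs_comp_onto_open u ((a + b) / 2) u0.
  have : lo u <= a by rewrite le_max lexx.
  have : b <= hi u by rewrite ge_min lexx.
  by move=> *; apply/andP; split; lra.
have [|y y01 ye] := @ifs_comp_onto_open v ((a + b) / 2) v0.
  have : lo v <= a by rewrite le_max lexx orbT.
  have : b <= hi v by rewrite ge_min lexx orbT.
  by move=> *; apply/andP; split; lra.
by have := disjoint_open suv uv u0 v0 x01 y01; rewrite xe ye eqxx.
Qed.

Lemma digit_order i j : (0 < i)%N -> (i < j)%N -> hi [:: i] <= lo [:: j].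
Proof.
move=> i0 ij; have j0 := leq_ltn_trans (leq0n i) ij.
have ui : posw [:: i] by rewrite /posw/= i0.
have uj : posw [:: j] by rewrite /posw/= j0.
have [||//|h] := @basic_disjoint [:: i] [:: j] _ _ ui uj => //.
  by rewrite eqseq_cons eqxx andbT ltn_eqF.
suff : (j < i)%N by move=> /(ltn_trans ij); rewrite ltnn.
apply: (ifs_order hf j0 i0) => x x01.
have /andP[_ h1] := ifs_comp_open uj x01; have /andP[h2 _] := ifs_comp_open ui x01.
by rewrite (lt_trans h1)// (le_lt_trans h).
Qed.

Lemma digit_cover (x : R) : 0 <= x < 1 ->
  exists j, [/\ (0 < j)%N, lo [:: j] <= x & x <= hi [:: j]].
Proof.
move=> x01; have /seteqP[_ /(_ x)] := ifs_cover hf.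
rewrite /= in_itv/= => /(_ x01)[j /= j0 [y y01 e]]; exists j.
have /andP[? ?] := @ifs_comp_closed [:: j] y (introT andP (conj j0 isT)) y01.
by split=> //; rewrite -e.
Qed.

Lemma digit_hi_lt1 j : (0 < j)%N -> hi [:: j] < 1.
Proof.
move=> j0; have /seteqP[+ _] := ifs_cover hf => h.
have H y : y \in `[0, 1] -> f j y < 1.
  move=> y01; have /= := h (f j y); rewrite in_itv/= => H.
  by have /andP[] : 0 <= f j y < 1 by apply: H; exists j => //; exists y.
by rewrite /hi/= gt_max !H// in_itv/= ?lexx ler01.
Qed.

Lemma digit_lo_ge0 j : (0 < j)%N -> 0 <= lo [:: j].
Proof.
move=> j0.
have := ifs_in01 j0 in01_0; have := ifs_in01 j0 in01_1.
by rewrite !in_itv/= /lo/= le_min => /andP[-> _] /andP[-> _].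
Qed.

Lemma digit_hi_lo j : (0 < j)%N -> hi [:: j] = lo [:: j.+1].
Proof.
move=> j0; apply/eqP; rewrite eq_le digit_order//= leNgt; apply/negP => h.
(* The middle of a gap would be covered by some I_1(k), and the order of the cylinders leaves no
   room for such a k. *)
pose x := (hi [:: j] + lo [:: j.+1]) / 2.
have xh : hi [:: j] < x by rewrite /x; lra.
have xl : x < lo [:: j.+1] by rewrite /x; lra.
have [|k [k0 kx xk]] := @digit_cover x.
  have := digit_lo_ge0 j0; have := @lo_lt_hi [:: j] (introT andP (conj j0 isT)).
  have := @digit_hi_lt1 j.+1 isT; have := @lo_lt_hi [:: j.+1] isT.
  by move=> *; apply/andP; split; lra.
have [kj|jk|kj] := ltngtP k j.
- have := digit_order k0 kj; have := @lo_lt_hi [:: j] (introT andP (conj j0 isT)); lra.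
- move: jk; rewrite leq_eqVlt => /predU1P[jk|jk]; first by rewrite -jk in kx; lra.
  by have := digit_order (ltn0Sn j) jk; have := @lo_lt_hi [:: j.+1] isT; lra.
- by rewrite -kj in xh; lra.
Qed.

(* The first-order cylinders tile [0, 1): I_1(j) = [cut j.-1, cut j]. *)
Definition cut (j : nat) : R := lo [:: j.+1].

Lemma cut_hi j : (0 < j)%N -> hi [:: j] = cut j.
Proof. exact: digit_hi_lo. Qed.

Lemma cut_lo j : (0 < j)%N -> lo [:: j] = cut j.-1.
Proof. by case: j. Qed.

Lemma cut0 : cut 0 = 0.
Proof.
apply/eqP; rewrite eq_le digit_lo_ge0// andbT.
have [|k [k0 k1 _]] := @digit_cover 0; first by rewrite lexx ltr01.
apply: le_trans k1; move: k0; rewrite leq_eqVlt => /predU1P[<-//|k1].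
by apply: le_trans (digit_order (ltn0Sn 0) k1); apply/ltW/lo_lt_hi.
Qed.

Lemma cut_ltS j : cut j < cut j.+1.
Proof. by rewrite -(@cut_hi j.+1)//; exact: lo_lt_hi. Qed.

Lemma cut_lt i j : (i < j)%N -> cut i < cut j.
Proof. by move: i j; exact: (homo_ltn lt_trans cut_ltS). Qed.

Lemma cut_le i j : (i <= j)%N -> cut i <= cut j.
Proof. by rewrite leq_eqVlt => /predU1P[->//|/cut_lt/ltW]. Qed.

Lemma cut_lt1 j : cut j < 1.
Proof. by case: j => [|j]; rewrite ?cut0 ?ltr01// -cut_hi// digit_hi_lt1. Qed.

Lemma cut_ge0 j : 0 <= cut j.
Proof. exact: digit_lo_ge0. Qed.

Lemma cut_cofinal (x : R) : x < 1 -> exists j, x <= cut j.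
Proof.
move=> x1; have [x0|x0] := ltP x 0; first by exists 0%N; rewrite cut0 ltW.
by have [|j [j0 _ h]] := @digit_cover x; [rewrite x0|exists j; rewrite -cut_hi].
Qed.

Lemma symbolic_expansion_exists (a : nat -> nat) : (forall k, 0 < a k)%N ->
  exists x : R, symbolic_expansion f a x.
Proof.
move=> a0; have aw n : posw (mkseq a n) by apply/allP => ? /mapP[k _ ->].
have mkD m n : mkseq a (m + n) = mkseq a m ++ mkseq (fun k => a (m + k)%N) n.
  rewrite /mkseq iotaD map_cat add0n; congr (_ ++ _).
  by rewrite -{1}(addn0 m) iotaDl -map_comp.
have aw' m n : posw (mkseq (fun k => a (m + k)%N) n) by apply/allP => ? /mapP[k _ ->].
have lo_mono m n : lo (mkseq a m) <= lo (mkseq a (m + n)) by rewrite mkD sub_lo.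
have hi_mono m n : hi (mkseq a (m + n)) <= hi (mkseq a m) by rewrite mkD sub_hi.
have lo_hi m n : lo (mkseq a m) <= hi (mkseq a n).
  rewrite (le_trans (lo_mono m n))// (le_trans (ltW (lo_lt_hi (aw _))))//.
  by rewrite addnC hi_mono.
pose S := range (fun n => lo (mkseq a n)).
have S_ub n : ubound S (hi (mkseq a n)) by move=> _ [m _ <-].
exists (sup S); split=> // n _; rewrite basic_intervalE//= in_itv/=; apply/andP; split.
  by apply: ub_le_sup; [exists (hi (mkseq a 0)); exact: S_ub|exists n].
by apply: ge_sup; [exists (lo (mkseq a 0)), 0%N|exact: S_ub].
Qed.

(** Level sets live in the open interval, and 0 is the left end of I_1(1); a first digit above 1
    stays clear of it. This is why the constructions below use leading digits at least 2. *)
Lemma first_digit_open a x : symbolic_expansion f a x -> (1 < a 0%N)%N -> x \in `]0, 1[.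
Proof.
move=> [a0 /(_ 1%N isT)] + a2; rewrite -[mkseq a 1]/[:: a 0%N] basic_intervalE/= ?a0// !in_itv/= => /andP[h1 h2].
apply/andP; split.
  apply: lt_le_trans h1; rewrite (cut_lo (a0 0%N)) -cut0.
  by apply: cut_lt; rewrite -subn1 subn_gt0.
by apply: le_lt_trans h2 _; exact: digit_hi_lt1.
Qed.

Lemma ifs_comp_bounds (c1 c2 : nat -> R) :
  (forall i, (0 < i)%N -> 0 <= c1 i) -> (forall i, (0 < i)%N -> 0 <= c2 i) ->
  (forall i, (0 < i)%N -> forall x y : R, x \in `[0, 1] -> y \in `[0, 1] ->
    c1 i * `|x - y| <= `|f i x - f i y| <= c2 i * `|x - y|) ->
  forall w, posw w -> forall x y : R, x \in `[0, 1] -> y \in `[0, 1] ->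
    (\prod_(i <- w) c1 i) * `|x - y| <= `|ifs_comp f w x - ifs_comp f w y| <=
    (\prod_(i <- w) c2 i) * `|x - y|.
Proof.
move=> c1ge0 c2ge0 h; elim=> [_ x y _ _|i w IH /= /andP[i0 w0] x y x01 y01].
  by rewrite !big_nil !mul1r lexx.
have /andP[h1 h2] := IH w0 x y x01 y01; rewrite !big_cons -!mulrA.
have /andP[h3 h4] := h i i0 _ _ (ifs_comp_in01 w0 x01) (ifs_comp_in01 w0 y01).
by rewrite (le_trans _ h3) ?(le_trans h4)// ler_wpM2l ?c1ge0 ?c2ge0.
Qed.

Lemma ifs_comp_is_derive w (x : R) : posw w -> x \in `]0, 1[ ->
  is_derive x 1 (ifs_comp f w) (deriv01 (ifs_comp f w) x).
Proof.
move=> w0 x01; suff [l hl] : exists l, is_derive x 1 (ifs_comp f w) l.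
  by rewrite (is_derive_deriv01 x01 hl).
elim: w w0 => [_|i w IH /= /andP[i0 w0]]; first by exists 1; exact: is_derive_id.
have [l hl] := IH w0.
exists (deriv01 (f i) (ifs_comp f w x) * l).
apply: is_derive1_comp hl; apply: C1_01_is_derive; first exact: ifs_C1 hf _ i0.
exact: ifs_comp_in01_open.
Qed.

(** Only m-fold compositions are known to contract, so a word is cut into pieces of length m, each
    contributing a factor A. *)
Lemma cylinder_shrink (e : R) : 0 < e -> exists2 n, (0 < n)%N &
  forall w, posw w -> size w = n -> hi w - lo w <= e.
Proof.
move=> e0; have [m [A [m0 A0 A1 hA]]] := ifs_contraction hf.
have contr w : posw w -> size w = m -> forall x y : R, x \in `[0, 1] -> y \in `[0, 1] ->
    `|ifs_comp f w x - ifs_comp f w y| <= A * `|x - y|.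
  move=> w0 wm; have ww : word w by rewrite /word wm m0.
  have bnd (x : R) : x \in `]0, 1[ -> 0 <= `|deriv01 (ifs_comp f w) x| <= A.
    by move=> x01; rewrite normr_ge0/=; have /andP[] := hA w ww wm x (subset_itv_oo_cc x01).
  move=> x y x01 y01; have /andP[] := lip_of_deriv (ifs_comp_continuous w0)
    (fun z z01 => ifs_comp_is_derive w0 z01) bnd x01 y01.
  by [].
have contr_iter k w : posw w -> size w = (k * m)%N ->
    forall x y : R, x \in `[0, 1] -> y \in `[0, 1] ->
    `|ifs_comp f w x - ifs_comp f w y| <= A ^+ k * `|x - y|.
  elim: k w => [|k IH] w w0 sw x y x01 y01.
    by move/size0nil : sw => ->; rewrite expr0 mul1r.
  have := cat_take_drop m w => e'; rewrite -e'.
  move: w0; rewrite -{1}e' posw_cat => /andP[w1 w2].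
  rewrite !ifs_comp_cat exprS -mulrA.
  rewrite (le_trans (contr _ w1 _ _ _ (ifs_comp_in01 w2 x01) (ifs_comp_in01 w2 y01)))//.
    by rewrite size_takel// sw mulSn leq_addr.
  by rewrite ler_wpM2l ?(ltW A0)// IH// size_drop sw mulSn addKn.
have [k Ak] := expr_small A0 A1 e0.
(* [k.+1] instead of k keeps the length positive. *)
exists (k.+1 * m)%N; first by rewrite muln_gt0.
move=> w w0 sw; rewrite hi_sub_lo// (le_trans (contr_iter _ _ w0 sw _ _ in01_0 in01_1))//.
rewrite sub0r normrN normr1 mulr1 exprS (le_trans _ Ak)//.
by rewrite ler_piMl ?exprn_ge0// ltW.
Qed.

End IFSGeometry.

Arguments lo {R} f w.
Arguments hi {R} f w.
Arguments cut {R} f j.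

(** * Trees and packings *)

Section TreeAverage.
Context {R : realType} {T : eqType} (W : nat -> seq T).
Hypothesis W_gt0 : forall k, (0 < size (W k))%N.
Implicit Types (F G : seq T -> R) (v : seq T).

Fixpoint tree_level k : seq (seq T) := if k is k'.+1 then
  [seq rcons v c | v <- tree_level k', c <- W k'] else [:: [::]].

(* The mean of F over the descendants of v that are g generations below it. *)
Fixpoint tree_avg g F v : R := if g is g'.+1 then
  (\sum_(c <- W (size v)) tree_avg g' F (rcons v c)) / (size (W (size v)))%:R
  else F v.

Lemma size_W_neq0 k : (size (W k))%:R != 0 :> R.
Proof. by rewrite pnatr_eq0 -lt0n. Qed.

Lemma tree_levelS k v c : (rcons v c \in tree_level k.+1) =
  (v \in tree_level k) && (c \in W k).
Proof.
apply/allpairsP/andP => [[[v' c'] [/= hv hc /rcons_inj[-> ->]]]//|[hv hc]].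
by exists (v, c).
Qed.

Lemma tree_level_size k v : v \in tree_level k -> size v = k.
Proof.
elim: k v => [|k IH] v; first by rewrite /= inE => /eqP ->.
by case/lastP: v => [/allpairsP[[[|? ?] ?] [_ _]]//|v c];
  rewrite tree_levelS size_rcons => /andP[/IH ->].
Qed.

Lemma tree_level_uniq k : (forall k, uniq (W k)) -> uniq (tree_level k).
Proof.
move=> Wu; elim: k => //= k IH; apply: allpairs_uniq => //.
by move=> [v c] [v' c'] _ _ /= /rcons_inj[-> ->].
Qed.

Lemma tree_level_seq k (B : nat -> T) : (forall n, B n \in W n) ->
  mkseq B k \in tree_level k.
Proof.
move=> BW; elim: k => [|k IH]; first by rewrite inE.
by rewrite -[k.+1]addn1 /mkseq iotaD map_cat cats1 addn1 tree_levelS IH BW.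
Qed.

(** The recursion averages over the children of v first; this form averages over the lowest
    generation first. *)
Lemma tree_avgS g F v : tree_avg g.+1 F v = tree_avg g (tree_avg 1 F) v.
Proof.
elim: g v => // g IH v.
by rewrite [LHS]/= [RHS]/=; congr (_ / _); apply: eq_bigr => c _; rewrite -IH.
Qed.

Lemma tree_avg_le g F G v : (forall u, F u <= G u) -> tree_avg g F v <= tree_avg g G v.
Proof.
by move=> FG; elim: g v => //= g IH v; rewrite ler_wpM2r ?invr_ge0// ler_sum.
Qed.

Lemma tree_avg_ge0 g F v : (forall u, 0 <= F u) -> 0 <= tree_avg g F v.
Proof.
by move=> F0; elim: g v => //= g IH v; rewrite divr_ge0// sumr_ge0.
Qed.

Lemma tree_avg_root k F : tree_avg k F [::] =
  (\sum_(v <- tree_level k) F v) / \prod_(i < k) (size (W i))%:R.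
Proof.
elim: k F => [|k IH] F; first by rewrite /= big_seq1 big_ord0 divr1.
rewrite tree_avgS IH big_ord_recr invfM mulrA mulrAC; congr (_ / _).
rewrite big_allpairs_dep/= mulr_suml big_seq [RHS]big_seq.
by apply: eq_bigr => v /tree_level_size <-.
Qed.

(* If the averages of countably many families of forbidden nodes sum to less
   than 1 at the root, some child inherits that property; iterating gives a
   branch avoiding all the families. *)
Lemma tree_avoid (k : nat -> nat) (C : nat -> pred (seq T)) :
  (forall i v, C i v -> size v = k i) ->
  (\sum_(0 <= i <oo) (tree_avg (k i) (fun v => (C i v)%:R) [::])%:E < 1)%E ->
  exists B : nat -> T, (forall n, B n \in W n) /\
    forall i, ~~ C i (mkseq B (k i)).
Proof.
move=> Ck root.
pose w i v := tree_avg (k i - size v) (fun v => (C i v)%:R) v.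
have w0 i v : 0 <= w i v by apply: tree_avg_ge0 => u; rewrite ler0n.
have wE0 i v : (0%:E <= (w i v)%:E)%E by rewrite lee_fin.
pose P v := (\sum_(0 <= i <oo) (w i v)%:E < 1)%E.
have P0 : P [::] by rewrite /P/w/=; under eq_eseriesr do rewrite subn0.
have w_children i v : \sum_(c <- W (size v)) w i (rcons v c) <= (size (W (size v)))%:R * w i v.
  rewrite /w; have [h|h] := ltnP (size v) (k i).
    have -> : (k i - size v = (k i - size v).-1.+1)%N by rewrite prednK// subn_gt0.
    rewrite /= mulrCA divff ?size_W_neq0// mulr1.
    by apply: ler_sum => c _; rewrite size_rcons subnS.
  (* From depth [k i] on, truncated subtraction leaves the indicator of [C i] itself, which vanishes
     at the children because [C i] only holds at depth [k i]. *)
  rewrite big1; first by rewrite mulr_ge0//; exact: w0.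
  move => c _; rewrite size_rcons.
  have -> /= : (k i - (size v).+1 = 0)%N by apply/eqP; rewrite subn_eq0 ltnW.
  case: (boolP (C i _)) => // /Ck; rewrite size_rcons => e.
  by rewrite -e ltnn in h.
have child v : P v -> exists2 c, c \in W (size v) & P (rcons v c).
  (* If every child had sum at least 1, adding up over the children would give at least their
     number, hence a sum of at least 1 at v. *)
  move=> Pv; apply: contrapT => h.
  have : ((size (W (size v)))%:R%:E <= (size (W (size v)))%:R%:E *
      \sum_(0 <= i <oo) (w i v)%:E)%E.
    rewrite -nneseriesZl// (@le_trans _ _ (\sum_(0 <= i <oo) \sum_(c <- W (size v)) (w i (rcons v c))%:E)%E)//; last first.
      apply: lee_nneseries => [i _ _|i _]; first by apply: sume_ge0 => c _; exact: wE0.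
      by rewrite sumEFin -EFinM lee_fin.
    rewrite nneseries_sum//.
    have -> : ((size (W (size v)))%:R%:E = \sum_(c <- W (size v)) (1 : \bar R))%E.
      by rewrite -sum1_size natr_sum -sumEFin.
    rewrite big_seq [leRHS]big_seq; apply: lee_sum => c cW.
    by rewrite leNgt; apply/negP => Pc; apply: h; exists c.
  apply/negP; rewrite -ltNge -[ltRHS]mule1 lte_pmul2l//.
  by rewrite lte_fin ltr0n.
have [c0 _ _] := child _ P0.
have /choice[nxt nxtP] : forall v, exists c, P v -> c \in W (size v) /\ P (rcons v c).
  move=> v; have [/child[c ? ?]|] := pselect (P v); first by exists c.
  by exists c0.
pose path := fix path n := if n is n'.+1 then rcons (path n') (nxt (path n')) else [::].
have size_path n : size (path n) = n by elim: n => //= n IH; rewrite size_rcons IH.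
have Ppath n : P (path n) by elim: n => //= n IH; exact: (nxtP _ IH).2.
exists (fun n => nxt (path n)); split=> [n|i].
  by have [+ _] := nxtP _ (Ppath n); rewrite size_path.
have -> : mkseq (fun n => nxt (path n)) (k i) = path (k i).
  by elim: (k i) => // n IH; rewrite -[n.+1]addn1 /mkseq iotaD map_cat -/(mkseq _ n) IH cats1 addn1.
(* If the branch met [C i], the i-th term alone would equal 1 at depth [k i]. *)
apply/negP => Ci; have := Ppath (k i); apply/negP; rewrite -leNgt.
apply: le_trans (nneseries_lim_ge i.+1 _) => //.
rewrite big_nat_recr//= (@le_trans _ _ (w i (path (k i)))%:E)//.
  by rewrite /w size_path subnn/= Ci.
by rewrite leeDr// sume_ge0.
Qed.

End TreeAverage.

Lemma size_tree_level (T : eqType) (W : nat -> seq T) k :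
  size (tree_level W k) = (\prod_(i < k) size (W i))%N.
Proof.
elim: k => [|k IH]; first by rewrite big_ord0.
by rewrite big_ord_recr/= size_allpairs IH.
Qed.

(** * Counting disjoint intervals that meet a small set *)

Section Packing.
Context {R : realType}.

(** After trimming to length ell, the left ends lie in a window of length r + ell starting at
    [inf U - ell], and any two are at least ell apart. Their integer parts in units of ell are
    therefore distinct and at most r / ell + 1; counting from 0 gives the 2. *)
Lemma packing (T : eqType) (s : seq T) (l h : T -> R) (ell r : R) (U : set R) :
  uniq s -> 0 < ell ->
  {in s, forall t, ell <= h t - l t} ->
  {in s &, forall t t', t != t' -> h t <= l t' \/ h t' <= l t} ->
  {in s, forall t, exists y, [/\ U y, l t <= y & y <= h t]} ->
  (diam U <= r%:E)%E -> (size s)%:R <= r / ell + 2.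
Proof.
move=> us ell0 hl disj meet Ur.
have U_r x y : U x -> U y -> `|x - y| <= r.
  by move=> Ux Uy; rewrite -lee_fin (le_trans (diam_ge Ux Uy)).
have [->|[t0 t0s]] : s = [::] \/ exists t, t \in s.
  by case: s {us hl disj meet} => [|t s]; [left|right; exists t; rewrite inE eqxx].
  have : (0%:E <= r%:E)%E by apply: le_trans Ur; exact: diam_ge0.
  by rewrite lee_fin => r0; rewrite addr_ge0// divr_ge0// ltW.
have /choice[y hy] : forall t, exists y, t \in s -> [/\ U y, l t <= y & y <= h t].
  move=> t; case: (boolP (t \in s)) => [/meet[y ?]|_]; first by exists y.
  by exists 0.
have [Uy0 _ _] := hy _ t0s.
have U_lb : has_lbound U.
  by exists (y t0 - r) => z Uz; have := U_r _ _ Uy0 Uz; rewrite ler_norml; lra.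
(* Shrink each interval to one of length ell that still meets U. *)
pose p t := Num.max (l t) (y t - ell).
pose a := inf U - ell.
have pa t : t \in s -> 0 <= p t - a <= r + ell.
  move=> ts; have [Uy ly yh] := hy t ts; have iy := ge_inf U_lb Uy.
  have yi : y t - r <= inf U.
    apply: lb_le_inf; first by exists (y t).
    by move=> z Uz; have := U_r _ _ Uy Uz; rewrite ler_norml; lra.
  have py : p t <= y t by rewrite ge_max ly/=; lra.
  have yp : y t - ell <= p t by rewrite le_max lexx orbT.
  by rewrite /a; apply/andP; split; lra.
have ph t : t \in s -> p t + ell <= h t.
  move=> ts; have [Uy ly yh] := hy t ts; have := hl t ts.
  by rewrite /p; case: (leP (l t) (y t - ell)) => *; lra.
have lp t : l t <= p t by rewrite le_max lexx.
pose q t := Num.truncn ((p t - a) / ell).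
have q_itv t : t \in s -> (q t)%:R <= (p t - a) / ell < (q t).+1%:R.
  by move=> ts; apply: truncn_itv; rewrite divr_ge0 ?(ltW ell0)//; case/andP: (pa t ts).
have q_inj : {in s &, injective q}.
  move=> t t' ts t's e; apply/eqP/negP => /negP tt'.
  have /andP[h1 h2] := q_itv t ts; have /andP[h3 h4] := q_itv t' t's.
  have : `|(p t - a) / ell - (p t' - a) / ell| < 1.
    by move: h1 h2 h3 h4; rewrite e -(natr1 (q t')) ltr_norml => *; apply/andP; split; lra.
  rewrite -mulrBl normrM (gtr0_norm (_ : 0 < ell^-1)) ?invr_gt0// ltr_pdivrMr// mul1r ltr_norml.
  have := ph t ts; have := ph t' t's; have := lp t; have := lp t'.
  by case: (disj t t' ts t's tt') => ? ? ? ? ? /andP[? ?]; lra.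
have q_le t : t \in s -> (q t <= Num.truncn (r / ell + 1))%N.
  move=> ts; apply: le_truncn.
  have /andP[_ h1] := pa t ts; rewrite ler_pdivrMr// mulrDl mul1r divfK ?gt_eqF//.
have r0 : 0 <= r / ell + 1.
  have : (0%:E <= r%:E)%E by apply: le_trans Ur; exact: diam_ge0.
  by rewrite lee_fin => r0; rewrite addr_ge0// divr_ge0// ltW.
have : (size (map q s) <= size (iota 0 (Num.truncn (r / ell + 1)).+1))%N.
  apply: uniq_leq_size; first by rewrite map_inj_in_uniq.
  by move=> _ /mapP[t ts ->]; rewrite mem_iota add0n ltnS q_le.
rewrite size_map size_iota -(ler_nat R) => /le_trans; apply.
have /andP[h1 _] := truncn_itv r0; rewrite -natr1; lra.
Qed.

End Packing.

(** * Lower bounds from homogeneous Moran sets *)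

Section HomogeneousMoran.
Context {R : realType} {d : R} {f : nat -> R -> R}.
Hypothesis hf : decaying_gauss_like_ifs d f.
Context (p : nat) (W : nat -> seq (seq nat)) (ell : nat -> R) (s c0 : R).
Hypotheses (p_gt0 : (0 < p)%N)
  (W_gt0 : forall k, (0 < size (W k))%N)
  (W_uniq : forall k, uniq (W k))
  (W_word : forall k w, w \in W k -> posw w /\ size w = p)
  (ell_gt0 : forall k, 0 < ell k)
  (ell_small : forall e : R, 0 < e -> exists k, ell k <= e)
  (ell_le : forall k v, v \in tree_level W k ->
     ell k <= hi f (flatten v) - lo f (flatten v))
  (s_gt0 : 0 < s) (s_le1 : s <= 1) (c0_gt0 : 0 < c0)
  (W_mass : forall k, c0 <= \prod_(i < k) (size (W i))%:R *
     ((size (W k))%:R * ell k.+1) `^ s).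

Definition block_digits (B : nat -> seq nat) j := nth 0%N (B (j %/ p)%N) (j %% p)%N.

Lemma tree_level_word k v : v \in tree_level W k ->
  posw (flatten v) /\ shape v = nseq k p.
Proof.
elim: k v => [|k IH] v; first by rewrite inE => /eqP ->.
case/lastP: v => [/allpairsP[[[|? ?] ?] [_ _]]//|v c].
rewrite tree_levelS => /andP[/IH[pv sv] /W_word[pc sc]].
rewrite flatten_rcons posw_cat pv pc; split=> //.
by rewrite /shape map_rcons -/(shape v) sv sc -cats1 -(nseqD k 1) addn1.
Qed.

Lemma flatten_block_digits B k : (forall n, B n \in W n) ->
  flatten (mkseq B k) = mkseq (block_digits B) (k * p).
Proof.
move=> BW; elim: k => [|k IH]; first by rewrite mul0n.
rewrite -[k.+1]addn1 {1}/mkseq iotaD map_cat cats1 flatten_rcons -/(mkseq B k) IH.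
rewrite mulnDl mul1n /mkseq iotaD map_cat add0n; congr (_ ++ _).
have [_ sB] := W_word (BW k); apply: (@eq_from_nth _ 0%N).
  by rewrite size_map size_iota sB.
move=> i; rewrite sB => ip; rewrite (nth_map 0%N) ?size_iota// nth_iota//.
by rewrite /block_digits divnMDl// divn_small// addn0 modnMDl modn_small.
Qed.

Definition meets (U : set R) (v : seq (seq nat)) :=
  `[< exists2 y, U y & lo f (flatten v) <= y <= hi f (flatten v) >].

Definition hit (U : set R) k v := (v \in tree_level W k) && meets U v.

Lemma hit_rcons U k v c : hit U k.+1 (rcons v c) -> hit U k v.
Proof.
rewrite /hit tree_levelS -andbA => /and3P[vk cW /asboolP[y Uy]].
rewrite flatten_rcons => /andP[h1 h2]; rewrite vk/=; apply/asboolP; exists y => //.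
have [pv _] := tree_level_word vk; have [pc _] := W_word cW.
by rewrite (le_trans (sub_lo hf pv pc))// (le_trans h2)// (sub_hi hf).
Qed.

Lemma hit_count U k r : (diam U <= r%:E)%E ->
  (count (hit U k) (tree_level W k))%:R <= r / ell k + 2.
Proof.
move=> Ur; rewrite -size_filter.
have mf v : v \in [seq v <- tree_level W k | hit U k v] ->
    v \in tree_level W k /\ meets U v.
  by rewrite mem_filter => /andP[/andP[? ?] _].
apply: (packing (l := fun v => lo f (flatten v)) (h := fun v => hi f (flatten v))
  _ (ell_gt0 k) _ _ _ Ur).
- exact/filter_uniq/tree_level_uniq.
- by move=> v /mf[vk _]; exact: ell_le.
- move=> u v /mf[uk _] /mf[vk _] uv.
  have [pu su] := tree_level_word uk; have [pv sv] := tree_level_word vk.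
  apply: (basic_disjoint hf) => //; first by rewrite !size_flatten su sv.
  (* Nodes of one level have the same shape, so they are recovered from their concatenations. *)
  apply: contra_neq uv => e.
  by rewrite -(flattenK u) -(flattenK v) su sv e.
- move=> v /mf[_ /asboolP[y Uy /andP[? ?]]]; by exists y.
Qed.

(** Choose k with [ell k.+1 <= r < ell k]. Then U meets at most 3 nodes of depth k and at most 3 t
    nodes of depth k+1, where t = r / [ell k.+1]. With M nodes of depth k and m children each, the
    proportion hit is at most 3 min(m, t) / (M m) <= 3 (t/m)^s / M. Since (t/m)(m [ell k.+1]) = r,
    [W_mass] is exactly the condition that bounds this by a multiple of r^s. *)
Lemma hit_avg U r : (diam U <= r%:E)%E -> 0 < r -> r < ell 0 ->
  exists k, tree_avg W k (fun v => (hit U k v)%:R) [::] <= 3 / c0 * r `^ s.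
Proof.
move=> Ur r0 rl.
have [k kr rk] : exists2 k, ell k.+1 <= r & r < ell k.
  have h : exists k, ell k <= r by exact: ell_small.
  case: (ex_minnP h) => [[|k] hk kmin]; first by move: (lt_le_trans rl hk); rewrite ltxx.
  by exists k => //; rewrite ltNge; apply/negP => /kmin; rewrite ltnn.
have M0 j : 0 < \prod_(i < j) (size (W i))%:R :> R.
  by apply: prodr_gt0 => i _; rewrite ltr0n.
have M0' : 0 < (size (W k))%:R :> R by rewrite ltr0n.
set m := (size (W k))%:R in M0'.
exists k.+1.
have cnt j (P : pred (seq (seq nat))) : \sum_(v <- tree_level W j) (P v)%:R = (count P (tree_level W j))%:R :> R.
  by rewrite -natr_sum -sum1_count [in RHS]big_mkcond; congr (_%:R); apply: eq_bigr => v _; case: (P v).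
have bound1 : tree_avg W k.+1 (fun v => (hit U k.+1 v)%:R) [::] <=
    3 / \prod_(i < k) (size (W i))%:R :> R.
  rewrite tree_avgS (@le_trans _ _ (tree_avg W k (fun v => (hit U k v)%:R) [::]))//.
    apply: tree_avg_le => v /=; rewrite ler_pdivrMr ?ltr0n//.
    case: (boolP (hit U k v)) => hv.
      rewrite mul1r -[X in _ <= X%:R]sum1_size natr_sum; apply: ler_sum => c _.
      by case: (hit _ _ _).
    rewrite mul0r big1// => c _; case: (boolP (hit _ _ _)) => // /hit_rcons.
    by rewrite (negbTE hv).
  rewrite tree_avg_root ler_pM2r ?invr_gt0// (cnt k (hit U k)).
  apply: le_trans (hit_count k Ur) _.
  have : r / ell k <= 1 by rewrite ler_pdivrMr// mul1r ltW.
  lra.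
have bound2 : tree_avg W k.+1 (fun v => (hit U k.+1 v)%:R) [::] <=
    3 * (r / ell k.+1) / (\prod_(i < k) (size (W i))%:R * m) :> R.
  rewrite tree_avg_root (cnt k.+1 (hit U k.+1)) big_ord_recr ler_pM2r ?invr_gt0 ?mulr_gt0//.
  apply: le_trans (hit_count k.+1 Ur) _.
  have : 1 <= r / ell k.+1 by rewrite ler_pdivlMr// mul1r.
  lra.
set M := \prod_(i < k) _ in bound1 bound2; have Mp : 0 < M := M0 k.
set t := r / ell k.+1 in bound2.
have t0 : 0 < t by rewrite divr_gt0.
have mn0 : m != 0 by rewrite gt_eqF.
(* min(m, t) <= m^(1-s) t^s *)
have key : Num.min m t <= m * (t / m) `^ s.
  have [tm|mt] := ltP t m.
    have tm1 : 0 < t / m <= 1 by rewrite divr_gt0//= ler_pdivrMr// mul1r ltW.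
    rewrite -[leLHS](divfK mn0 t) mulrC ler_pM2l//.
    by rewrite -[leLHS](powRr1 (ltW (divr_gt0 t0 M0'))) ger_powR.
  have tm1 : 1 <= t / m by rewrite ler_pdivlMr// mul1r.
  by rewrite -[leLHS]mulr1 ler_pM2l// -[leLHS](powRr0 (t / m)) ler_powR// ltW.
have bound : tree_avg W k.+1 (fun v => (hit U k.+1 v)%:R) [::] <= 3 / (M * m) * Num.min m t.
  have [tm|mt] := ltP t m.
    by rewrite (le_trans bound2)// le_eqVlt mulrAC eqxx.
  rewrite (le_trans bound1)// invfM -!mulrA mulVf ?mulr1// gt_eqF//.
rewrite (le_trans bound)// (@le_trans _ _ (3 / (M * m) * (m * (t / m) `^ s)))//.
  by rewrite ler_wpM2l// divr_ge0// mulr_ge0// ltW.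
have -> : 3 / (M * m) * (m * (t / m) `^ s) = 3 * ((t / m) `^ s / M).
  by field; rewrite !gt_eqF.
rewrite -[leRHS]mulrA ler_pM2l// ler_pdivrMr// -[leRHS]mulrA ler_pdivlMl//.
rewrite (@le_trans _ _ (M * (m * ell k.+1) `^ s * (t / m) `^ s))//.
  by apply: ler_wpM2r; [exact: powR_ge0|exact: W_mass].
have p1 : 0 <= m * ell k.+1 by rewrite mulr_ge0// ltW.
have p2 : 0 <= t / m by rewrite divr_ge0// ltW.
rewrite -[leLHS]mulrA -(powRM _ p1 p2).
have -> : m * ell k.+1 * (t / m) = r by rewrite /t; field; rewrite !gt_eqF.
by rewrite mulrC.
Qed.

Theorem moran_not_null (A : set R) :
  (forall B, (forall k, B k \in W k) ->
     forall x : R, symbolic_expansion f (block_digits B) x -> A x) ->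
  hausdorff_measure s A <> 0%E.
Proof.
move=> hA A0.
pose C := 3 / c0; have C0 : 0 < C by rewrite divr_gt0.
(* The first entry of the minimum keeps the total of the averages below 1; the second keeps every
   radius below [ell 0], as [hit_avg] demands. *)
pose eta := Num.min ((2 * C)^-1) ((ell 0) `^ s / 2) / 2.
have eta0 : 0 < eta.
  by rewrite divr_gt0// lt_min invr_gt0 mulr_gt0//= divr_gt0// powR_gt0.
have etaC : C * (eta + eta) <= 2^-1.
  have : eta <= (2 * C)^-1 / 2 by rewrite ler_pM2r// ge_min lexx.
  rewrite -(ler_pM2l C0).
  have -> : C * ((2 * C)^-1 / 2) = 2^-1 / 2 by field; rewrite gt_eqF.
  lra.
have etal : eta + eta < ell 0 `^ s.
  have : eta <= (ell 0 `^ s / 2) / 2 by rewrite ler_pM2r// ge_min lexx orbT.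
  by have := powR_gt0 s (ell_gt0 0); lra.
have [U [AU U1 Ueta]] := hausdorff_null_cover A0 eta0.
have Ufin i : exists2 x, 0 <= x & diam (U i) = x%:E.
  have := diam_ge0 (U i); have := U1 i; case: (diam (U i)) => // x _ x0.
  by exists x; rewrite // -lee_fin.
have /choice[u hu] : forall i, exists x, 0 <= x /\ diam (U i) = x%:E.
  by move=> i; have [x ? ?] := Ufin i; exists x.
have gaugeE i : hausdorff_gauge s (U i) = (u i `^ s)%:E.
  by rewrite hausdorff_gaugeE// (hu i).2 poweR_EFin.
(* Sets of diameter 0 need a positive radius; enlarging all radii to at least [v i] costs eta in
   total. *)
pose v i := (eta / (2 ^ i.+1)%:R) `^ s^-1.
have v0 i : 0 < v i by rewrite powR_gt0// divr_gt0// ltr0n expn_gt0.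
have vs i : v i `^ s = eta / (2 ^ i.+1)%:R.
  by rewrite -powRrM mulVf ?gt_eqF// powRr1// divr_ge0// ltW.
pose r i := Num.max (u i) (v i).
have r0 i : 0 < r i by rewrite lt_max v0 orbT.
have rs i : r i `^ s <= u i `^ s + eta / (2 ^ i.+1)%:R.
  rewrite -vs /r; have := powR_ge0 (u i) s; have := powR_ge0 (v i) s.
  by case: (leP (u i) (v i)) => _; lra.
have sum_r : (\sum_(0 <= i <oo) (r i `^ s)%:E <= (eta + eta)%:E)%E.
  apply: (@le_trans _ _ (\sum_(0 <= i <oo) (hausdorff_gauge s (U i) + (eta / (2 ^ i.+1)%:R)%:E))%E).
    apply: lee_nneseries => [i _ _|i _]; first by rewrite lee_fin powR_ge0.
    by rewrite gaugeE -EFinD lee_fin.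
  apply: le_trans (epsilon_trick xpredT _ (ltW eta0)) _.
    by move=> i; exact: hausdorff_gauge_ge0.
  by rewrite EFinD leeD2r.
have r_small i : r i < ell 0.
  rewrite ltNge; apply/negP => h.
  have : ((r i `^ s)%:E <= (eta + eta)%:E)%E.
    apply: le_trans sum_r; apply: le_trans (nneseries_lim_ge i.+1 _); last first.
      by move=> n _ _; rewrite lee_fin powR_ge0.
    by rewrite big_nat_recr//= leeDr// sume_ge0// => n _; rewrite lee_fin powR_ge0.
  rewrite lee_fin leNgt (lt_le_trans etal)// ge0_ler_powR// ?nnegrE ltW//.
have /choice[k hk] : forall i, exists k,
    tree_avg W k (fun v => (hit (U i) k v)%:R) [::] <= C * r i `^ s.
  move=> i; apply: hit_avg => //; rewrite (hu i).2 lee_fin le_max lexx//.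
have [||B [BW Bavoid]] := @tree_avoid R (seq nat) W W_gt0 k (fun i => hit (U i) (k i)).
- by move=> i w /andP[/tree_level_size].
- apply: (@le_lt_trans _ _ (\sum_(0 <= i <oo) (C%:E * (r i `^ s)%:E))%E).
    apply: lee_nneseries => [i _ _|i _]; last by rewrite -EFinM lee_fin.
    by rewrite lee_fin tree_avg_ge0// => ?; rewrite ler0n.
  rewrite nneseriesZl; last by move=> i _; rewrite lee_fin powR_ge0.
  apply: (@le_lt_trans _ _ (C%:E * (eta + eta)%:E)%E); first by rewrite lee_pmul2l.
  by rewrite -EFinM lte_fin; lra.
have Bpos j : (0 < block_digits B j)%N.
  have [/allP pB sB] := W_word (BW (j %/ p)%N).
  by apply: pB; rewrite mem_nth// sB ltn_pmod.
have [x hx] := symbolic_expansion_exists hf Bpos.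
have [i _ Ux] := AU x (hA B BW x hx).
have /negP := Bavoid i; apply; apply/andP; split; first exact: tree_level_seq.
apply/asboolP; exists x => //; rewrite flatten_block_digits//.
(* The root is separate: [symbolic_expansion] speaks of nonempty prefixes only, while the root
   cylinder is all of [0, 1]. *)
have [k0|k0] := posnP (k i * p)%N.
  have [_ /(_ 1%N isT)] := hx; rewrite k0 => -[y y01 <-].
  by apply: (@ifs_comp_closed _ _ _ hf [::]) => //; exact: (ifs_in01 hf (Bpos 0%N)).
have [_ /(_ _ k0)] := hx; rewrite (basic_intervalE hf) ?in_itv//=.
by apply/allP => _ /mapP[j _ ->].
Qed.

End HomogeneousMoran.

(** * Rapidly growing Birkhoff sums *)

Section FastGrowth.
Context {R : realType} {d c : R} {f : nat -> R -> R} {phi : R -> R}.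
Hypotheses (hd : 1 < d) (hf : decaying_gauss_like_ifs d f)
  (hc0 : 0 < c) (hc1 : c < 1)
  (hphij : forall j : nat, (0 < j)%N ->
     potential_value f phi j = expR (j%:R `^ c)).

(* Phi (k.+1) = exp (exp (t k)), and T is the sequence of partial sums of t,
   whose growth rate G determines the dimension. *)
Context (t : nat -> R) (G q : R) (Phi : nat -> R).
Let T k : R := \sum_(i < k) t i.
Hypotheses (Phi0 : 0 < Phi 0%N) (PhiS : forall k, Phi k.+1 = expR (expR (t k)))
  (G_ge1 : 1 <= G) (t_ge0 : forall k, 0 <= t k)
  (T_superlinear : forall e : R, 0 < e -> \forall k \near \oo, k%:R <= e * T k)
  (T_ratio : forall e : R, 0 < e -> \forall k \near \oo, `|t k - (G - 1) * T k| <= e * T k)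
  (expt_gap : forall M : R, \forall k \near \oo, M <= expR (t k.+1) - expR (t k)).

Hypotheses (q_gt1 : 1 < q) (cq : c * q = 1).

Let T_ge0 k : 0 <= T k. Proof. exact: sumr_ge0. Qed.

Let TS k : T k.+1 = T k + t k. Proof. by rewrite /T big_ord_recr. Qed.

Lemma t_unbounded M : \forall k \near \oo, M <= t k.
Proof.
have [N _ hN] := expt_gap (expR M).
exists N.+1 => // -[//|k] /= Nk; have := hN k Nk.
by move=> /= h; rewrite -ler_expR; have := expR_gt0 (t k); lra.
Qed.

Lemma Phi_gt0 n : 0 < Phi n.
Proof. by case: n => // n; rewrite PhiS expR_gt0. Qed.

Lemma Phi_ratio : (fun n => Phi n / Phi n.+1) @ \oo --> (0 : R).
Proof.
apply/cvgrPdist_le => e e0.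
have [N _ hN] := expt_gap (- ln e).
exists N.+1 => // -[//|k] /= Nk; rewrite !PhiS sub0r normrN -expRB.
rewrite ger0_norm ?expR_ge0// -[leRHS]lnK ?posrE// ler_expR.
by have := hN k Nk; lra.
Qed.

Lemma birkhoff_sumE a n : (forall k, 0 < a k)%N ->
  birkhoff_sum f phi a n = \sum_(k < n) expR ((a k)%:R `^ c).
Proof. by move=> a0; apply: eq_bigr => k _; exact: hphij. Qed.

(** As t is close to (G - 1) T, the main part is close to g T with g = A - B (G - 1). The error in t
    takes a quarter of g T, and the linear term together with M takes half of it, because T outgrows
    k. *)
Lemma exponent_to_infty (A B C : R) : 0 < A - B * (G - 1) ->
  forall M, \forall k \near \oo, M <= A * T k - B * t k - C * k.+1%:R.
Proof.
move=> gap M; pose g := A - B * (G - 1).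
have g0 : 0 < g by [].
have B0 : 0 <= `|B| by [].
have [e1 e10 Be1] : exists2 e1, 0 < e1 & `|B| * e1 <= g / 4.
  exists (g / (4 * (`|B| + 1))); first by rewrite divr_gt0// mulr_gt0//; lra.
  by rewrite mulrA ler_pdivrMr ?mulr_gt0//; lra.
pose D := `|C| + `|M| + 1; have D0 : 0 < D by rewrite /D; have := normr_ge0 C; have := normr_ge0 M; lra.
pose e2 := g / (4 * D); have e20 : 0 < e2 by rewrite divr_gt0// mulr_gt0.
near=> k.
have h1 : `|t k - (G - 1) * T k| <= e1 * T k by near: k; exact: T_ratio.
have h2 : k%:R <= e2 * T k by near: k; exact: T_superlinear.
have k1 : 1 <= k%:R :> R by near: k; exists 1%N => // k /= k1; rewrite ler1n.
have Bt : B * t k <= B * (G - 1) * T k + g / 4 * T k.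
  rewrite -lerBlDl -mulrA -mulrBr (le_trans (ler_norm _))// normrM.
  by rewrite (le_trans (ler_wpM2l B0 h1))// mulrA ler_wpM2r.
have Dk : D * k%:R <= g / 4 * T k.
  have -> : g / 4 * T k = D * (e2 * T k) by rewrite /e2; field; rewrite gt_eqF.
  by rewrite ler_pM2l.
have CM : C * k.+1%:R + M <= 2 * (D * k%:R).
  rewrite -natr1 /D.
  have := ler_norm C; have := ler_norm M; have := normr_ge0 C; have := normr_ge0 M.
  nra.
have -> : A * T k = g * T k + B * (G - 1) * T k by rewrite /g; ring.
have := T_ge0 k; nra.
Unshelve. all: by end_near. Qed.

Lemma fast_level_set_digits a : (forall k, 0 < a k)%N ->
  (fun k => (a k)%:R `^ c - expR (t k)) @ \oo --> (0 : R) ->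
  (fun n => birkhoff_sum f phi a n / Phi n) @ \oo --> (1 : R).
Proof.
move=> a0 ha; have -> : birkhoff_sum f phi a = fun n => \sum_(k < n) expR ((a k)%:R `^ c).
  by apply/funext => n; exact: birkhoff_sumE.
apply: (@sum_ratio _ (fun k => expR ((a k)%:R `^ c)) Phi); [exact: Phi_gt0|by move=> n; exact: expR_ge0|exact: Phi_ratio|].
have -> : (fun n => expR ((a n)%:R `^ c) / Phi n.+1) =
    (fun n => expR ((a n)%:R `^ c - expR (t n))).
  by apply/funext => n; rewrite PhiS -expRB.
suff : (fun n => expR ((a n)%:R `^ c - expR (t n))) @ \oo --> expR (0 : R) by rewrite expR0.
by apply: (cvg_comp _ _ ha); apply: continuous_expR.
Qed.

Lemma fast_lower s : 0 < s -> s * (d * q * G - (q - 1) * (G - 1)) < q - 1 ->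
  hausdorff_measure s (birkhoff_level_set f phi Phi) <> 0%E.
Proof.
move=> s0 hs; have := (hd, q_gt1, G_ge1) => -[[d1 q1] G1].
have s1 : s <= 1.
  rewrite leNgt; apply/negP => s1.
  have den : q - 1 < d * q * G - (q - 1) * (G - 1).
    have dq : q < d * q by rewrite ltr_pMl//; lra.
    have : 0 < G * (d * q - q + 1) by rewrite mulr_gt0//; lra.
    nra.
  suff : d * q * G - (q - 1) * (G - 1) < s * (d * q * G - (q - 1) * (G - 1)) by lra.
  by rewrite ltr_pMl//; lra.
pose gap := (q - 1) - s * (d * q * G - (q - 1) * (G - 1)).
have gap0 : 0 < gap by rewrite /gap; lra.
have D0 : 0 < 1 + s * (G - 1) + s * q * G.
  have : 0 <= s * (G - 1) by rewrite mulr_ge0//; lra.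
  have : 0 < s * q * G by rewrite !mulr_gt0//; lra.
  lra.
(* e shortens the digit windows and worsens the Lipschitz exponent to d + e; the factor of e is the
   resulting total loss in A - B (G - 1) below. *)
have [e [e0 eq1 egap]] : exists e, [/\ 0 < e, e < q - 1 &
    e * (1 + s * (G - 1) + s * q * G) < gap].
  exists (Num.min ((q - 1) / 2) (gap / (2 * (1 + s * (G - 1) + s * q * G)))); split.
  - by rewrite lt_min; apply/andP; split; [lra|rewrite divr_gt0// mulr_gt0].
  - by rewrite gt_min; apply/orP; left; lra.
  rewrite -ltr_pdivlMr// gt_min; apply/orP; right.
  by rewrite invfM mulrA mulrAC ltr_pdivrMr// mulr_natr mulr2n ltrDl divr_gt0.
(* [x k] solves x^c = log Phi(k+1). The window [y k] is shorter than x^(1-c) by the factor e^(-e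
   t_k), so that a_k^c - log Phi(k+1) tends to 0 and does not merely stay bounded. *)
pose x k := expR (q * t k); pose y k := expR ((q - 1 - e) * t k).
have y1 k : 1 <= y k by rewrite /y -[leLHS]expR0 ler_expR mulr_ge0// ltW//; lra.
have yx k : y k <= x k by rewrite ler_expR ler_wpM2r//; lra.
have x1 k : 1 <= x k by exact: le_trans (yx k).
(* Adding 2 puts the digits above both [x k] and 1. *)
pose J k := (Num.truncn (x k)).+2; pose m k := Num.truncn (y k).
have m_half k : y k / 2 <= (m k)%:R by exact: truncn_ge_half.
have digit k i : (i < m k)%N -> x k <= (J k + i)%:R <= x k + 2 * y k.
  move=> im; have /andP[h1 h2] := truncn_itv (le_trans ler01 (x1 k)).
  have /andP[h3 h4] := truncn_itv (le_trans ler01 (y1 k)).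
  have : i.+1%:R <= (m k)%:R :> R by rewrite ler_nat.
  have := y1 k; have : 0 <= i%:R :> R by [].
  move: h2; rewrite natrD /J -!natr1 => *; apply/andP; split; lra.
pose W k := [seq [:: (J k + i)%N] | i <- iota 0 (m k)].
have WP k w : w \in W k -> exists2 j, w = [:: j] &
    [/\ (1 < j)%N, x k <= j%:R & j%:R <= x k + 2 * y k].
  case/mapP => i; rewrite mem_iota add0n => /andP[_ im] ->; exists (J k + i)%N => //.
  by have /andP[? ?] := digit k i im; split => //; rewrite /J addSn ltnS.
have sizeW k : size (W k) = m k by rewrite size_map size_iota.
have [K1 [K2 [K10 K20 hK]]] := ifs_bilipschitz hf e0.
(* The digits are at most x + 2 y <= 3 x, whence the 3; kappa is the logarithm of the constant paid
   per letter. *)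
pose kappa := ln K1 - (d + e) * ln 3.
pose ell k := expR (kappa * k%:R - (d + e) * q * T k).
have ellS k : ell k.+1 = ell k * expR (kappa - (d + e) * q * t k).
  by rewrite /ell -expRD TS -natr1; congr expR; ring.
have lip_digit k j : 1 <= j%:R :> R -> j%:R <= x k + 2 * y k ->
    expR (kappa - (d + e) * q * t k) <= K1 / j%:R `^ (d + e).
  move=> j1 jx; rewrite -[K1 in leRHS]lnK ?posrE// /powR gt_eqF; last lra.
  rewrite -expRB ler_expR /kappa.
  have -> : (d + e) * q * t k = (d + e) * (q * t k) by ring.
  have : ln (j%:R : R) <= ln 3 + q * t k.
    rewrite -[q * t k]expRK -lnM ?posrE ?expR_gt0// ler_ln ?posrE ?mulr_gt0 ?expR_gt0//; last lra.
    by rewrite -/(x k); have := yx k; lra.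
  have : 0 < d + e by lra.
  nra.
have ell_prod k v : v \in tree_level W k -> posw (flatten v) /\
    ell k <= \prod_(j <- flatten v) (K1 / j%:R `^ (d + e)).
  elim: k v => [|k IH] v.
    rewrite inE => /eqP ->; split=> //.
    by rewrite big_nil /ell /T big_ord0 mulr0 mulr0 subr0 expR0.
  case/lastP: v => [/allpairsP[[[|? ?] ?] [_ _]]//|v w].
  rewrite tree_levelS => /andP[/IH[pv hv] /WP[j -> [j1 jx1 jx2]]].
  rewrite flatten_rcons posw_cat pv/= (ltnW j1); split=> //.
  rewrite big_cat/= big_seq1 ellS ler_pM ?expR_ge0//.
  by apply: lip_digit => //; rewrite ler1n ltnW.
pose A := (q - 1 - e) - s * ((d + e) * q).
pose B := s * ((d + e) * q - (q - 1 - e)).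
pose C := ln 2 + s * ln 2 - s * kappa.
have B0 : 0 <= B by rewrite mulr_ge0 ?(ltW s0)//; nra.
have AB : 0 < A - B * (G - 1).
  have -> : A - B * (G - 1) = gap - e * (1 + s * (G - 1) + s * q * G).
    by rewrite /A /B /gap; ring.
  lra.
(* E is the logarithm of the quantity in [W_mass], each count [m i] being replaced with its lower
   bound [y i / 2]. *)
pose E k := (q - 1 - e) * T k - k%:R * ln 2 +
   s * ((q - 1 - e) * t k - ln 2 + (kappa * k.+1%:R - (d + e) * q * T k.+1)).
have [b hb] : exists b, forall k, b <= E k.
  apply: bounded_below_of_near.
  have := exponent_to_infty C AB 0; apply: filterS => k /le_trans; apply.
  have -> : E k = A * T k - B * t k - (k%:R * ln 2 + s * ln 2 - s * kappa * k.+1%:R).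
    by rewrite /E TS /A /B; ring.
  rewrite lerD2l lerN2 /C -natr1.
  have l2 : 0 <= ln 2 :> R by rewrite ln_ge0// ler1n.
  have : 0 <= s * ln 2 * k%:R by rewrite !mulr_ge0// ltW.
  lra.
apply: (@moran_not_null _ _ _ hf 1 W ell s (expR b)) => //.
- by move=> k; rewrite sizeW -(ltr_nat R); have := m_half k; have := y1 k; lra.
- by move=> k; rewrite map_inj_uniq ?iota_uniq// => i i' [] /addnI.
- by move=> k w /WP[j -> [j1 _ _]]; rewrite /= ltnW.
- by move=> k; exact: expR_gt0.
- move=> r r0.
  have AA : 0 < (d + e) * q - 0 * (G - 1) by rewrite mul0r subr0 mulr_gt0; lra.
  have [N _ hN] := exponent_to_infty `|kappa| AA (- ln r).
  exists N; rewrite /ell -[leRHS]lnK ?posrE// ler_expR.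
  have /= := hN N (leqnn N); rewrite mul0r -natr1.
  have := ler_norm kappa; have : 0 <= N%:R :> R by [].
  have := normr_ge0 kappa; nra.
- move=> k v vk; have [pv hv] := ell_prod k v vk.
  rewrite (hi_sub_lo hf pv) (le_trans hv)//.
  have c1_ge0 i : (0 < i)%N -> 0 <= K1 / i%:R `^ (d + e) by rewrite divr_ge0 ?powR_ge0 ?ltW.
  have c2_ge0 i : (0 < i)%N -> 0 <= K2 / i%:R `^ (d - e) by rewrite divr_ge0 ?powR_ge0 ?ltW.
  have /andP[+ _] := ifs_comp_bounds hf c1_ge0 c2_ge0 hK pv in01_0 in01_1.
  by rewrite sub0r normrN normr1 mulr1.
- by rewrite expR_gt0.
- move=> k; apply: le_trans (_ : expR (E k) <= _); first by rewrite ler_expR.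
  rewrite expRD ler_pM ?expR_ge0//.
    elim: k => [|k IH]; first by rewrite big_ord0 /T big_ord0 mulr0 mul0r subr0 expR0.
    rewrite big_ord_recr/= TS.
    rewrite (_ : _ - _ = ((q - 1 - e) * T k - k%:R * ln 2) + ((q - 1 - e) * t k - ln 2)).
      rewrite expRD ler_pM ?expR_ge0// sizeW expRB lnK ?posrE//; exact: m_half.
    by rewrite -natr1; ring.
  have -> : expR (s * ((q - 1 - e) * t k - ln 2 + (kappa * k.+1%:R - (d + e) * q * T k.+1))) =
      (y k / 2 * ell k.+1) `^ s.
    by rewrite mulrC -powR_expR expRD expRB lnK ?posrE.
  apply: ge0_ler_powR; rewrite ?(ltW s0)// ?nnegrE ?mulr_ge0 ?divr_ge0 ?expR_ge0//.
  by rewrite sizeW ler_wpM2r ?expR_ge0.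
- move=> Bk BW z hz; pose a := block_digits 1 Bk.
  have aP k : [/\ (1 < a k)%N, x k <= (a k)%:R & (a k)%:R <= x k + 2 * y k].
    by rewrite /a /block_digits divn1 modn1; have [j -> ?] := WP _ _ (BW k).
  split; first by apply: (first_digit_open hf hz); have [] := aP 0%N.
  exists a; split => //; apply: fast_level_set_digits.
    by move=> k; have [/ltnW] := aP k.
  have hbnd k : 0 <= (a k)%:R `^ c - expR (t k) <= 2 * expR (- e * t k).
    have [_ h1 h2] := aP k.
    have -> : expR (t k) = x k `^ c by rewrite /x powR_expR mulrAC -[q * c]mulrC cq mul1r.
    apply/andP; split.
      by rewrite subr_ge0 ge0_ler_powR ?nnegrE ?(ltW hc0) ?expR_ge0 ?ler0n.
    rewrite (@le_trans _ _ ((x k + 2 * y k) `^ c - x k `^ c))//.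
      rewrite lerD2r ge0_ler_powR ?nnegrE ?(ltW hc0)//.
      by have := y1 k; have := x1 k; lra.
    apply: le_trans (powR_concave_gap _ _ _ _) _ => //; [exact: ltW|exact: expR_gt0|..].
      by rewrite mulr_ge0// expR_ge0.
    rewrite -mulrA ler_pM2l// powR_expR -expRD ler_expR.
    have -> : (q - 1 - e) * t k + q * t k * (c - 1) = - e * t k + (c * q - 1) * t k by ring.
    by rewrite cq subrr mul0r addr0.
  apply/cvgrPdist_le => r r0.
  have := t_unbounded (- ln (r / 2) / e); apply: filterS => k.
  rewrite ler_pdivrMr// sub0r normrN => htk.
  have /andP[h1 h2] := hbnd k; rewrite ger0_norm// (le_trans h2)//.
  rewrite mulrC -ler_pdivlMr// -[leRHS]lnK ?posrE ?divr_gt0// ler_expR; nra.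
Qed.

(** The digits of the prefix u are arbitrary; every later one has a finite window. The words of n
    digits are listed one by one, and for each of them all values of the next digit are covered by a
    single interval, their cylinders being adjacent. This saves a factor e^((q-1) t_n) in the count
    at the price of a larger diameter, and matters when t_n is comparable to T_n. *)
Lemma fast_upper_covers s : 0 < s -> q - 1 < s * (d * q * G - (q - 1) * (G - 1)) ->
  exists N0, forall u, posw u -> (N0 <= size u)%N ->
  hausdorff_measure s [set x : R | exists a, [/\ symbolic_expansion f a x,
    mkseq a (size u) = u &
    forall k, (size u <= k)%N -> `|(a k)%:R `^ c - expR (t k)| <= 1]] = 0%E.
Proof.
move=> s0 hs; have := (hd, q_gt1, G_ge1) => -[[d1 q1] G1].
pose gap := s * (d * q * G - (q - 1) * (G - 1)) - (q - 1).
have gap0 : 0 < gap by rewrite /gap; lra.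
have sqG : 0 < s * q * G by rewrite !mulr_gt0//; lra.
have [e [e0 e1 egap]] : exists e, [/\ 0 < e, e < 1 & e * (s * q * G) < gap].
  exists (Num.min 2^-1 (gap / (2 * (s * q * G)))); split.
  - by rewrite lt_min invr_gt0 ltr0n/= divr_gt0// mulr_gt0.
  - by rewrite gt_min; apply/orP; left; lra.
  rewrite -ltr_pdivlMr// gt_min; apply/orP; right.
  by rewrite invfM mulrA mulrAC ltr_pdivrMr// mulr_natr mulr2n ltrDl divr_gt0.
have [K1 [K2 [K10 K20 hK]]] := ifs_bilipschitz hf e0.
have [C0 C00 hC0] := powR_gap (ltW q1).
pose L k := expR (t k).
pose j0 k := Num.truncn ((L k - 1) `^ q); pose j1 k := Num.truncn ((L k + 1) `^ q).
pose W k := iota (j0 k) ((j1 k).+1 - j0 k).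
(* The least digit is at least half of (L - 1)^q, and L - 1 >= L / 2. *)
pose kap := 2^-1 * 2^-1 `^ q; have kap0 : 0 < kap by rewrite mulr_gt0 ?invr_gt0// powR_gt0 invr_gt0.
pose C2 := K2 / kap `^ (d - e); have C20 : 0 < C2 by rewrite divr_gt0// powR_gt0.
have [N0 _ hN0] : \forall k \near \oo, 3 <= L k.
  by have := t_unbounded (ln 3); apply: filterS => k; rewrite /L -ler_expR lnK ?posrE.
have Lq k : L k `^ q = expR (q * t k) by rewrite powR_expR mulrC.
have q0 : 0 <= q := ltW (lt_trans ltr01 q1).
have Lm k : (N0 <= k)%N -> 1 <= L k - 1.
  by move=> /hN0 /= L3; rewrite lerBrDr (le_trans _ L3)// -[1 + 1]/(2%:R : R) ler_nat.
have Lm0 k : (N0 <= k)%N -> 0 <= L k - 1 by move=> /Lm; exact: le_trans.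
have Lmp k : L k - 1 <= L k + 1 by rewrite lerD2l (le_trans (lerN10 R)).
have pm k : (N0 <= k)%N -> 1 <= (L k - 1) `^ q.
  move=> k0; have one_q : (1 : R) `^ q = 1 by rewrite powR1.
  by rewrite -[leLHS]one_q ler_powR2r// Lm.
have pp k : (N0 <= k)%N -> (L k - 1) `^ q <= (L k + 1) `^ q.
  by move=> k0; rewrite ler_powR2r// Lm0.
have memW k j : (N0 <= k)%N -> `|j%:R `^ c - L k| <= 1 -> j \in W k.
  move=> k0; rewrite ler_norml => /andP[h1 h2]; have /= L3 := hN0 _ k0.
  have jq : (j%:R : R) = (j%:R `^ c) `^ q by rewrite -powRrM cq powRr1.
  have jc : 0 <= j%:R `^ c :> R by exact: powR_ge0.
  have Lj : L k - 1 <= j%:R `^ c by rewrite addrC -lerBrDr.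
  have jL : j%:R `^ c <= L k + 1 by rewrite -lerBlDl.
  have hj0 : (j0 k <= j)%N.
    rewrite truncn_le_nat -natr1; apply: (@le_lt_trans _ _ j%:R); last by rewrite ltrDl.
    by rewrite [leRHS]jq ler_powR2r ?Lm0.
  rewrite mem_iota hj0/= subnKC ?ltnS; last by apply: ltnW; rewrite ltnS le_truncn// pp.
  have -> : j = Num.truncn (j%:R : R) by rewrite natrK.
  by rewrite le_truncn// jq ler_powR2r.
have j0_half k : (N0 <= k)%N -> kap * expR (q * t k) <= (j0 k)%:R.
  move=> k0; have /= L3 := hN0 _ k0; apply: le_trans (truncn_ge_half (pm k k0)).
  rewrite mulrC -Lq /kap mulrA mulrAC ler_pM2r ?invr_gt0// -powRM ?invr_ge0 ?expR_ge0//.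
  by rewrite ge0_ler_powR ?nnegrE; lra.
have Wj k j : (N0 <= k)%N -> j \in W k -> (0 < j)%N /\
    K2 / j%:R `^ (d - e) <= C2 * expR (- ((d - e) * q * t k)).
  move=> k0; rewrite mem_iota => /andP[j0j _].
  have h : kap * expR (q * t k) <= j%:R.
    by rewrite (le_trans (j0_half k k0))// ler_nat.
  have p0 : 0 < kap * expR (q * t k) by rewrite mulr_gt0// expR_gt0.
  split; first by rewrite -(ltr_nat R) (lt_le_trans p0).
  rewrite /C2 -mulrA ler_pM2l// expRN -invfM lef_pV2 ?posrE ?mulr_gt0 ?powR_gt0 ?expR_gt0//.
    have -> : expR ((d - e) * q * t k) = expR (q * t k) `^ (d - e).
      by rewrite powR_expR; congr expR; ring.
    rewrite -powRM ?expR_ge0//; last exact: ltW.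
    by rewrite ge0_ler_powR ?nnegrE ?ler0n ?(ltW p0)//; lra.
  exact: lt_le_trans h.
have sizeW k : (N0 <= k)%N -> (size (W k))%:R <= C0 * expR ((q - 1) * t k).
  move=> k0; have /= L3 := hN0 _ k0.
  rewrite size_iota -[_ * t k]mulrC -powR_expR; apply: le_trans (hC0 _ L3).
  have /andP[h1 h2] := truncn_itv (le_trans ler01 (pm k k0)).
  have /andP[h3 h4] := truncn_itv (le_trans (le_trans ler01 (pm k k0)) (pp k k0)).
  rewrite natrB; last by apply: leqW; rewrite le_truncn// pp.
  by move: h2; rewrite -!natr1; lra.
have cutW k : (N0 <= k)%N -> cut f (j1 k) - cut f (j0 k).-1 <=
    C0 * expR ((q - 1) * t k) * (C2 * expR (- ((d - e) * q * t k))).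
  move=> k0; have j0_gt0 : (0 < j0 k)%N.
    by rewrite -(ltr_nat R); apply: lt_le_trans (j0_half k k0); rewrite mulr_gt0// expR_gt0.
  have j01 : (j0 k <= j1 k)%N by rewrite le_truncn// pp.
  (* Adjacency: the extent of the window telescopes into the lengths of its cylinders. *)
  have -> : cut f (j1 k) - cut f (j0 k).-1 = \sum_(j <- W k) (hi f [:: j] - lo f [:: j]).
    rewrite big_seq (eq_bigr (fun j => cut f j - cut f j.-1)); last first.
      by move=> j /(Wj _ _ k0)[jp _]; rewrite (cut_hi hf jp) (cut_lo jp).
    rewrite -big_seq /W -/(index_iota (j0 k) (j1 k).+1).
    rewrite -[X in index_iota X _](prednK j0_gt0) big_add1/= telescope_sumr//.
    by rewrite (leq_trans (leq_pred _)).
  rewrite (@le_trans _ _ (\sum_(j <- W k) C2 * expR (- ((d - e) * q * t k))))//.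
    rewrite big_seq [leRHS]big_seq; apply: ler_sum => j /(Wj _ _ k0)[jp jle].
    have pj : posw [:: j] by rewrite /= jp.
    rewrite (hi_sub_lo hf pj); apply: le_trans jle.
    have /andP[_] := hK j jp 0 1 in01_0 in01_1.
    by rewrite sub0r normrN normr1 mulr1.
  rewrite big_const_seq count_predT iter_addr addr0 -mulr_natl.
  by rewrite ler_wpM2r ?sizeW// mulr_ge0 ?expR_ge0 ?(ltW C20).
exists N0 => u pu N0u; set N := size u.
apply: hausdorff_null_finite_covers => // eta eta0.
have [Lu Lu0 hLu] := ifs_comp_lipschitz hf pu.
pose A := s * ((d - e) * q) - (q - 1).
pose B := - (s * ((d - e) * q - (q - 1))).
have AB : 0 < A - B * (G - 1).
  have -> : A - B * (G - 1) = gap - e * (s * q * G) by rewrite /A /B /gap; ring.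
  lra.
(* C gathers the constants paid per letter and those of the prefix; letting the latter be multiplied
   by [n.+1] as well is harmless. For a given eta one large generation n then suffices. *)
pose C := `|ln C0| + s * `|ln Lu| + s * `|ln C2| + s * `|ln C0| + `|A * T N|.
have [n Nn hn] : exists2 n, (N <= n)%N & - ln eta <= A * T n - B * t n - C * n.+1%:R.
  have [N1 _ hN1] := exponent_to_infty C AB (- ln eta).
  by exists (maxn N N1); [exact: leq_maxl|apply: hN1; exact: leq_maxr].
pose m := (n - N)%N; have Nm : (N + m = n)%N by rewrite subnKC.
pose V i := W (N + i)%N.
have N0i i : (N0 <= N + i)%N by rewrite (leq_trans N0u) ?leq_addr.
have sizeV k : (size (tree_level V k))%:R <=
    expR (k%:R * ln C0 + (q - 1) * (T (N + k) - T N)).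
  rewrite size_tree_level natr_prod; elim: k => [|k IH].
    by rewrite big_ord0 addn0 subrr mulr0 mul0r addr0 expR0.
  rewrite big_ord_recr/= addnS TS.
  rewrite (_ : _ + _ = (k%:R * ln C0 + (q - 1) * (T (N + k) - T N)) + (ln C0 + (q - 1) * t (N + k))).
    by rewrite expRD ler_pM ?prodr_ge0// expRD lnK ?posrE// sizeW.
  by rewrite -natr1; ring.
have prodV k w : w \in tree_level V k -> posw w /\ \prod_(j <- w) (K2 / j%:R `^ (d - e)) <=
    expR (k%:R * ln C2 - (d - e) * q * (T (N + k) - T N)).
  elim: k w => [|k IH] w.
    rewrite inE => /eqP ->; split=> //.
    by rewrite big_nil addn0 subrr mulr0 mul0r subr0 expR0.
  case/lastP: w => [/allpairsP[[[|? ?] ?] [_ _]]//|w j].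
  rewrite tree_levelS => /andP[/IH[pw hw] /(Wj _ _ (N0i k))[jp jle]].
  rewrite -cats1 posw_cat pw/= jp; split=> //.
  rewrite big_cat/= big_seq1 addnS TS.
  rewrite [X in _ <= expR X](_ : _ = (k%:R * ln C2 - (d - e) * q * (T (N + k) - T N)) +
     (ln C2 - (d - e) * q * t (N + k))).
    rewrite expRD ler_pM//.
    - by apply: prodr_ge0 => i _; rewrite divr_ge0 ?powR_ge0// ltW.
    - by rewrite divr_ge0 ?powR_ge0// ltW.
    - by rewrite expRD lnK.
  by rewrite -natr1; ring.
(* The factors come from the prefix, from the m listed letters, and from the window of the next
   digit. *)
pose rho := expR (ln Lu + (m%:R * ln C2 - (d - e) * q * (T n - T N)) +
  (ln C0 + (q - 1) * t n + (ln C2 - (d - e) * q * t n))).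
exists (seq nat : eqType), (tree_level V m),
  (fun w => ifs_comp f (u ++ w) @` `[cut f (j0 n).-1, cut f (j1 n)]), (fun=> rho); split.
- move=> x [a [[a0 hx] au ha]].
  have [y y01 xy] := hx n.+1 isT.
  have aw : mkseq a n.+1 = u ++ rcons (mkseq (fun i => a (N + i)%N) m) (a n).
    rewrite -{1}Nm -addnS -addn1 addnA /mkseq !iotaD !map_cat -/(mkseq a N) au -catA; congr (_ ++ _).
    rewrite add0n cats1 Nm; congr (rcons _ _).
    by rewrite -{1}(addn0 N) iotaDl -map_comp.
  exists (mkseq (fun i => a (N + i)%N) m).
    apply: (@tree_level_seq _ V) => i.
    by apply: memW => //; apply: ha; rewrite leq_addr.
  rewrite /=; exists (f (a n) y).
    have pan : posw [:: a n] by rewrite /= a0.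
    have /andP[h1 h2] := ifs_comp_closed hf pan y01.
    have := memW n (a n) _ (ha n Nn); rewrite mem_iota => /(_ _)/andP[|g1 g2].
      by rewrite -Nm.
    rewrite in_itv/= (le_trans _ h1) ?(le_trans h2)//.
    - rewrite (cut_hi hf (a0 n)) (cut_le hf)//.
      move: g2; rewrite subnKC ?ltnS//; apply: leqW; rewrite le_truncn// pp// -Nm//.
    - by rewrite (cut_lo (a0 n)) (cut_le hf)// -!subn1 leq_sub2r.
  by rewrite -xy aw -cats1 catA [RHS]ifs_comp_cat.
- move=> w wV; have [pw hw] := prodV m w wV.
  apply: diam_le; first exact: expR_ge0.
  have cut01 z : z \in `[cut f (j0 n).-1, cut f (j1 n)] -> z \in `[0, 1].
    rewrite !in_itv/= => /andP[h1 h2]; rewrite (le_trans _ h1) ?(cut_ge0 hf)//=.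
    by rewrite (le_trans h2)// ltW// (cut_lt1 hf).
  move=> _ _ [z1 z1I <-] [z2 z2I <-].
  have c1_ge0 i : (0 < i)%N -> 0 <= K1 / i%:R `^ (d + e) by rewrite divr_ge0 ?powR_ge0// ltW.
  have c2_ge0 i : (0 < i)%N -> 0 <= K2 / i%:R `^ (d - e) by rewrite divr_ge0 ?powR_ge0// ltW.
  have /andP[_ hz] := ifs_comp_bounds hf c1_ge0 c2_ge0 hK pw (cut01 _ z1I) (cut01 _ z2I).
  rewrite !ifs_comp_cat.
  have h1 := hLu _ _ (ifs_comp_in01 hf pw (cut01 _ z1I)) (ifs_comp_in01 hf pw (cut01 _ z2I)).
  rewrite (le_trans h1)// /rho -addrA expRD lnK ?posrE// ler_pM2l//.
  rewrite (le_trans hz)// expRD ler_pM//.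
  - by apply: prodr_ge0 => i _; rewrite divr_ge0 ?powR_ge0// ltW.
  - by rewrite -{1}Nm.
  rewrite expRD [expR (ln C0 + _)]expRD [expR (ln C2 - _)]expRD !lnK ?posrE//.
  have := @cutW n; rewrite -{1}Nm => /(_ (N0i m)); apply: le_trans.
  exact: dist_in_itv.
rewrite big_const_seq count_predT iter_addr addr0 -mulr_natl.
have := sizeV m; rewrite Nm => hsz.
rewrite (le_trans (ler_wpM2r (powR_ge0 _ _) hsz))// powR_expR -expRD.
rewrite -[leRHS]lnK ?posrE// ler_expR.
have mn : m.+1%:R <= n.+1%:R :> R by rewrite ler_nat ltnS leq_subr.
have mn' : m%:R <= n.+1%:R :> R by rewrite ler_nat leqW// leq_subr.
have b1 : m%:R * ln C0 <= `|ln C0| * n.+1%:R by exact: mulr_le_norm.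
have bs (y : R) : s * y <= s * `|y| * n.+1%:R.
  by rewrite -mulrA ler_pM2l// -[leLHS]mul1r mulr_le_norm// ler1n.
have b3 : s * (m.+1%:R * ln C2) <= s * `|ln C2| * n.+1%:R.
  by rewrite -mulrA ler_pM2l// mulr_le_norm.
have b5 : A * T N <= `|A * T N| * n.+1%:R by rewrite -[leLHS]mul1r mulr_le_norm// ler1n.
rewrite [leLHS](_ : _ = m%:R * ln C0 + s * ln Lu + s * (m.+1%:R * ln C2) + s * ln C0 + A * T N
   - (A * T n - B * t n)); last by rewrite /A /B -natr1; ring.
rewrite -[leRHS]opprK; apply: le_trans (_ : C * n.+1%:R - (A * T n - B * t n) <= _).
  have -> : C * n.+1%:R = `|ln C0| * n.+1%:R + s * `|ln Lu| * n.+1%:R +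
      s * `|ln C2| * n.+1%:R + s * `|ln C0| * n.+1%:R + `|A * T N| * n.+1%:R.
    by rewrite /C; ring.
  by rewrite lerD2r; exact: lerD (lerD (lerD (lerD b1 (bs _)) b3) (bs _)) b5.
by rewrite lerNr opprB.
Qed.

Lemma fast_level_set_cover a : (forall k, 0 < a k)%N ->
  (fun n => birkhoff_sum f phi a n / Phi n) @ \oo --> (1 : R) ->
  \forall k \near \oo, `|(a k)%:R `^ c - expR (t k)| <= 1.
Proof.
move=> a0 ha.
have /cvgrPdist_le/(_ 2^-1) : (fun n => expR ((a n)%:R `^ c) / Phi n.+1) @ \oo --> (1 : R).
  apply: (@last_term_ratio _ (fun k => expR ((a k)%:R `^ c)) Phi Phi_gt0 Phi_ratio).
  have -> // : (fun n => (\sum_(k < n) expR ((a k)%:R `^ c)) / Phi n) =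
    (fun n => birkhoff_sum f phi a n / Phi n).
  by apply/funext => n; rewrite birkhoff_sumE.
rewrite invr_gt0 ltr0n => /(_ isT); apply: filterS => k.
rewrite PhiS -expRB; set z := (a k)%:R `^ c - expR (t k) => h.
(* An exponential within 1/2 of 1 has its argument in [-1, 1], since e >= 2. *)
have e2 := @expR_ge1Dx R 1.
have eN1 : expR (- 1) <= 2^-1 :> R by rewrite expRN lef_pV2 ?posrE ?expR_gt0.
move: h; rewrite ler_norml => /andP[h1 h2].
rewrite ler_norml; apply/andP; split; rewrite leNgt; apply/negP; rewrite -ltr_expR => h; lra.
Qed.

(** The rank from which the digits obey their windows depends on the point, so the level set is
    split according to its countably many finite prefixes. *)
Lemma fast_upper s : 0 < s -> q - 1 < s * (d * q * G - (q - 1) * (G - 1)) ->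
  hausdorff_measure s (birkhoff_level_set f phi Phi) = 0%E.
Proof.
move=> s0 hs; have [N0 hN0] := fast_upper_covers s0 hs.
pose F u := [set x : R | exists a, [/\ symbolic_expansion f a x, mkseq a (size u) = u &
    forall k, (size u <= k)%N -> `|(a k)%:R `^ c - expR (t k)| <= 1]].
pose F' n := if unpickle n is Some u then
   if posw u && (N0 <= size u)%N then F u else set0 else set0.
have null0 : hausdorff_measure s (set0 : set R) = 0%E.
  apply: hausdorff_null_finite_covers => // eta eta0.
  by exists nat, [::], (fun=> set0), (fun=> 0); split => //; rewrite big_nil ltW.
apply: (@hausdorff_null_sub _ _ _ (\bigcup_n F' n)) => //; last first.
  apply: hausdorff_null_bigcup => // n; rewrite /F'; case: unpickle => [u|] //.
  by case: ifP => // /andP[pu Nu]; exact: hN0.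
move=> x [_ [a [ha Sa]]]; have [N1 _ hN1] := fast_level_set_cover ha.1 Sa.
pose N := maxn N0 N1; exists (pickle (mkseq a N)) => //.
rewrite /F' pickleK size_mkseq leq_maxl.
have -> /= : posw (mkseq a N) by apply/allP => _ /mapP[k _ ->]; exact: ha.1.
exists a; rewrite size_mkseq; split=> // k Nk.
by apply: hN1; rewrite /= (leq_trans _ Nk)// leq_maxr.
Qed.

Theorem fast_hausdorff_dim : hausdorff_dim (birkhoff_level_set f phi Phi) =
  ((1 - c) / (d * G - (1 - c) * (G - 1)))%:E.
Proof.
have := (hd, hc0, hc1, G_ge1, q_gt1, cq) => -[[[[[d1 c0] c1] G1] q1] cq1].
pose D := d * G - (1 - c) * (G - 1).
have D0 : 0 < D.
  have : 0 < (d - (1 - c)) * G by rewrite mulr_gt0//; lra.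
  by rewrite /D; lra.
have cD : c * (d * q * G - (q - 1) * (G - 1)) = D.
  have -> : c * (d * q * G - (q - 1) * (G - 1)) = d * G * (c * q) - (c * q - c) * (G - 1) by ring.
  by rewrite cq1 /D; ring.
have cq' : c * (q - 1) = 1 - c by rewrite mulrBr cq1 mulr1.
apply: hausdorff_dim_eq; first by rewrite divr_ge0 ?(ltW D0)//; lra.
  move=> s; rewrite ltr_pdivrMr// => hs; apply: fast_upper.
    by rewrite -(pmulr_lgt0 _ D0) (lt_trans _ hs)//; lra.
  by rewrite -(ltr_pM2l c0) cq' mulrCA cD.
move=> s s0; rewrite ltr_pdivlMr// => hs; apply: fast_lower => //.
by rewrite -(ltr_pM2l c0) cq' mulrCA cD.
Qed.

End FastGrowth.

(** * The three fast growth rates *)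

Section FastInstances.
Context {R : realType}.
Implicit Types (t : nat -> R).

Lemma partial_sums_superlinear t : (forall k, 0 <= t k) ->
  (forall M, \forall k \near \oo, M <= t k) ->
  forall e : R, 0 < e -> \forall k \near \oo, k%:R <= e * \sum_(i < k) t i.
Proof.
move=> t0 tM e e0; have [N _ hN] := tM (2 / e).
exists (2 * N)%N => // k /= Nk; have Nk' : (N <= k)%N by lia.
have h : 2 / e * (k - N)%:R <= \sum_(i < k) t i.
  rewrite -(big_mkord xpredT) (big_cat_nat (n := N))//= -[leLHS]add0r lerD//.
    by rewrite sumr_ge0.
  rewrite mulr_natr -sumr_const_nat; apply: ler_sum_nat => i /andP[Ni _].
  exact: hN.
have : e * (2 / e * (k - N)%:R) <= e * \sum_(i < k) t i by rewrite ler_pM2l.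
apply: le_trans; have -> : e * (2 / e * (k - N)%:R) = 2 * (k - N)%:R by field; rewrite gt_eqF.
by rewrite -natrM ler_nat; lia.
Qed.

Context {d c : R} {f : nat -> R -> R} {phi : R -> R}.
Hypotheses (hd : 1 < d) (hf : decaying_gauss_like_ifs d f)
  (hc0 : 0 < c) (hc1 : c < 1)
  (hphij : forall j : nat, (0 < j)%N ->
     potential_value f phi j = expR (j%:R `^ c)).

Let c1 : 1 < c^-1. Proof. by rewrite invf_gt1. Qed.
Let cV : c * c^-1 = 1. Proof. by rewrite divff// gt_eqF. Qed.
Let dim1 : (1 - c) / (d * 1 - (1 - c) * (1 - 1)) = (1 - c) / d.
Proof. by rewrite subrr mulr0 subr0 mulr1. Qed.

Lemma stretched_exponential_dim (alpha : R) : 1 < alpha ->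
  hausdorff_dim (birkhoff_level_set f phi (fun n : nat => expR (n%:R `^ alpha))) =
  ((1 - c) / d)%:E.
Proof.
move=> a1; rewrite -dim1.
pose t k : R := alpha * ln (k.+1%:R).
have a0 : 0 < alpha by lra.
have ln0 (k : nat) : 0 <= ln (k.+1%:R : R) by rewrite ln_ge0// ler1n.
have t0 k : 0 <= t k by rewrite mulr_ge0// ltW.
have expt k : expR (t k) = k.+1%:R `^ alpha by rewrite /powR gt_eqF ?ltr0n.
have tM M : \forall k \near \oo, M <= t k.
  have := @nbhs_infty_ger R (expR (M / alpha)); apply: filterS => k h.
  rewrite /t mulrC -ler_pdivrMr// -ler_expR lnK ?posrE// (le_trans h)//.
  by rewrite ler_nat.
have sup := partial_sums_superlinear t0 tM.
apply: (@fast_hausdorff_dim R d c f phi hd hf hc0 hc1 hphij t 1 c^-1) => //.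
- by move=> k; rewrite expt.
- move=> e e0; have := sup (e / alpha) (divr_gt0 e0 a0); apply: filterS => k h.
  rewrite subrr mul0r subr0 ger0_norm// /t mulrC -ler_pdivlMr// mulrAC.
  apply: le_trans h; have := @le_ln1Dx R k%:R; rewrite addrC natr1; apply.
  by rewrite (lt_le_trans (_ : _ < 0))// ltrN10.
(* The increments of [n ^ alpha] are unbounded precisely because alpha > 1. *)
- move=> M; have am : 0 < alpha - 1 by lra.
  have := powR_unbounded am M; apply: filterS => k h.
  rewrite !expt; have k0 : 0 < k.+1%:R :> R by [].
  have hM : M <= k.+1%:R `^ (alpha - 1).
    by rewrite (le_trans h)// ge0_ler_powR ?nnegrE ?(ltW am)// ler_nat.
  have -> : k.+2%:R = k.+1%:R * (1 + k.+1%:R^-1) :> R.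
    by rewrite mulrDr mulr1 divff ?gt_eqF// natr1.
  rewrite powRM ?addr_ge0// -[X in _ - X]mulr1 -mulrBr.
  apply: (le_trans hM).
  rewrite -(@mulr_powRB1 _ k.+1%:R alpha)// mulrAC.
  rewrite ler_peMl ?powR_ge0//.
  rewrite -ler_pdivrMl// mulr1 lerBrDl.
  by rewrite le1r_powR ?lerDl ?invr_ge0// ltW.
Qed.

Lemma double_exponential_dim (beta : R) : 1 < beta ->
  hausdorff_dim (birkhoff_level_set f phi (fun n : nat => expR (beta ^+ n))) =
  ((1 - c) / d)%:E.
Proof.
move=> b1; rewrite -dim1; have b0 : 0 < beta by lra.
have lb : 0 < ln beta by rewrite ln_gt0.
pose t k : R := k.+1%:R * ln beta.
have t0 k : 0 <= t k by rewrite mulr_ge0// ltW.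
have expt k : expR (t k) = beta ^+ k.+1 by rewrite expRM_natl lnK.
have tM M : \forall k \near \oo, M <= t k.
  have := @nbhs_infty_ger R (M / ln beta); apply: filterS => k h.
  by rewrite /t -ler_pdivrMr// (le_trans h)// ler_nat.
have sup := partial_sums_superlinear t0 tM.
apply: (@fast_hausdorff_dim R d c f phi hd hf hc0 hc1 hphij t 1 c^-1) => //.
- exact: expR_gt0.
- by move=> k; rewrite expt.
- move=> e e0; near=> k.
  rewrite subrr mul0r subr0 ger0_norm// /t -ler_pdivlMr// mulrAC.
  have h : k%:R <= e / (2 * ln beta) * \sum_(i < k) t i.
    by near: k; apply: sup; rewrite divr_gt0// mulr_gt0.
  have -> : e / ln beta * \sum_(i < k) t i = 2 * (e / (2 * ln beta) * \sum_(i < k) t i).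
    by field; rewrite gt_eqF.
  have k1 : 1 <= k%:R :> R by near: k; exists 1%N => // k /= k1; rewrite ler1n.
  rewrite -natr1; lra.
- move=> M; have bm : 0 < beta - 1 by lra.
  have := expr_unbounded b1 (M / (beta - 1)); apply: filterS => k h.
  rewrite !expt (exprS _ k.+1) -[X in _ - X]mul1r -mulrBl mulrC -ler_pdivrMr//.
  by rewrite (le_trans h)// exprS ler_peMl ?exprn_ge0 ?ltW.
Unshelve. all: by end_near. Qed.

Lemma triple_exponential_dim (gamma : R) : 1 < gamma ->
  hausdorff_dim (birkhoff_level_set f phi (fun n : nat => expR (expR (gamma ^+ n)))) =
  ((1 - c) / (d * gamma - (1 - c) * (gamma - 1)))%:E.
Proof.
move=> g1; have g0 : 0 < gamma by lra.
pose t k : R := gamma ^+ k.+1.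
have t0 k : 0 <= t k by rewrite exprn_ge0// ltW.
have tM M : \forall k \near \oo, M <= t k.
  have := expr_unbounded g1 M; apply: filterS => k h.
  by rewrite (le_trans h)// /t exprS ler_peMl ?exprn_ge0 ?ltW.
have sup := partial_sums_superlinear t0 tM.
(* By this geometric sum t - (gamma - 1) T is constant, so G = gamma. *)
have geo k : (gamma - 1) * \sum_(i < k) t i = t k - gamma.
  elim: k => [|k IH]; first by rewrite big_ord0 mulr0 /t expr1 subrr.
  by rewrite big_ord_recr/= mulrDr IH /t (exprS _ k.+1); ring.
apply: (@fast_hausdorff_dim R d c f phi hd hf hc0 hc1 hphij t gamma c^-1) => //.
- exact: ltW.
- move=> e e0; near=> k.
  rewrite geo opprB addrCA subrr addr0 ger0_norm ?(ltW g0)//.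
  have h : k%:R <= e / gamma * \sum_(i < k) t i by near: k; apply: sup; rewrite divr_gt0.
  have k1 : 1 <= k%:R :> R by near: k; exists 1%N => // k /= k1; rewrite ler1n.
  have := le_trans k1 h; rewrite -(ler_pM2l g0) mulr1 => /le_trans; apply.
  by rewrite le_eqVlt; apply/orP; left; apply/eqP; field; rewrite gt_eqF.
- move=> M; have gm : 0 < gamma - 1 by lra.
  have := tM (M / (gamma - 1)); apply: filterS => k; rewrite ler_pdivrMr// => h.
  have -> : t k.+1 = t k + t k * (gamma - 1) by rewrite /t (exprS _ k.+1); ring.
  rewrite expRD; have e1 := @expR_ge1Dx R (t k * (gamma - 1)).
  have e2 : 1 <= expR (t k) by rewrite -[leLHS]expR0 ler_expR.
  have e3 : 0 <= t k * (gamma - 1) by rewrite mulr_ge0// ltW.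
  nra.
Unshelve. all: by end_near. Qed.

End FastInstances.

(** * Slowly growing Birkhoff sums *)

Section SizeClass.
Context {R : realType}.

(* If positive numbers of total mass at least 1/2 are all small, then more than
   C ell^(-s) of them exceed some ell: otherwise, summing over dyadic scales,
   their total would be at most a tail of a geometric series of ratio 2^(s-1). *)
Lemma size_class (s C : R) : 0 < s -> s < 1 -> 0 < C -> exists2 rho, 0 < rho &
  forall (T : eqType) (F : seq T) (x : T -> R),
    {in F, forall w, x w <= rho} -> 2^-1 <= \sum_(w <- F) x w ->
    exists ell, [/\ 0 < ell, ell <= rho &
      C <= (count (fun w => ell <= x w) F)%:R * ell `^ s].
Proof.
move=> s0 s1 C0.
(* Here b r = 1/2, so h_k = b^k r^k. If fewer than C h_(k+1)^(-s) terms exceed h_(k+1), then their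
   number times h_k is at most (C/b) r^k, which is summable as s < 1. *)
pose h k : R := 2^-1 ^+ k; pose b : R := 2^-1 `^ s; pose r : R := 2^-1 `^ (1 - s).
have h0 k : 0 < h k by rewrite exprn_gt0// invr_gt0.
have b0 : 0 < b by rewrite powR_gt0 ?invr_gt0.
have r0 : 0 < r by rewrite powR_gt0 ?invr_gt0.
have half1 : 2^-1 < 1 :> R by rewrite invf_lt1// ltrDl.
have r1 : r < 1.
  have one : (1 : R) `^ (1 - s) = 1 by rewrite powR1.
  by rewrite -[ltRHS]one gt0_ltr_powR ?nnegrE ?subr_gt0.
have br : b * r = 2^-1.
  rewrite -powRD; last by rewrite invr_eq0 pnatr_eq0 implybT.
  by rewrite addrC subrK powRr1.
have hs k : h k.+1 `^ s = b ^+ k.+1.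
  have hp : 0 <= 2^-1 :> R by rewrite invr_ge0.
  by rewrite /h -(powR_mulrn _ hp) powRAC powR_mulrn// ltW.
have hb k : h k = b ^+ k * r ^+ k by rewrite -exprMn br.
pose Q := C / b / (1 - r).
have Q0 : 0 < Q by rewrite !divr_gt0//; lra.
have [k0 hk0] : exists k, r ^+ k <= (8 * Q)^-1.
  by apply: expr_small => //; rewrite invr_gt0 mulr_gt0.
exists (h k0) => // T F x xF Fhalf.
apply: contrapT => no.
have few k : (k0 <= k)%N -> (count (fun w => h k.+1 <= x w) F)%:R * h k <= C / b * r ^+ k.
  move=> k0k; have hle : h k.+1 <= h k0.
    by rewrite /h ler_wiXn2l ?invr_ge0// ?(ltW half1)// leqW.
  have : (count (fun w => h k.+1 <= x w) F)%:R * h k.+1 `^ s < C.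
    by rewrite ltNge; apply/negP => hC; apply: no; exists (h k.+1).
  move=> /ltW; rewrite hs -ler_pdivlMr ?exprn_gt0// => /(ler_wpM2r (ltW (h0 k))) /le_trans; apply.
  rewrite hb exprS le_eqVlt; apply/orP; left; apply/eqP; field.
  by rewrite gt_eqF//= expf_neq0// gt_eqF.
(* Each x is at most the sum of the scales whose successor it exceeds, up to the last scale
   considered; m is then taken so large that this remainder is negligible over all of F. *)
have layers m w : w \in F -> x w <= \sum_(i < m) h (k0 + i)%N * (h (k0 + i).+1 <= x w)%R%:R + h (k0 + m)%N.
  move=> /xF xw; elim: m => [|m IH]; first by rewrite big_ord0 add0r addn0.
  rewrite big_ord_recr/= addnS; case: (leP (h (k0 + m).+1) (x w)) => hx.
    by rewrite mulr1 (le_trans IH)// lerDl ltW.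
  rewrite mulr0 addr0 (le_trans (ltW hx))// lerDr sumr_ge0// => i _.
  by rewrite mulr_ge0// ltW.
have [m hm] : exists m, h m <= (8 * ((size F)%:R + 1))^-1.
  by apply: expr_small; rewrite ?invr_gt0// mulr_gt0// ltr_wpDl.
have tail : (size F)%:R * h (k0 + m)%N <= 8^-1.
  have : h (k0 + m)%N <= h m.
    by rewrite /h ler_wiXn2l ?invr_ge0// ?(ltW half1)// leq_addl.
  move=> /le_trans/(_ hm); set S := (size F)%:R => hS.
  have S0 : 0 <= S by [].
  have : S * h (k0 + m)%N <= S * (8 * (S + 1))^-1 by rewrite ler_wpM2l.
  move=> /le_trans; apply; rewrite ler_pdivrMr; last by rewrite mulr_gt0// ltr_wpDl.
  have -> : 8^-1 * (8 * (S + 1)) = S + 1 by field.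
  by rewrite lerDl.
have head : \sum_(i < m) (count (fun w => h (k0 + i).+1 <= x w) F)%:R * h (k0 + i)%N <= 8^-1.
  apply: (@le_trans _ _ (\sum_(i < m) C / b * r ^+ k0 * r ^+ i)).
    by apply: ler_sum => i _; rewrite -mulrA -exprD few// leq_addr.
  rewrite -mulr_sumr (@le_trans _ _ (C / b * r ^+ k0 * (1 - r)^-1))//.
    by rewrite ler_wpM2l ?geometric_le// mulr_ge0 ?exprn_ge0 ?divr_ge0 ?(ltW C0) ?(ltW b0) ?(ltW r0).
  rewrite mulrAC -/Q; have := ler_wpM2l (ltW Q0) hk0; move=> /le_trans; apply.
  by rewrite le_eqVlt; apply/orP; left; apply/eqP; field; rewrite gt_eqF.
have : \sum_(w <- F) x w <= 8^-1 + 8^-1.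
  apply: (@le_trans _ _ (\sum_(w <- F) (\sum_(i < m) h (k0 + i)%N * (h (k0 + i).+1 <= x w)%R%:R + h (k0 + m)%N))).
    by rewrite big_seq [leRHS]big_seq; apply: ler_sum => w; exact: layers.
  rewrite big_split/= lerD//; last first.
    by rewrite big_const_seq count_predT iter_addr addr0 -[leLHS]mulr_natl.
  rewrite exchange_big/= (le_trans _ head)// ler_sum// => i _.
  rewrite -mulr_sumr mulrC -natr_sum -sum1_count [in leRHS]big_mkcond le_eqVlt; apply/orP; left.
  by apply/eqP; congr (_%:R * _); apply: eq_bigr => w _; case: (_ <= _).
lra.
Qed.

End SizeClass.

(** * Scheduling the inserted digits *)

Section DigitSchedule.
Context {R : realType} (alpha c : R) (p : nat).
Hypotheses (alpha_gt0 : 0 < alpha) (alpha_lt1 : alpha < 1) (c_gt0 : 0 < c) (c_lt1 : c < 1)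
  (p_gt0 : (0 < p)%N).

Context (H F : nat -> R).
Hypotheses (HE : forall k, H k = expR ((p * k)%:R `^ alpha))
  (FE : forall j, F j = expR (j%:R `^ c)).

Let F_gt0 j : 0 < F j. Proof. by rewrite FE expR_gt0. Qed.
Let H_gt0 k : 0 < H k. Proof. by rewrite HE expR_gt0. Qed.

Lemma digit_weight_le i j : (i <= j)%N -> F i <= F j.
Proof.
by move=> ij; rewrite !FE ler_expR ge0_ler_powR ?nnegrE ?(ltW c_gt0)// ler_nat.
Qed.

Lemma digit_weight_unbounded M : exists j, M < F j.+3.
Proof.
have [N _ hN] := powR_unbounded c_gt0 M; exists N.
have /= h := hN N.+3 (leqW (leqW (leqnSn N))).
by rewrite FE; have := @expR_ge1Dx R (N.+3%:R `^ c); lra.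
Qed.

(* The digit 2 is the fallback when already F 3 overshoots the target. *)
Lemma greedy_digit (S target : R) : exists g,
  [/\ (1 < g)%N, S + F g <= target \/ g = 2%N & target < S + F g.+1].
Proof.
have ex : exists j, target < S + F j.+3.
  by have [j hj] := digit_weight_unbounded (target - S); exists j; lra.
case: (ex_minnP ex) => [[|j] hj jmin]; first by exists 2%N; split=> //; right.
exists j.+3; split=> //; left; rewrite leNgt; apply/negP => /jmin.
by rewrite ltnn.
Qed.

(** As c < 1, neighbouring large digits have weights of ratio close to 1, so a greedy choice has
    small relative error; C takes care of the small digits. *)
Lemma digit_weight_succ (e : R) : 0 < e -> exists2 C, 0 < C & forall j, F j.+1 <= (1 + e) * F j + C.
Proof.
move=> e0; have c1 : 0 < 1 - c by rewrite subr_gt0.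
have le0 : 0 < ln (1 + e) by rewrite ln_gt0// ltrDl.
have [N _ hN] := powR_unbounded c1 (ln (1 + e))^-1.
exists (F N.+1) => // j; have [jN|Nj] := leqP j N.
  by rewrite (le_trans (digit_weight_le (_ : j.+1 <= N.+1)%N))// lerDr mulr_ge0 ?ltW// addr_gt0.
have j0 : 0 < j%:R :> R by rewrite ltr0n (leq_ltn_trans _ Nj).
rewrite (@le_trans _ _ ((1 + e) * F j))//; last by rewrite lerDl ltW.
rewrite -[1 + e]lnK ?posrE ?addr_gt0// !FE -expRD ler_expR -lerBlDr.
have := powR_concave_gap c_gt0 (ltW c_lt1) j0 ler01; rewrite natr1 mul1r => /le_trans; apply.
have := hN j (ltnW Nj); rewrite /= -[c - 1]opprB powRN => h.
by rewrite -[leRHS]invrK lef_pV2 ?posrE ?invr_gt0 ?powR_gt0.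
Qed.

Lemma block_target_gap (e : R) : 0 < e -> \forall k \near \oo, (p * k.+1)%:R `^ alpha - (p * k)%:R `^ alpha <= e.
Proof.
move=> e0; have a1 : 0 < 1 - alpha by rewrite subr_gt0.
have := powR_unbounded a1 (p%:R / e) ; move=> h; near=> k.
have k0 : (0 < k)%N by near: k; exists 1%N.
have pk0 : 0 < (p * k)%:R :> R by rewrite ltr0n muln_gt0 p_gt0.
have -> : (p * k.+1)%:R = (p * k)%:R + p%:R :> R by rewrite mulnS addnC natrD.
rewrite (le_trans (powR_concave_gap alpha_gt0 (ltW alpha_lt1) pk0 _))//.
rewrite -[alpha - 1]opprB powRN ler_pdivrMr ?powR_gt0// mulrC -ler_pdivrMr//.
apply: (@le_trans _ _ (k%:R `^ (1 - alpha))); first by near: k.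
by rewrite ge0_ler_powR ?nnegrE ?(ltW a1)// ler_nat leq_pmull.
Unshelve. all: by end_near. Qed.

Lemma linear_le_block_target (M e : R) : 0 < e -> \forall k \near \oo, M * k.+1%:R <= e * H k.
Proof.
move=> e0; pose M' := `|M| + 1; have M0 : 0 < M' by rewrite ltr_wpDl.
(* With z = k^(alpha/2), the logarithm of a multiple of k is at most a constant times z plus a
   constant, hence eventually at most z^2 = k^alpha. *)
have a2 : 0 < alpha / 2 by rewrite divr_gt0.
near=> k.
have k0 : (0 < k)%N by near: k; exists 1%N.
have k1 : 0 < k%:R :> R by rewrite ltr0n.
have z1 : 1 <= k%:R `^ (alpha / 2) :> R by near: k; exact: powR_unbounded.
have zM : 2 / alpha + `|ln (2 * M' / e)| <= k%:R `^ (alpha / 2).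
  by near: k; exact: powR_unbounded.
pose z : R := k%:R `^ (alpha / 2); rewrite -/z in z1 zM.
have lk : ln (k%:R : R) <= z * (2 / alpha).
  by have := ln_le_powR a2 k1; rewrite invf_div.
have kk : k.+1%:R <= 2 * k%:R :> R.
  by rewrite -natr1; have : 1 <= k%:R :> R; [rewrite ler1n|lra].
have MM := ler_norm M.
apply: (@le_trans _ _ (M' * k.+1%:R)); first by rewrite ler_wpM2r// /M'; lra.
apply: (@le_trans _ _ (M' * (2 * k%:R))); first by rewrite ler_pM2l.
have -> : M' * (2 * k%:R) = e * (2 * M' / e * k%:R) by field; rewrite gt_eqF.
rewrite ler_pM2l// HE -[leLHS]lnK ?posrE ?mulr_gt0 ?invr_gt0// ler_expR lnM ?posrE ?mulr_gt0 ?invr_gt0//.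
apply: (@le_trans _ _ (z * z)).
  have := ler_norm (ln (2 * M' / e)); have := normr_ge0 (ln (2 * M' / e)); nra.
rewrite -powRD; last by rewrite (gt_eqF k1) implybT.
have -> : alpha / 2 + alpha / 2 = alpha by field.
by rewrite ge0_ler_powR ?nnegrE ?(ltW alpha_gt0)// ler_nat leq_pmull.
Unshelve. all: by end_near. Qed.

Let beta : R := (1 + alpha) / 2.
(** A greedy digit is allowed at k exactly when [Fl] jumps between k and k+1. Having beta > alpha
    makes the jumps dense enough for the target to be nearly constant between them; having beta < 1
    makes them too rare for their logarithmic cost to reach order k. *)
Let Fl k := Num.truncn (k%:R `^ beta : R).

Lemma beta_bounds : [/\ 0 < beta, alpha < beta & beta < 1].
Proof. by have := (alpha_gt0, alpha_lt1) => -[? ?]; rewrite /beta; split; lra. Qed.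

Lemma jump_index_le i j : (i <= j)%N -> (Fl i <= Fl j)%N.
Proof.
move=> ij; have [b0 _ _] := beta_bounds.
by apply: le_truncn; rewrite ge0_ler_powR ?nnegrE ?(ltW b0)// ler_nat.
Qed.

Lemma last_jump k : (0 < k)%N -> exists j, [/\ (j < k)%N, (Fl j < Fl j.+1)%N & Fl j.+1 = Fl k].
Proof.
move=> k0; have [b0 _ _] := beta_bounds.
have Fl0 : Fl 0 = 0%N by rewrite /Fl powR0 ?gt_eqF// truncn0.
have Fl1 : (0 < Fl k)%N.
  by apply: leq_trans (jump_index_le k0); rewrite /Fl powR1 truncn1.
have ex : exists i, Fl i == Fl k by exists k.
case: (ex_minnP ex) => [[|j] /eqP hj jmin]; first by rewrite -hj Fl0 in Fl1.
exists j; split=> //; first exact: jmin.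
rewrite ltn_neqAle jump_index_le// andbT hj; apply/negP => /jmin; by rewrite ltnn.
Qed.

(** In the variable y = k^beta the target exponent is p^alpha y^tau with tau = alpha / beta < 1, and
    y grows by less than 1 while [Fl] is constant. *)
Lemma jump_target_gap (e : R) : 0 < e -> \forall k \near \oo, forall j, (j.+1 <= k)%N ->
  Fl j.+1 = Fl k -> (p * k)%:R `^ alpha - (p * j.+1)%:R `^ alpha <= e.
Proof.
move=> e0; have [b0 ab b1] := beta_bounds.
pose tau := alpha / beta.
have tau0 : 0 < tau by rewrite divr_gt0.
have tau1 : 0 < 1 - tau by rewrite subr_gt0 ltr_pdivrMr// mul1r.
have bt : beta * tau = alpha by rewrite mulrC divfK// gt_eqF.
pose M0 := p%:R `^ alpha / e.
have pa0 : 0 < p%:R `^ alpha :> R by rewrite powR_gt0// ltr0n.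
have M00 : 0 < M0 by rewrite divr_gt0.
near=> k; move=> j jk Fjk.
have yX : M0 `^ (1 - tau)^-1 + 1 <= k%:R `^ beta by near: k; exact: powR_unbounded.
have powE (m : nat) : m%:R `^ alpha = (m%:R `^ beta) `^ tau :> R by rewrite -powRrM bt.
rewrite !natrM !powRM// -mulrBr (powE k) (powE j.+1).
set y : R := k%:R `^ beta in yX *; set x : R := j.+1%:R `^ beta.
have x0 : 0 < x by rewrite powR_gt0.
have yx : y < x + 1.
  have /andP[_ h] := truncn_itv (powR_ge0 k%:R beta : 0 <= y).
  have /andP[h' _] := truncn_itv (powR_ge0 j.+1%:R beta : 0 <= x).
  apply: lt_le_trans h _; rewrite -natr1 lerD2r.
  by rewrite -[Num.truncn y]/(Fl k) -Fjk.
have xX : M0 <= x `^ (1 - tau).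
  have -> : M0 = (M0 `^ (1 - tau)^-1) `^ (1 - tau).
    by rewrite -powRrM mulVf ?lt0r_neq0// powRr1// ltW.
  rewrite ge0_ler_powR ?nnegrE ?powR_ge0 ?(ltW tau1)//; lra.
have h1 : y `^ tau <= (x + 1) `^ tau.
  by rewrite ge0_ler_powR ?nnegrE ?powR_ge0 ?addr_ge0 ?(ltW yx) ?(ltW tau0) ?(ltW x0).
have tau1' : tau <= 1 by rewrite -subr_ge0 ltW.
have h2 := powR_concave_gap tau0 tau1' x0 ler01.
rewrite mul1r -[tau - 1]opprB powRN in h2.
have h3 : (x `^ (1 - tau))^-1 <= M0^-1 by rewrite lef_pV2 ?posrE ?powR_gt0.
apply: (@le_trans _ _ (p%:R `^ alpha * M0^-1)).
  by rewrite ler_pM2l// (le_trans _ h3)// (le_trans _ h2)// lerD2r.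
by rewrite /M0 invf_div mulrCA divff ?mulr1// gt_eqF.
Unshelve. all: by end_near. Qed.

Lemma digit_schedule : exists g : nat -> nat,
  [/\ forall k, (1 < g k)%N,
      forall e : R, 0 < e -> \forall k \near \oo,
        \sum_(i < k) ln ((g i)%:R / 2) <= e * k%:R &
      (fun k => (\sum_(i < k) F (g i)) / H k) @ \oo --> (1 : R)].
Proof.
have [b0 ab b1] := beta_bounds.
have /choice[pick pickP] : forall kS : nat * R, exists g : nat,
    if (Fl kS.1 < Fl kS.1.+1)%N then
      [/\ (1 < g)%N, kS.2 + F g <= H kS.1.+1 \/ g = 2%N & H kS.1.+1 < kS.2 + F g.+1]
    else g = 2%N.
  move=> [k S] /=; case: (Fl k < Fl k.+1)%N; last by exists 2%N.
  exact: greedy_digit.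
have [g [S [S_0 SS gP]]] : exists (g : nat -> nat) (S : nat -> R),
    [/\ S 0%N = 0, forall k, S k.+1 = S k + F (g k) & forall k,
      if (Fl k < Fl k.+1)%N then
        [/\ (1 < g k)%N, S k + F (g k) <= H k.+1 \/ g k = 2%N & H k.+1 < S k + F (g k).+1]
      else g k = 2%N].
  pose S := fix S k : R := if k is k'.+1 then S k' + F (pick (k', S k')) else 0.
  exists (fun k => pick (k, S k)), S; split=> // k; exact: pickP (k, S k).
have SE k : S k = \sum_(i < k) F (g i).
  by elim: k => [|k IH]; rewrite ?big_ord0// big_ord_recr/= -IH SS.
have g1 k : (1 < g k)%N by have := gP k; case: ifP => [_ []|_ ->].
have S0 k : 0 <= S k by rewrite SE sumr_ge0// => i _; exact: ltW.
have S_le i j : (i <= j)%N -> S i <= S j.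
  elim: j => [|j IH]; first by rewrite leqn0 => /eqP ->.
  rewrite leq_eqVlt => /predU1P[->//|]; rewrite ltnS => /IH /le_trans; apply.
  by rewrite SS lerDl ltW.
have H_le k : H k <= H k.+1.
  by rewrite !HE ler_expR ge0_ler_powR ?nnegrE ?(ltW alpha_gt0)// ler_nat leq_mul2l leqnSn orbT.
(* A digit other than 2 never takes the sum past the target; only the digits 2 can overshoot, by a
   linear amount in all. *)
have upper k : S k <= H k + F 2 * k%:R.
  elim: k => [|k IH]; first by rewrite S_0 mulr0 addr0 ltW.
  have F2 := F_gt0 2; have Hk := H_le k.
  have two : g k = 2%N -> S k.+1 <= H k.+1 + F 2 * k.+1%:R.
    by move=> g2; rewrite SS g2 -natr1 mulrDr mulr1 addrA lerD2r (le_trans IH)// lerD2r.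
  have := gP k; case: ifP => [_ [_ [h|/two//] _]|_ /two//].
  by rewrite SS (le_trans h)// lerDl mulr_ge0 ?(ltW F2).
exists g; split=> //.
(* A greedy digit costs O(ln k) = O(k^gm) and there are at most k^beta of them. As beta + 2 gm = 1,
   a further factor k^gm remains to beat the constants. *)
- move=> e e0; pose gm := (1 - beta) / 2; have gm0 : 0 < gm by rewrite /gm; lra.
  near=> k.
  have k0 : (0 < k)%N by near: k; exists 1%N.
  have kR : 0 < k%:R :> R by rewrite ltr0n.
  have pk0 : 0 < (p * k)%:R :> R by rewrite ltr0n muln_gt0 p_gt0.
  have pk1 : 0 <= ln ((p * k)%:R : R) by rewrite ln_ge0// ler1n muln_gt0 p_gt0.
  have kM : alpha / c * (p%:R `^ gm / gm) / e <= k%:R `^ gm by near: k; exact: powR_unbounded.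
  pose D := alpha / c * ln ((p * k)%:R : R).
  have D0 : 0 <= D by rewrite mulr_ge0// divr_ge0 ?ltW.
  have gbound i : (i < k)%N -> ln ((g i)%:R / 2) <= ((Fl i.+1)%:R - (Fl i)%:R) * D.
    move=> ik; have dF : 0 <= (Fl i.+1)%:R - (Fl i)%:R :> R by rewrite subr_ge0 ler_nat jump_index_le.
    have two : g i = 2%N -> ln ((g i)%:R / 2 : R) <= ((Fl i.+1)%:R - (Fl i)%:R) * D.
      by move=> ->; rewrite divff// ln1 mulr_ge0.
    have := gP i; case: ifP => [jmp [_ [h|/two//] _]|_ /two//].
    have gi0 : 0 < (g i)%:R :> R by rewrite ltr0n ltnW.
    have h1 : 1 <= (Fl i.+1)%:R - (Fl i)%:R :> R.
      by rewrite lerBrDl natr1 ler_nat.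
    apply: (@le_trans _ _ D); last by rewrite ler_peMl.
    apply: (@le_trans _ _ (ln (g i)%:R)).
      by rewrite ler_ln ?posrE ?divr_gt0// ler_pdivrMr// ler_peMr ?ler1n// ltW.
    have : F (g i) <= H k.
      apply: (@le_trans _ _ (H i.+1)); first by apply: le_trans h; rewrite lerDr.
      by rewrite !HE ler_expR ge0_ler_powR ?nnegrE ?(ltW alpha_gt0)// ler_nat leq_mul2l ik orbT.
    rewrite FE HE ler_expR -ler_ln ?posrE ?powR_gt0// !ln_powR => h2.
    by rewrite /D mulrAC ler_pdivlMr// mulrC.
  apply: (@le_trans _ _ ((Fl k)%:R * D)).
    apply: (@le_trans _ _ (\sum_(i < k) ((Fl i.+1)%:R - (Fl i)%:R) * D)).
      by apply: ler_sum => i _; exact: gbound.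
    rewrite -mulr_suml ler_wpM2r//.
    rewrite -(big_mkord xpredT (fun i => (Fl i.+1)%:R - (Fl i)%:R)) telescope_sumr//.
    by rewrite gerBl.
  have Fk : (Fl k)%:R <= k%:R `^ beta :> R by rewrite truncn_le powR_ge0.
  have Dk : D <= alpha / c * (p%:R `^ gm / gm) * k%:R `^ gm.
    rewrite /D -[leRHS]mulrA ler_pM2l ?divr_gt0//.
    have := ln_le_powR gm0 pk0; rewrite natrM powRM// => /le_trans; apply.
    by rewrite mulrAC.
  apply: (@le_trans _ _ (k%:R `^ beta * (e * k%:R `^ gm * k%:R `^ gm))).
    rewrite ler_pM//; apply: le_trans Dk _.
    rewrite ler_wpM2r ?powR_ge0//.
    by rewrite [leRHS]mulrC -ler_pdivrMr.
  have -> : k%:R `^ beta * (e * k%:R `^ gm * k%:R `^ gm) =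
     e * (k%:R `^ beta * (k%:R `^ gm * k%:R `^ gm)) :> R by ring.
  rewrite -!powRD ?(gt_eqF kR) ?implybT//.
  have -> : beta + (gm + gm) = 1 by rewrite /gm; field.
  by rewrite powRr1// ltW.
apply/cvgrPdist_le => e e0.
(* The lower bound loses a factor 1 + e1 to the growth of the target since the last jump, another to
   the passage from g to g + 1, and e1 H to the constant C; 5 e1 covers all three. *)
pose e1 := Num.min e 1 / 5.
have me : 0 < Num.min e 1 by rewrite lt_min e0 ltr01.
have e10 : 0 < e1 by rewrite divr_gt0.
have e11 : 5 * e1 <= e by rewrite /e1 mulrC divfK// ge_min lexx.
have e12 : 5 * e1 <= 1 by rewrite /e1 mulrC divfK// ge_min lexx orbT.
have [C C0 hC] := digit_weight_succ e10.
have le1 : 0 < ln (1 + e1) by rewrite ln_gt0// ltrDl.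
have [N1 _ hN1] := jump_target_gap le1.
near=> k.
rewrite -SE; have k0 : (0 < k)%N by near: k; exists 1%N.
have CH : C * k.+1%:R <= e1 * H k by near: k; exact: linear_le_block_target.
have FH : F 2 * k.+1%:R <= e * H k by near: k; exact: linear_le_block_target.
have [j [jk jmp Fjk]] := last_jump k0.
have hgap : (p * k)%:R `^ alpha - (p * j.+1)%:R `^ alpha <= ln (1 + e1).
  by apply: (hN1 k) => //; near: k; exists N1.
have HHk : H k <= (1 + e1) * H j.+1.
  by rewrite -[1 + e1]lnK ?posrE ?addr_gt0// !HE -expRD ler_expR -lerBlDr.
(* At the last jump the greedy digit was maximal: its successor would have passed the target. *)
have Hj : H j.+1 <= (1 + e1) * S k + C.
  have := gP j; rewrite jmp => -[_ _ h].
  have h2 := hC (g j); have h3 := S_le _ _ jk; rewrite SS in h3.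
  have h4 := S0 j.
  have : 0 <= e1 * S j by rewrite mulr_ge0// ltW.
  have : (1 + e1) * (S j + F (g j)) <= (1 + e1) * S k by rewrite ler_pM2l ?addr_gt0.
  lra.
have CH' : C <= e1 * H k.
  by apply: le_trans CH; rewrite ler_peMr ?ler1n// ltW.
have Hk0 := H_gt0 k.
have low : (1 - 5 * e1) * H k <= S k.
  have h1 : H k <= (1 + e1) * ((1 + e1) * S k + e1 * H k).
    by rewrite (le_trans HHk)// ler_pM2l ?addr_gt0// (le_trans Hj)// lerD2l.
  have h2 : (1 - (1 + e1) * e1) * H k <= (1 + e1) * (1 + e1) * S k by lra.
  have q0 : 0 < (1 + e1) * (1 + e1) by rewrite mulr_gt0 ?addr_gt0.
  rewrite -(ler_pM2l q0) (le_trans _ h2)// mulrA ler_wpM2r ?(ltW Hk0)//.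
  have : 0 <= e1 * e1 by rewrite mulr_ge0 ?ltW.
  have : 0 <= e1 * e1 * e1 by rewrite !mulr_ge0 ?ltW.
  by have := e10; lra.
have up : S k <= (1 + e) * H k.
  apply: le_trans (upper k) _; rewrite mulrDl mul1r lerD2l (le_trans _ FH)//.
  by rewrite ler_pM2l// ler_nat.
rewrite ler_norml; apply/andP; split.
  by rewrite lerBrDl -lerBrDr opprK ler_pdivrMr// addrC.
rewrite lerBlDr -lerBlDl ler_pdivlMr// (le_trans _ low)// ler_pM2r//; lra.
Unshelve. all: by end_near. Qed.

End DigitSchedule.

(** * Full dimension for slow growth *)

Section SlowGrowth.
Context {R : realType} {d c : R} {f : nat -> R -> R} {phi : R -> R}.
Hypotheses (hd : 1 < d) (hf : decaying_gauss_like_ifs d f)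
  (hc0 : 0 < c) (hc1 : c < 1)
  (hphij : forall j : nat, (0 < j)%N ->
     potential_value f phi j = expR (j%:R `^ c)).

(** The triangle inequality along the images of the cuts suffices, whatever the orientation of the
    map. *)
Lemma children_lengths w J : posw w ->
  `|ifs_comp f w 0 - ifs_comp f w (cut f J)| <=
  \sum_(j <- iota 0 J) (hi f (rcons w j.+1) - lo f (rcons w j.+1)).
Proof.
move=> w0; elim: J => [|J IH]; first by rewrite big_nil (cut0 hf) subrr normr0.
rewrite -[J.+1]addn1 iotaD big_cat big_seq1 add0n addn1.
apply: le_trans (ler_distD (ifs_comp f w (cut f J)) _ _) _; rewrite lerD//.
have wJ : posw (rcons w J.+1) by rewrite -cats1 posw_cat w0.
rewrite (hi_sub_lo hf wJ) -cats1 !ifs_comp_cat.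
have J0 : posw [:: J.+1] by [].
have hJ := cut_hi hf (ltn0Sn J); have lJ := cut_lo (f := f) (ltn0Sn J).
by case: (ifs_compE hf J0) => -[l0 [l1 _]]; rewrite -l0 -l1 hJ lJ// distrC.
Qed.

(** There are infinitely many digits, so the total length 1 is only approached by finite families.
    Half of eta pays for the truncation at earlier levels, half for the last digit; the Lipschitz
    constants of the finitely many prefixes allow one common cutoff J. *)
Lemma level_lengths n eta : 0 < eta -> exists F : seq (seq nat),
  [/\ uniq F, {in F, forall w, posw w /\ size w = n} &
      1 - eta <= \sum_(w <- F) (hi f w - lo f w)].
Proof.
elim: n eta => [|n IH] eta eta0.
  exists [:: [::]]; split=> // [w|]; first by rewrite inE => /eqP ->.
  by rewrite big_seq1 (@hi_sub_lo _ _ _ hf [::])//= sub0r normrN normr1 gerBl ltW.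
have eta2 : 0 < eta / 2 by rewrite divr_gt0.
have [F [Fu FP Fsum]] := IH (eta / 2) eta2.
have /choice[L hL] : forall w, exists L : R, 0 < L /\ (posw w ->
    forall x y : R, x \in `[0, 1] -> y \in `[0, 1] ->
    `|ifs_comp f w x - ifs_comp f w y| <= L * `|x - y|).
  move=> w; have [w0|w0] := boolP (posw w); last by exists 1.
  by have [L ? ?] := ifs_comp_lipschitz hf w0; exists L.
pose Lam := \sum_(w <- F) L w + 1.
have Lam0 : 0 < Lam by rewrite ltr_wpDl// sumr_ge0// => w _; rewrite ltW// (hL w).1.
have [J hJ] : exists J, 1 - eta / 2 / Lam <= cut f J.
  by apply: (cut_cofinal hf); rewrite ltrBlDr ltrDl divr_gt0.
exists [seq rcons w j.+1 | w <- F, j <- iota 0 J]; split.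
- apply: allpairs_uniq; rewrite ?iota_uniq//.
  by move=> [w j] [w' j'] _ _ /= /rcons_inj[-> ->].
- move=> _ /allpairsP[[w j] [/= wF _ ->]]; have [w0 sw] := FP w wF.
  by rewrite size_rcons sw -cats1 posw_cat w0.
rewrite big_allpairs_dep/=.
apply: (@le_trans _ _ (\sum_(w <- F) ((hi f w - lo f w) - L w * (eta / 2 / Lam)))).
  rewrite sumrB -mulr_suml.
  have h : (\sum_(w <- F) L w) * (eta / 2 / Lam) <= eta / 2.
    rewrite mulrA ler_pdivrMr// mulrC ler_pM2l//.
    by rewrite /Lam lerDl.
  by move: Fsum h; lra.
rewrite big_seq [leRHS]big_seq; apply: ler_sum => w wF; have [w0 _] := FP w wF.
apply: le_trans (children_lengths J w0).
have cJ : cut f J \in `[0, 1] by rewrite in_itv/= (cut_ge0 hf) ltW// (cut_lt1 hf).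
have [L0 /(_ w0 1 (cut f J) in01_1 cJ) hLw] := hL w.
have := ler_distD (ifs_comp f w (cut f J)) (ifs_comp f w 0) (ifs_comp f w 1).
rewrite (hi_sub_lo hf w0) (distrC (ifs_comp f w (cut f J)) (ifs_comp f w 1)).
have h1 : `|1 - cut f J| <= eta / 2 / Lam.
  by have c1 := ltW (cut_lt1 hf J); rewrite ger0_norm ?subr_ge0// lerBlDr -lerBlDl.
have := ler_wpM2l (ltW L0) h1; lra.
Qed.

Lemma length_le1 w : posw w -> hi f w - lo f w <= 1.
Proof.
move=> w0; have := ifs_comp_in01 hf w0 in01_0; have := ifs_comp_in01 hf w0 in01_1.
by rewrite (hi_sub_lo hf w0) !in_itv/= => /andP[? ?] /andP[? ?];
  rewrite ler_norml; apply/andP; split; lra.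
Qed.

(* The factor kappa is what each word of the family loses to distortion and to
   the digit inserted in front of it in [slow_lower]. *)
Lemma good_block (s kappa : R) : 0 < s -> s < 1 -> 0 < kappa ->
  exists (p : nat) (V : seq (seq nat)) (ell : R),
  [/\ uniq V, {in V, forall v, [/\ posw v, size v = p & ell <= hi f v - lo f v]},
      0 < ell, ell <= 1 & 2 <= (size V)%:R * (kappa * ell) `^ s].
Proof.
move=> s0 s1 k0.
have C0 : 0 < 2 / kappa `^ s by rewrite divr_gt0// powR_gt0.
have [rho rho0 hrho] := size_class s0 s1 C0.
have [n n0 hn] := cylinder_shrink hf rho0.
have half0 : 0 < 2^-1 :> R by rewrite invr_gt0.
have [F [Fu FP Fsum]] := level_lengths n half0.
have Fhalf : 2^-1 <= \sum_(w <- F) (hi f w - lo f w) by lra.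
have [||ell [l0 lr hell]] := hrho _ F (fun w => hi f w - lo f w) => //.
  by move=> w /FP[pw sw]; exact: hn.
exists n, [seq w <- F | ell <= hi f w - lo f w], ell.
have hV : 2 <= (size [seq w <- F | ell <= hi f w - lo f w])%:R * (kappa * ell) `^ s.
  rewrite size_filter powRM ?(ltW k0) ?(ltW l0)// mulrCA mulrC -ler_pdivrMr//.
  exact: powR_gt0.
split=> //; first exact: filter_uniq.
  by move=> v; rewrite mem_filter => /andP[lv /FP[]].
have : has (fun w => ell <= hi f w - lo f w) F.
  rewrite has_count -size_filter lt0n; apply/negP => /eqP V0.
  by move: hV; rewrite V0 mul0r; lra.
by move=> /hasP[w /FP[pw _] lw]; apply: le_trans lw _; exact: length_le1.
Qed.

(** The other digits of the blocks add at most Mb per block, which is negligible against H, and H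
    changes by a factor close to 1 over a block; hence the limit along the inserted digits is the
    limit along all digits. *)
Lemma block_birkhoff (alpha : R) (p : nat) (g : nat -> nat) (B : nat -> seq nat)
    (Mb : R) (F H : nat -> R) :
  0 < alpha -> alpha < 1 ->
  (forall k, H k = expR ((p.+1 * k)%:R `^ alpha)) ->
  (forall j, 0 <= F j) ->
  (forall k, exists2 v, B k = g k :: v & size v = p /\ \sum_(j <- v) F j <= Mb) ->
  (fun k => (\sum_(i < k) F (g i)) / H k) @ \oo --> (1 : R) ->
  (fun n => (\sum_(k < n) F (block_digits p.+1 B k)) / expR (n%:R `^ alpha)) @ \oo --> (1 : R).
Proof.
move=> a0 a1 HE F0 BP glim; set a := block_digits p.+1 B.
pose S n := \sum_(k < n) F (a k).
pose Gs k := \sum_(i < k) F (g i).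
have H0 k : 0 < H k by rewrite HE expR_gt0.
have S_le m n : (m <= n)%N -> S m <= S n.
  move=> mn; rewrite /S -!(big_mkord xpredT (fun k => F (a k))) (big_cat_nat (n := m) _ mn)//=.
  by rewrite lerDl sumr_ge0.
have blockE k : \sum_(i < p.+1) F (a (k * p.+1 + i)%N) = \sum_(j <- B k) F j.
  have [v Bk [sv _]] := BP k; rewrite (big_nth 0%N) Bk/= sv big_mkord.
  apply: eq_bigr => i _; rewrite /a /block_digits divnMDl// divn_small// addn0.
  by rewrite modnMDl modn_small// Bk.
have SS k : S (k.+1 * p.+1)%N = S (k * p.+1)%N + \sum_(j <- B k) F j.
  by rewrite -blockE /S mulSnr big_split_ord.
have lowS k : Gs k <= S (k * p.+1)%N.
  elim: k => [|k IH]; first by rewrite /Gs /S !big_ord0.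
  rewrite SS /Gs big_ord_recr/= lerD//; have [v -> _] := BP k.
  by rewrite big_cons lerDl sumr_ge0.
have upS k : S (k * p.+1)%N <= Gs k + Mb * k%:R.
  elim: k => [|k IH]; first by rewrite /Gs /S !big_ord0 mulr0 addr0.
  rewrite SS /Gs big_ord_recr/= -natr1 mulrDr mulr1; have [v -> [_ hv]] := BP k.
  by rewrite big_cons; rewrite -/(Gs k); lra.
apply/cvgrPdist_le => e e0.
(* The upper bound comes to (1 + e1)^2 + e1, at most 1 + 4 e1 as e1 <= 1. *)
pose e1 := Num.min e 1 / 4.
have me : 0 < Num.min e 1 by rewrite lt_min e0 ltr01.
have e10 : 0 < e1 by rewrite divr_gt0.
have e11 : 4 * e1 <= e by rewrite /e1 mulrC divfK// ge_min lexx.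
have e12 : 4 * e1 <= 1 by rewrite /e1 mulrC divfK// ge_min lexx orbT.
have le1 : 0 < ln (1 + e1) by rewrite ln_gt0// ltrDl.
have [N1 _ hN1] := block_target_gap a0 a1 (ltn0Sn p) le1.
have [N2 _ hN2] := linear_le_block_target a0 (ltn0Sn p) HE Mb e10.
move/cvgrPdist_le : glim => /(_ e1 e10)[N3 _ hN3].
pose N := maxn N1 (maxn N2 N3).
exists (N * p.+1)%N => // n /= Nn.
pose k := (n %/ p.+1)%N.
have Nk : (N <= k)%N by rewrite leq_divRL.
have h1 : H k.+1 <= (1 + e1) * H k.
  rewrite -[1 + e1]lnK ?posrE ?addr_gt0// !HE -expRD ler_expR -lerBlDr.
  by apply: hN1; rewrite /= (leq_trans _ Nk)// leq_maxl.
have h2 : Mb * k.+1%:R <= e1 * H k.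
  by apply: hN2; rewrite /= (leq_trans _ Nk)// leq_max leq_maxl orbT.
have gk m : (N <= m)%N -> (1 - e1) * H m <= Gs m /\ Gs m <= (1 + e1) * H m.
  move=> Nm; have /= := hN3 m (leq_trans (leq_trans (leq_maxr _ _) (leq_maxr _ _)) Nm).
  rewrite ler_norml -/(Gs m) => /andP[q1 q2].
  by split; rewrite -?(ler_pdivlMr _ _ (H0 m)) -?(ler_pdivrMr _ _ (H0 m)); lra.
have [h3 _] := gk k Nk; have [_ h4] := gk k.+1 (leqW Nk).
have kn : (k * p.+1 <= n)%N by exact: leq_divM.
have nk : (n < k.+1 * p.+1)%N by exact: ltn_ceil.
have Phi0 : 0 < expR (n%:R `^ alpha) :> R by exact: expR_gt0.
have HP : H k <= expR (n%:R `^ alpha).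
  by rewrite HE ler_expR ge0_ler_powR ?nnegrE ?(ltW a0)// ler_nat mulnC.
have PH : expR (n%:R `^ alpha) <= H k.+1.
  by rewrite HE ler_expR ge0_ler_powR ?nnegrE ?(ltW a0)// ler_nat mulnC ltnW.
have l1 : Gs k <= S n := le_trans (lowS k) (S_le _ _ kn).
have u1 : S n <= Gs k.+1 + Mb * k.+1%:R := le_trans (S_le _ _ (ltnW nk)) (upS k.+1).
have Hk := H0 k.
rewrite -/(S n) ler_norml; move: (S n) (Gs k) (Gs k.+1) (expR _) (H k) (H k.+1) (Mb * _) Hk Phi0 HP PH l1 u1 h1 h2 h3 h4.
move: e1 e10 e11 e12 {gk le1 hN1 hN2 hN3} => x x0 xe x1 s g0 g2 P h h' m h0 P0 hP Ph' l1 u1 k1 k2 k3 k4.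
have xx : 0 <= x * x by rewrite mulr_ge0 ?ltW.
have x2 : x * x <= x by rewrite ler_piMr ?(ltW x0)//; lra.
apply/andP; split.
  rewrite lerBrDl -lerBrDr opprK ler_pdivrMr// addrC.
  have : (1 + x) * h' <= (1 + x) * ((1 + x) * h) by rewrite ler_pM2l ?addr_gt0.
  have : ((1 + x) * (1 + x) + x) * h <= (1 + e) * P by rewrite ler_pM//; lra.
  lra.
rewrite lerBlDr -lerBlDl ler_pdivlMr//.
have q1 : (1 - x) * P <= (1 + x) * s.
  have : (1 - x) * P <= (1 - x) * ((1 + x) * h) by rewrite ler_pM2l; lra.
  have : (1 + x) * ((1 - x) * h) <= (1 + x) * s by rewrite ler_pM2l ?addr_gt0//; lra.
  lra.
rewrite -(ler_pM2l (_ : 0 < 1 + x)) ?addr_gt0// (le_trans _ q1)// mulrA ler_wpM2r ?ltW//.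
have : 0 <= x * e by rewrite mulr_ge0 ?ltW.
lra.
Qed.

Hypothesis hbd : bounded_distortion f.

(** [bounded_distortion] concerns nonempty words; K <= 1 extends its lower bound to an empty
    prefix. *)
Lemma length_cat : exists K, [/\ 0 < K, K <= 1 & forall u w, posw u -> posw w -> (0 < size w)%N ->
  K * (hi f u - lo f u) * (hi f w - lo f w) <= hi f (u ++ w) - lo f (u ++ w)].
Proof.
have [K3 [K4 [K30 K40 hK]]] := hbd.
exists (Num.min K3 1); split; first by rewrite lt_min K30 ltr01.
  by rewrite ge_min lexx orbT.
move=> u w u0 w0 sw.
have lw : 0 < hi f w - lo f w by rewrite subr_gt0 (lo_lt_hi hf).
have lu : 0 < hi f u - lo f u by rewrite subr_gt0 (lo_lt_hi hf).
have [u1|] := posnP (size u).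
  have -> : u = [::] by apply: size0nil.
  rewrite cat0s (@hi_sub_lo _ _ _ hf [::])//= sub0r normrN normr1 mulr1.
  by rewrite ler_piMl ?ge_min ?lexx ?orbT// ltW.
move=> su; have wu : word u by rewrite /word su.
have ww : word w by rewrite /word sw.
have /andP[+ _] := hK u w wu ww.
rewrite !(basic_lengthE hf)// ?posw_cat ?u0//.
rewrite ler_pdivlMr ?mulr_gt0// => /(le_trans _); apply.
by rewrite -mulrA ler_pM2r ?mulr_gt0// ge_min lexx.
Qed.

Lemma slow_lower (s alpha : R) : 0 < s -> s < 1 -> 0 < alpha -> alpha < 1 ->
  hausdorff_measure s
    (birkhoff_level_set f phi (fun n : nat => expR (n%:R `^ alpha))) <> 0%E.
Proof.
move=> s0 s1 a0 a1.
have [K [K0 K1 hK]] := length_cat.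
have [K2 [K2' [K20 K20' hK2]]] := ifs_bilipschitz hf ltr01.
(* The crude exponent d + 1 is good enough, as the inserted digits only enter through a sum of
   logarithms of order o(k). *)
pose D := d + 1; have D0 : 0 < D by have := hd; rewrite /D; lra.
pose xi := Num.min K2 1; have xi0 : 0 < xi by rewrite lt_min K20 ltr01.
have xi1 : xi <= 1 by rewrite ge_min lexx orbT.
(* The loss per block when the inserted digit is 2. A larger digit g costs a further (g/2)^D, kept
   apart in [lk]. *)
pose kappa := K * xi / 2 `^ D; have kappa0 : 0 < kappa by rewrite divr_gt0 ?mulr_gt0 ?powR_gt0.
have kappa_half : kappa <= 2^-1.
  have h1 : K * xi <= 1 by rewrite mulr_ile1 ?(ltW K0) ?(ltW xi0).
  have h2 : 2 <= 2 `^ D :> R by rewrite le1r_powR// ?ler1n// /D; have := hd; lra.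
  rewrite /kappa ler_pdivrMr ?powR_gt0// (le_trans h1)// -(ler_pM2l (ltr0Sn R 1)).
  by rewrite mulrA divff// mul1r mulr1.
have [p [V [ell [Vu VP ell0 ell1 V2]]]] := good_block s0 s1 kappa0.
have V0 : (0 < size V)%N.
  by rewrite lt0n; apply/negP => /eqP e; move: V2; rewrite e mul0r; lra.
pose H k : R := expR ((p.+1 * k)%:R `^ alpha).
pose F j : R := expR (j%:R `^ c).
have [g [g1 glog glim]] := @digit_schedule R alpha c p.+1 a0 a1 hc0 hc1 isT H F
  (fun=> erefl) (fun=> erefl).
pose W k := [seq g k :: v | v <- V].
have WP k w : w \in W k -> exists2 v, w = g k :: v & v \in V.
  by move=> /mapP[v vV ->]; exists v.
have sizeW k : size (W k) = size V by rewrite size_map.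
pose k0 := ln (kappa * ell); have k0E : expR k0 = kappa * ell by rewrite lnK ?posrE ?mulr_gt0.
pose lk k := expR (k0 * k%:R - D * \sum_(i < k) ln ((g i)%:R / 2)).
have lkS k : lk k.+1 = lk k * expR (k0 - D * ln ((g k)%:R / 2)).
  by rewrite /lk -expRD big_ord_recr/= -natr1; congr expR; ring.
have block k v : v \in V -> posw (g k :: v) /\
    expR (k0 - D * ln ((g k)%:R / 2)) <= K * (hi f (g k :: v) - lo f (g k :: v)).
  move=> /VP[pv sv lv]; have gk0 : (0 < g k)%N by exact: ltnW (g1 k).
  have gR : 0 < (g k)%:R :> R by rewrite ltr0n.
  have pgv : posw (g k :: v) by rewrite /= gk0.
  split=> //; rewrite (hi_sub_lo hf pgv)/=.
  have /andP[+ _] := hK2 (g k) gk0 _ _ (ifs_comp_in01 hf pv in01_0) (ifs_comp_in01 hf pv in01_1).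
  rewrite -(hi_sub_lo hf pv) -/D => h.
  have -> : expR (k0 - D * ln ((g k)%:R / 2)) = K * (xi / (g k)%:R `^ D * ell).
    rewrite expRB k0E -ln_powR lnK ?posrE ?powR_gt0 ?divr_gt0//.
    rewrite powRM ?invr_ge0// -[2^-1](powR_inv1 (ler0n R 2)) powRAC powR_inv1 ?powR_ge0//.
    rewrite /kappa; field.
    by rewrite !gt_eqF ?powR_gt0.
  rewrite ler_pM2l//; apply: le_trans h; rewrite ler_pM ?divr_ge0 ?powR_ge0 ?(ltW xi0) ?(ltW ell0)//.
  by rewrite ler_wpM2r ?invr_ge0 ?powR_ge0// ge_min lexx.
have lk_le k v : v \in tree_level W k ->
    posw (flatten v) /\ lk k <= hi f (flatten v) - lo f (flatten v).
  elim: k v => [|k IH] v.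
    rewrite inE => /eqP ->; split=> //.
    rewrite (@hi_sub_lo _ _ _ hf [::])//= sub0r normrN normr1.
    by rewrite /lk big_ord0 !mulr0 subr0 expR0.
  case/lastP: v => [/allpairsP[[[|? ?] ?] [_ _]]//|u w].
  rewrite tree_levelS => /andP[/IH[pu hu] /WP[v -> vV]].
  have [pgv hgv] := block k v vV.
  rewrite flatten_rcons posw_cat pu pgv; split=> //.
  apply: le_trans (hK _ _ pu pgv isT); rewrite lkS mulrAC mulrC.
  by rewrite ler_pM ?expR_ge0.
have half_pow k : lk k <= 2^-1 ^+ k.
  elim: k => [|k IH]; first by rewrite /lk big_ord0 !mulr0 subr0 expR0 expr0.
  rewrite lkS exprSr ler_pM ?expR_ge0//.
  have h1 : 0 <= D * ln ((g k)%:R / 2).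
    rewrite mulr_ge0 ?(ltW D0)// ln_ge0// ler_pdivlMr// mul1r ler_nat.
    exact: g1.
  apply: (@le_trans _ _ (expR k0)); first by rewrite ler_expR gerBl.
  by rewrite k0E (le_trans _ kappa_half)// ler_piMr// ltW.
(* The logarithmic gain of mass per block, at least ln 2 by the choice of V. *)
pose theta := ln (size V)%:R + s * k0.
have VR : 0 < (size V)%:R :> R by rewrite ltr0n.
have theta2 : ln 2 <= theta.
  have pk : 0 < (kappa * ell) `^ s by rewrite powR_gt0 ?mulr_gt0.
  have -> : theta = ln ((size V)%:R * (kappa * ell) `^ s) by rewrite lnM ?posrE// ln_powR.
  by rewrite ler_ln ?posrE ?mulr_gt0.
have ln2 : 0 < ln 2 :> R by rewrite ln_gt0// ltr1n.
have sD : 0 < s * D by rewrite mulr_gt0.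
pose E k := k%:R * theta - s * D * \sum_(i < k.+1) ln ((g i)%:R / 2).
have [b hb] : exists b, forall k, b <= E k.
  apply: bounded_below_of_near.
  (* With this e the inserted digits consume at most half of ln 2 per block, and (k + 1) / 2 <= k
     leaves the balance nonnegative. *)
  have e0 : 0 < ln 2 / (2 * (s * D)) by rewrite divr_gt0// mulr_gt0.
  have [N _ hN] := glog _ e0.
  exists N.+1 => // k /= Nk; have /= := hN k.+1 (leqW (ltnW Nk)).
  move=> /(ler_wpM2l (ltW sD)).
  have cancel_u (u x y : R) : 0 < u -> u * (x / (2 * u) * y) = x / 2 * y.
    by move=> u0; field; rewrite gt_eqF.
  rewrite cancel_u// => hlog.
  have k1 : 1 <= k%:R :> R by rewrite ler1n (leq_trans _ Nk).
  have : ln 2 * k%:R <= theta * k%:R by rewrite ler_wpM2r.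
  rewrite /E -natr1; nra.
apply: (@moran_not_null _ _ _ hf p.+1 W lk s (expR (b + s * k0))) => //.
- by move=> k; rewrite sizeW.
- by move=> k; rewrite map_inj_uniq// => v v' [].
- move=> k w /WP[v -> vV]; have [pgv _] := block k v vV; have [_ sv _] := VP v vV.
  by rewrite /= sv.
- by move=> k; exact: expR_gt0.
- move=> r r0; have i0 : 0 < 2^-1 :> R by rewrite invr_gt0.
  have i1 : 2^-1 < 1 :> R by rewrite invf_lt1// ltr1n.
  have [k hk] := expr_small i0 i1 r0.
  by exists k; exact: le_trans (half_pow k) hk.
- by move=> k v /lk_le[].
- exact: ltW.
- exact: expR_gt0.
- move=> k; under eq_bigr do rewrite sizeW; rewrite sizeW prodr_const card_ord.
  have N1 : 1 <= (size V)%:R :> R by rewrite ler1n.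
  apply: (@le_trans _ _ ((size V)%:R ^+ k * lk k.+1 `^ s)); last first.
    rewrite ler_wpM2l ?exprn_ge0// ge0_ler_powR ?nnegrE ?mulr_ge0 ?expR_ge0 ?(ltW s0)//.
    by rewrite ler_peMl ?expR_ge0.
  rewrite -[in leRHS](lnK (_ : (size V)%:R \is Num.pos)) ?posrE// -expRM_natl.
  rewrite powR_expR -expRD ler_expR.
  have := hb k; rewrite /E /theta -natr1; lra.
move=> B BW x hx; pose a := block_digits p.+1 B.
have BV k : exists2 v, B k = g k :: v & v \in V by exact: WP (BW k).
have a_pos k : (0 < a k)%N by have [] := hx.
split.
  apply: (first_digit_open hf hx); rewrite /block_digits div0n mod0n.
  by have [v -> _] := BV 0%N; exact: g1.
exists a; split; first exact: hx.
have -> : birkhoff_sum f phi a = fun n => \sum_(k < n) F (a k).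
  by apply/funext => n; apply: eq_bigr => k _; rewrite hphij.
apply: (@block_birkhoff alpha p g B (\sum_(v <- V) \sum_(j <- v) F j) F H) => //.
  by move=> j; exact: expR_ge0.
move=> k; have [v Bk vV] := BV k; have [_ sv _] := VP v vV; exists v => //; split=> //.
by rewrite (big_rem v)//= lerDl sumr_ge0// => u _; rewrite sumr_ge0// => j _; exact: expR_ge0.
Qed.

Lemma unit_interval_null (s : R) : 1 < s ->
  hausdorff_measure s [set x : R | x \in `]0, 1[] = 0%E.
Proof.
move=> s1; apply: hausdorff_null_finite_covers; first lra.
move=> eta eta0; have s10 : 0 < s - 1 by lra.
have [N _ hN] := powR_unbounded s10 eta^-1.
pose n := N.+1; have n0 : 0 < n%:R :> R by rewrite ltr0n.
exists nat, (iota 0 n), (fun i => [set x : R | i%:R / n%:R <= x <= i.+1%:R / n%:R]),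
  (fun=> n%:R^-1); split.
- move=> x /=; rewrite in_itv/= => /andP[x0 x1].
  have xn : 0 <= x * n%:R by rewrite mulr_ge0 ?ltW.
  have /andP[h1 h2] := truncn_itv xn.
  exists (Num.truncn (x * n%:R)); last first.
    by rewrite ler_pdivrMr// h1/= ler_pdivlMr// ltW.
  rewrite [_ \in _](mem_iota 0 n)/= add0n -(ltr_nat R) (le_lt_trans h1)//.
  by rewrite gtr_pMl.
- move=> i _; apply: diam_le; first by rewrite invr_ge0.
  move=> x y /= /andP[? ?] /andP[? ?].
  have e : i.+1%:R / n%:R = i%:R / n%:R + n%:R^-1 :> R by rewrite -natr1 mulrDl mul1r.
  by rewrite ler_norml; apply/andP; split; lra.
rewrite big_const_seq count_predT iter_addr addr0 -[leLHS]mulr_natl size_iota.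
have := hN n (leqnSn N) => /= h.
rewrite -[n%:R^-1](powR_inv1 (ltW n0)) powRAC powR_inv1 ?powR_ge0//.
rewrite -(@mulr_powRB1 _ n%:R s) ?(ltW n0)//; last lra.
by rewrite invfM mulrA (divff (lt0r_neq0 n0)) mul1r -[leRHS]invrK lef_pV2 ?posrE ?invr_gt0 ?powR_gt0.
Qed.

Theorem slow_hausdorff_dim (alpha : R) : 0 < alpha -> alpha < 1 ->
  hausdorff_dim (birkhoff_level_set f phi (fun n : nat => expR (n%:R `^ alpha))) = 1%:E.
Proof.
move=> a0 a1; apply: hausdorff_dim_eq => //.
  move=> s s1; apply: (hausdorff_null_sub _ _ (unit_interval_null s1)); last lra.
  by move=> x [].
by move=> s s0 s1; exact: slow_lower.
Qed.

End SlowGrowth.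

Theorem theorem1p4 (R : realType) (d : R) (f : nat -> R -> R) (c : R)
    (phi : R -> R) (hd : 1 < d) (hf : decaying_gauss_like_ifs d f)
    (hc0 : 0 < c) (hc1 : c < 1) (hphi : potential f phi)
    (hphij : forall j : nat, (0 < j)%N ->
       potential_value f phi j = expR (j%:R `^ c)) :
  [/\ forall alpha : R, 0 < alpha ->
        let Phi := fun n : nat => expR (n%:R `^ alpha) in
        (alpha < 1 -> bounded_distortion f ->
           hausdorff_dim (birkhoff_level_set f phi Phi) = 1%:E) /\
        (1 < alpha ->
           hausdorff_dim (birkhoff_level_set f phi Phi) = ((1 - c) / d)%:E),
      forall beta : R, 1 < beta ->
        hausdorff_dim
          (birkhoff_level_set f phi (fun n : nat => expR (beta ^+ n)))
          = ((1 - c) / d)%:E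
    & forall gamma : R, 1 < gamma ->
        hausdorff_dim
          (birkhoff_level_set f phi (fun n : nat => expR (expR (gamma ^+ n))))
          = ((1 - c) / (d * gamma - (1 - c) * (gamma - 1)))%:E].
Proof.
split=> [alpha a0 Phi|beta b1|gamma g1].
- split=> [a1 hbd|a1].
    exact (slow_hausdorff_dim hd hf hc0 hc1 hphij hbd a0 a1).
  exact (stretched_exponential_dim hd hf hc0 hc1 hphij a1).
- exact (double_exponential_dim hd hf hc0 hc1 hphij b1).
- exact (triple_exponential_dim hd hf hc0 hc1 hphij g1).
Qed.
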